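(* The following bounds hold: $$\varrho_4(11) \leq \frac{4}{7},\qquad \varrho_5(12) \leq \frac{10}{19},\qquad \varrho_6(12) \leq \frac{5}{12},\qquad \varrho_6(14) \leq \frac{12}{23}.$$ Moreover, $\varrho_5(12) = \frac{10}{19}$.
   Context: For a graph $G$ and an integer $p\ge 2$, the $p$-independence number is $\alpha_p(G) := \max\{|U| : U \subseteq V(G),\ G[U] \text{ is } K_p\text{-free}\}$. The Ramsey–Turán number $RT_p(n,K_q,m)$ is the maximum number of edges in an $n$-vertex $K_q$-free graph $G$ with $\alpha_p(G) \le m$. The Ramsey–Turán density is $$\varrho_p(q) := \lim_{\varepsilon \to 0}\lim_{n\to\infty} \frac{RT_p(n,K_q,\varepsilon n)}{\binom{n}{2}}$$ (the paper assumes this limit exists; for upper bounds the inner limit may be read as a limit superior). *)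

(* Defs.v *)
From HB Require Import structures.
From mathcomp Require Import all_boot all_order all_algebra.
From mathcomp Require Import all_classical all_reals all_analysis.
Import Order.TTheory GRing.Theory Num.Theory.
Import numFieldNormedType.Exports.

Set Implicit Arguments.
Unset Strict Implicit.
Unset Printing Implicit Defensive.

Section Graphs.
Variable T : finType.
Implicit Types (E : {set {set T}}) (U W : {set T}) (p : nat).

(* A simple graph on the vertex set T is given by its set of edges, each edge
   being a two-element set of vertices. *)
Definition is_sgraph E : bool := [forall e in E, #|e| == 2].

Definition is_clique E W : bool :=
  [forall x in W, forall y in W, (x != y) ==> ([set x; y]%SET \in E)].

Definition Kfree_on E p U : bool :=
  [forall W : {set T}, (W \subset U) && (#|W| == p) ==> ~~ is_clique E W].

Definition Kfree E p : bool := Kfree_on E p [set: T]%SET.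

Definition independence_number E p : nat :=
  \max_(U : {set T} | Kfree_on E p U) #|U|.

End Graphs.

Local Open Scope classical_set_scope.
Local Open Scope ereal_scope.

Section RamseyTuran.
Variable R : realType.
Implicit Types (p q n : nat) (m eps : R).

(* If no graph qualifies, the maximum is 0; for p < q and a fixed eps > 0 this
   concerns only finitely many n when m = eps * n. *)
Definition ramsey_turan p n q m : nat :=
  \max_(E : {set {set 'I_n}} | [&& is_sgraph E, Kfree E q &
                               ((independence_number E p)%:R <= m :> R)%R]) #|E|.

Definition ramsey_turan_ratio p q eps n : R :=
  ((ramsey_turan p n q (eps * n%:R))%:R / 'C(n, 2)%:R)%R.

Definition ramsey_turan_limsup p q eps : \bar R :=
  limn_esup (fun n => (ramsey_turan_ratio p q eps n)%:E).

Definition ramsey_turan_liminf p q eps : \bar R :=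
  limn_einf (fun n => (ramsey_turan_ratio p q eps n)%:E).

(* The density with the inner limit read as a limit superior, respectively
   inferior.  Both outer limits exist (is_cvg_ramsey_turan_limsup and
   is_cvg_ramsey_turan_liminf below). *)
Definition upper_ramsey_turan_density p q : \bar R :=
  lim (ramsey_turan_limsup p q eps @[eps --> 0^'+]%R).

Definition lower_ramsey_turan_density p q : \bar R :=
  lim (ramsey_turan_liminf p q eps @[eps --> 0^'+]%R).

(* The iterated limit equals r.  Since lower <= upper for every eps, this says
   that all limit points, as n grows, of the ratio for a fixed eps tend to r as
   eps tends to 0 from the right; it is implied by the literal iterated limit
   and requires no inner limit to exist at any individual eps. *)
Definition ramsey_turan_density_eq p q (r : \bar R) : Prop :=
  lower_ramsey_turan_density p q = r /\ upper_ramsey_turan_density p q = r.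

Lemma ramsey_turan_mono p n q m m' : (m <= m')%R ->
  (ramsey_turan p n q m <= ramsey_turan p n q m')%N.
Proof.
move=> mm'; apply/bigmax_leqP => E /and3P[gE kE aE].
apply: (@leq_bigmax_cond _ _ (fun E : {set {set 'I_n}} => #|E|)).
by rewrite gE kE (le_trans aE mm').
Qed.

Lemma ramsey_turan_ratio_mono p q n eps eps' : (eps <= eps')%R ->
  (ramsey_turan_ratio p q eps n <= ramsey_turan_ratio p q eps' n)%R.
Proof.
move=> ee'; apply: ler_wpM2r; first by rewrite invr_ge0 ler0n.
by rewrite ler_nat; apply: ramsey_turan_mono; rewrite ler_wpM2r.
Qed.

Lemma le_limn_esup (u v : (\bar R)^nat) : (forall n, u n <= v n) ->
  limn_esup u <= limn_esup v.
Proof.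
move=> uv; rewrite /limn_esup !limf_esupE.
apply: le_ereal_inf_tmp => _ [A FA <-].
apply: (@le_trans _ _ (ereal_sup (u @` A))).
  by apply: ereal_inf_lbound; exists A.
apply: ge_ereal_sup => _ [n An <-]; apply: (le_trans (uv n)).
by apply: ereal_sup_ubound; exists n.
Qed.

Lemma ramsey_turan_limsup_mono p q :
  {homo ramsey_turan_limsup p q : x y / (x <= y)%R >-> x <= y}.
Proof.
move=> x y xy; apply: le_limn_esup => n.
by rewrite lee_fin ramsey_turan_ratio_mono.
Qed.

Lemma ramsey_turan_liminf_mono p q :
  {homo ramsey_turan_liminf p q : x y / (x <= y)%R >-> x <= y}.
Proof.
move=> x y xy; rewrite leeN2; apply: le_limn_esup => n.
by rewrite leeN2 lee_fin ramsey_turan_ratio_mono.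
Qed.

Lemma is_cvg_ramsey_turan_limsup p q :
  cvg (ramsey_turan_limsup p q eps @[eps --> 0^'+]%R).
Proof.
apply: nondecreasing_at_right_is_cvge; near=> e => x y _ _.
exact: ramsey_turan_limsup_mono.
Unshelve. all: by end_near. Qed.

Lemma is_cvg_ramsey_turan_liminf p q :
  cvg (ramsey_turan_liminf p q eps @[eps --> 0^'+]%R).
Proof.
apply: nondecreasing_at_right_is_cvge; near=> e => x y _ _.
exact: ramsey_turan_liminf_mono.
Unshelve. all: by end_near. Qed.

End RamseyTuran.

Arguments upper_ramsey_turan_density : clear implicits.
Arguments lower_ramsey_turan_density : clear implicits.
Arguments ramsey_turan_density_eq : clear implicits.

(* Main.v *)
(* Upper bounds.  Refine a balanced partition by the regularity lemma and round
   the densities of the regular pairs up to multiples of 1/p, which gives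
   integral weights W <= p on the pairs of clusters.  Since every large set of
   vertices contains a K_p, clusters can be filled greedily: in each of them but
   the last one may choose one vertex, or p minus the deficits p - W towards the
   later clusters, and all p in the last one.  So K_q-freeness bounds the sums of W
   over small cliques of clusters, and the quadratic form of W is bounded on the
   simplex by a Motzkin-Straus argument and by linear programming duality.

   Lower bound for (5, 12).  A Bollobas-Erdos type graph on 19 copies of a discrete
   torus (Z/m)^d, in classes of 9, 5 and 5 copies.  Inside a class x is joined to y
   if y is close to a rotation of x by 2 pi i / 5, i <> 0: cliques have at most five
   vertices, and concentration of measure puts a K_5 inside every dense set.  The
   first class is joined completely to the other two, and these two are joined to
   each other when Re <x, y> <= - rho and Re <w x, y> >= rho, w the rotation by
   2 pi / 5: a pentagon identity limits cliques on the last two classes to six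
   vertices, and up to a set of small measure one of the five rotates of each pair
   is an edge, so the density is 1/5.  A blow-up gives all numbers of vertices. *)
From HB Require Import structures.
Require Import Defs.
From mathcomp Require Import all_classical all_reals all_analysis.
From mathcomp Require Import all_boot all_order all_algebra.
From mathcomp Require Import ring lra zify.

Set Implicit Arguments.
Unset Strict Implicit.
Unset Printing Implicit Defensive.
Import Order.TTheory GRing.Theory Num.Theory.
Import numFieldNormedType.Exports.
Local Open Scope ring_scope.

(** * Quadratic forms on the simplex *)

(** For a clique [s] of clusters the fillings yield two families of inequalities:
    [W a b + p + |s| <= q + 1] for pairs and [W a b + W a c + W b c + |s| <= q + 2] for triples.
    They force small weights on large cliques, so few clusters decide the constants: for (4, 11),
    (5, 12) and (6, 14) a triangle with weights p, p, q - 1 - 2p, and for (6, 12) a single pair of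
    weight 5. The triangle 5, 5, 1 has densities 1, 1, 1/5 and optimal masses 9 : 5 : 5, which is
    exactly what the lower bound realises.

    The lower bound needs a radius [rho] fixed before the dimension: large enough for concentration
    at density [eps], yet negligible against [d] (separation of rotates) and against typical values
    of Re <x, y> (density of the cross edges). A finite group makes all measures cardinalities.
    Concentration with a dimension-free radius then follows from a Poincare inequality, obtained by
    averaging one coordinate at a time, and Chebyshev's inequality; anticoncentration follows by
    packing disjoint rotated copies of a set. *)

Section Forms.
Variable R : realFieldType.
Implicit Types (x y z : R).

(** As [x y >= x z >= y z], the best weights are [wm] on both pairs at the heaviest vertex and the
    rest on the third pair. The three products are the dual certificate. *)
Lemma form3_le (wm S a b c x y z : R) :
  a <= wm -> b <= wm -> a + b + c <= S -> 0 <= z -> z <= y -> y <= x ->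
  a * x * y + b * x * z + c * y * z <= wm * x * (y + z) + (S - 2 * wm) * y * z.
Proof.
move=> aw bw abc z0 zy yx.
have h1 : 0 <= (wm - a) * (y * (x - z)) by rewrite !mulr_ge0 ?subr_ge0 //; lra.
have h2 : 0 <= (wm - b) * (z * (x - y)) by rewrite !mulr_ge0 ?subr_ge0 //; lra.
have h3 : 0 <= (S - a - b - c) * (y * z) by rewrite !mulr_ge0 //; lra.
lra.
Qed.

(** The best weights are [s / 2] across a cut and 0 inside its two sides; the final square in each
    identity is the defect in the inequality of arithmetic and geometric means for the two sides. If
    [x1 >= x2 + x3], the cut separates vertex 1 from the others. *)
Lemma form4_le (s w12 w13 w14 w23 w24 w34 x1 x2 x3 x4 : R) :
  0 <= w12 -> 0 <= w13 -> 0 <= w14 -> 0 <= w23 -> 0 <= w24 -> 0 <= w34 ->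
  w12 <= s / 2 -> w13 <= s / 2 -> w14 <= s / 2 ->
  w23 <= s / 2 -> w24 <= s / 2 -> w34 <= s / 2 ->
  w12 + w13 + w23 <= s -> w12 + w14 + w24 <= s ->
  w13 + w14 + w34 <= s -> w23 + w24 + w34 <= s ->
  0 <= x4 -> x4 <= x3 -> x3 <= x2 -> x2 <= x1 ->
  2 * (w12 * x1 * x2 + w13 * x1 * x3 + w14 * x1 * x4 + w23 * x2 * x3
       + w24 * x2 * x4 + w34 * x3 * x4) <= s / 4 * (x1 + x2 + x3 + x4) ^+ 2.
Proof.
rewrite -!(subr_ge0 _ (s / 2)) -!(subr_ge0 _ s).
move=> p12 p13 p14 p23 p24 p34 k12 k13 k14 k23 k24 k34 k123 k124 k134 k234.
have s0 : 0 <= s by clear -p12 k12; lra.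
clear p12 p13 p14 p23 p24 p34 => x40 x43 x32 x21; rewrite -subr_ge0.
pose ge0 (u : R) := 0 <= u.
have mul (u v : R) : 0 <= u -> ge0 v -> 0 <= u * v by exact: mulr_ge0.
case: (lerP (x2 + x3) x1) => hx.
  have -> : s / 4 * (x1 + x2 + x3 + x4) ^+ 2 - 2 * (w12 * x1 * x2 + w13 * x1 * x3
      + w14 * x1 * x4 + w23 * x2 * x3 + w24 * x2 * x4 + w34 * x3 * x4)
    = 2 * ((s / 2 - w12) * (x2 * (x1 - x3 - x4)) + (s / 2 - w13) * (x3 * (x1 - x2 - x4))
      + (s / 2 - w14) * (x4 * (x1 - x2 - x3)) + (s - (w12 + w13 + w23)) * (x2 * x3)
      + (s - (w12 + w14 + w24)) * (x2 * x4) + (s - (w13 + w14 + w34)) * (x3 * x4))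
      + s * (x1 - x2 - x3 - x4) ^+ 2 / 4 by field.
  rewrite addr_ge0 ?divr_ge0 ?(mulr_ge0 s0 (sqr_ge0 _)) // mulr_ge0 //.
  by rewrite !addr_ge0 //; apply: mul => //; clear -x40 x43 x32 x21 hx;
    rewrite /ge0 mulr_ge0 //; lra.
(* LP duality: [x1 x4 - a], [a], [x2 x3 - b], [b] are multipliers of the four
   triangle constraints, complementary to the cut {1,4}|{2,3}. *)
pose a := x4 * (x3 + x1 - x2) / 2; pose b := x4 * (x3 - x1 + x2) / 2.
have -> : s / 4 * (x1 + x2 + x3 + x4) ^+ 2 - 2 * (w12 * x1 * x2 + w13 * x1 * x3
    + w14 * x1 * x4 + w23 * x2 * x3 + w24 * x2 * x4 + w34 * x3 * x4)
  = 2 * ((s - (w13 + w14 + w34)) * a + (s - (w12 + w14 + w24)) * (x1 * x4 - a)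
    + (s - (w23 + w24 + w34)) * b + (s - (w12 + w13 + w23)) * (x2 * x3 - b)
    + (s / 2 - w12) * (x1 * x2 - (x1 * x4 - a) - (x2 * x3 - b))
    + (s / 2 - w13) * (x1 * x3 - a - (x2 * x3 - b))
    + (s / 2 - w24) * (x2 * x4 - (x1 * x4 - a) - b)
    + (s / 2 - w34) * (x3 * x4 - a - b)) + s * (x1 + x4 - x2 - x3) ^+ 2 / 4.
  by field.
rewrite addr_ge0 ?divr_ge0 ?(mulr_ge0 s0 (sqr_ge0 _)) // mulr_ge0 //.
rewrite !addr_ge0 //; apply: mul => //; clear -x40 x43 x32 x21 hx a b; rewrite /ge0 {}/a {}/b.
- by rewrite !mulr_ge0 ?invr_ge0 //; lra.
- have h : 0 <= x4 * (x1 + x2 - x3) by rewrite mulr_ge0 //; lra.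
  lra.
- by rewrite !mulr_ge0 ?invr_ge0 //; lra.
- have h1 : 0 <= x2 * (x3 - x4) by rewrite mulr_ge0 //; lra.
  have h2 : 0 <= x4 * (x1 + x2 - x3) by rewrite mulr_ge0 //; lra.
  lra.
- have h : 0 <= (x1 - x3) * (x2 - x4) by rewrite mulr_ge0 //; lra.
  lra.
- have h : 0 <= (x3 - x4) * (x1 - x2) by rewrite mulr_ge0 //; lra.
  lra.
- lra.
- lra.
Qed.
End Forms.

(** * Weighted Turan bounds *)

Section CliqueForm.
Variables (R : realFieldType) (T : finType) (W : T -> T -> nat).
Hypotheses (Wsym : forall a b, W a b = W b a) (Wirr : forall a, W a a = 0%N).
Implicit Types (s : seq T) (x : T -> R).

Definition form s x : R := \sum_(a <- s) \sum_(b <- s) (W a b)%:R * x a * x b.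

Definition mass s x : R := \sum_(a <- s) x a.

Lemma form_le_max (w : nat) s x : uniq s -> (forall a, 0 <= x a) ->
  {in s &, forall a b, (W a b <= w)%N} ->
  form s x <= w%:R * (mass s x ^+ 2 - \sum_(a <- s) x a ^+ 2).
Proof.
move=> us x0 Ww; rewrite expr2 {1}/mass mulr_suml -sumrB mulr_sumr /form.
rewrite big_seq [leRHS]big_seq; apply: ler_sum => a as_.
rewrite /mass (bigD1_seq a) //= Wirr !mul0r add0r (bigD1_seq a as_ us) /=.
set Y := \sum_(_ <- _ | _) x _.
have -> : w%:R * (x a * (x a + Y) - x a ^+ 2) = w%:R * x a * Y by ring.
rewrite /Y mulr_sumr big_seq_cond [leRHS]big_seq_cond.
apply: ler_sum => b /andP[bs _]; rewrite ler_wpM2r //.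
by rewrite ler_wpM2r // ler_nat Ww.
Qed.

(** After [form3_le] the two lighter vertices enter only through their sum and product, and the
    product is largest when they are equal. This leaves an inequality in the mass [u] of the
    heaviest vertex and the mass [t] of the other two. *)
Lemma form_size3 (wm S C : R) s x : size s = 3%N -> uniq s ->
  (forall a, 0 <= x a) -> sorted (fun a b => x b <= x a) s ->
  {in s &, forall a b, (W a b)%:R <= wm} ->
  (forall a b c, subseq [:: a; b; c] s -> (W a b)%:R + (W a c)%:R + (W b c)%:R <= S) ->
  2 * wm <= S ->
  (forall u t : R, 0 <= u -> 0 <= t ->
    2 * wm * u * t + (S - 2 * wm) * t ^+ 2 / 2 <= C * (u + t) ^+ 2) ->
  form s x <= C * mass s x ^+ 2.
Proof.
case: s => [|a [|b [|c []]]] // _ _ x0 xs Ww Ws wS HC.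
have /= /andP[xba /andP[xcb _]] := xs.
rewrite /form /mass !big_cons !big_nil !Wirr (Wsym b a) (Wsym c a) (Wsym c b).
have wab : (W a b)%:R <= wm by rewrite Ww ?inE ?eqxx ?orbT.
have wac : (W a c)%:R <= wm by rewrite Ww ?inE ?eqxx ?orbT.
have wabc := Ws a b c (subseq_refl _).
have xc := x0 c.
have h1 := form3_le wab wac wabc xc xcb xba.
have h2 := HC (x a) (x b + x c) (x0 a) (addr_ge0 (x0 b) xc).
have h3 : 0 <= (S - 2 * wm) * (x b - x c) ^+ 2 by rewrite mulr_ge0 ?sqr_ge0 ?subr_ge0.
lra.
Qed.

Lemma form_size4 (S : R) s x : size s = 4%N ->
  (forall a, 0 <= x a) -> sorted (fun a b => x b <= x a) s ->
  {in s &, forall a b, (W a b)%:R <= S / 2} ->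
  (forall a b c, subseq [:: a; b; c] s -> (W a b)%:R + (W a c)%:R + (W b c)%:R <= S) ->
  form s x <= S / 4 * mass s x ^+ 2.
Proof.
case: s => [|a [|b [|c [|d []]]]] // _ x0 xs Ww Ws.
have /= /and4P[xba xcb xdc _] := xs.
rewrite /form /mass !big_cons !big_nil !Wirr (Wsym b a) (Wsym c a) (Wsym c b).
rewrite (Wsym d a) (Wsym d b) (Wsym d c).
have w u v : u \in [:: a; b; c; d] -> v \in [:: a; b; c; d] -> (W u v)%:R <= S / 2 :> R by exact: Ww.
have sub (m : bitseq) u v z : mask m [:: a; b; c; d] = [:: u; v; z] ->
    (W u v)%:R + (W u z)%:R + (W v z)%:R <= S.
  by move=> E; apply: Ws; rewrite -E mask_subseq.
have tabc := sub [:: true; true; true] a b c erefl.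
have tabd := sub [:: true; true; false; true] a b d erefl.
have tacd := sub [:: true; false; true; true] a c d erefl.
have tbcd := sub [:: false; true; true; true] b c d erefl.
have h : 2 * ((W a b)%:R * x a * x b + (W a c)%:R * x a * x c + (W a d)%:R * x a * x d
    + (W b c)%:R * x b * x c + (W b d)%:R * x b * x d + (W c d)%:R * x c * x d)
    <= S / 4 * (x a + x b + x c + x d) ^+ 2.
  by apply: form4_le => //; apply: w; rewrite !inE eqxx ?orbT.
rewrite !addr0 !addrA in h *; apply: le_trans h; rewrite le_eqVlt; apply/orP; left; apply/eqP; ring.
Qed.

(** Each pair lies in three of the five 4-subsets, so summing [form_size4] bounds [3 * form] by
    [S / 4] times three squared masses plus the sum of squares [Q]. In [form_le_max] the term [Q]
    has the opposite sign; eliminating it gives the constant [4 w S / (12 w + S)]. *)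
Lemma form_size5 (w : nat) (S C : R) s x : size s = 5%N -> uniq s ->
  (forall a, 0 <= x a) -> sorted (fun a b => x b <= x a) s ->
  {in s &, forall a b, (W a b <= w)%N} ->
  (forall a b c, subseq [:: a; b; c] s -> (W a b)%:R + (W a c)%:R + (W b c)%:R <= S) ->
  w%:R <= S / 2 -> 0 < S -> 4 * w%:R * S <= C * (12 * w%:R + S) ->
  form s x <= C * mass s x ^+ 2.
Proof.
move=> s5 us x0 xs Ww Ws wS S0 HC.
have q := form_le_max us x0 Ww.
have sub4 t : subseq t s -> size t = 4%N -> form t x <= S / 4 * mass t x ^+ 2.
  move=> ts t4; apply: form_size4 => //.
  - by apply: subseq_sorted ts xs => u v z /[swap]; exact: le_trans.
  - move=> u v /(mem_subseq ts) us' /(mem_subseq ts) vs.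
    by apply: le_trans wS; rewrite ler_nat Ww.
  - by move=> u v z uvz; apply: Ws; apply: subseq_trans ts.
have w0 : 0 <= w%:R :> R by [].
rewrite -(ler_pM2r (_ : 0 < 12 * w%:R + S)); last by lra.
have M0 : 0 <= mass s x ^+ 2 by exact: sqr_ge0.
have {HC} HC : 4 * w%:R * S * mass s x ^+ 2 <= C * (12 * w%:R + S) * mass s x ^+ 2.
  by rewrite ler_wpM2r.
suff h : 3 * form s x <= S / 4 * (3 * mass s x ^+ 2 + \sum_(a <- s) x a ^+ 2).
  have w40 : 0 <= 4 * w%:R :> R by lra.
  have h1 := ler_wpM2l w40 h.
  have h2 := ler_wpM2l (ltW S0) q.
  lra.
case: s s5 us xs Ww Ws q sub4 M0 HC => [|a [|b [|c [|d [|e []]]]]] // _ _ _ _ _ _ sub4 _ _.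
have m (m : bitseq) := sub4 _ (mask_subseq m _).
have h1 := m [:: false; true; true; true; true] erefl.
have h2 := m [:: true; false; true; true; true] erefl.
have h3 := m [:: true; true; false; true; true] erefl.
have h4 := m [:: true; true; true; false; true] erefl.
have h5 := m [:: true; true; true; true; false] erefl.
move: h1 h2 h3 h4 h5; rewrite /form /mass /= !big_cons !big_nil !Wirr (Wsym b a) (Wsym c a) (Wsym c b).
rewrite (Wsym d a) (Wsym d b) (Wsym d c) (Wsym e a) (Wsym e b) (Wsym e c) (Wsym e d).
rewrite !addr0 => h1 h2 h3 h4 h5.
have := lerD (lerD (lerD (lerD h1 h2) h3) h4) h5; clear; move=> h; lra.
Qed.

(** [w k] and [S k] bound the pair weights and triple sums in a clique of [k] clusters. The clauses
    are what the bounds for 2, 3, 4, 5 and at least 6 clusters require; from 6 on the pair bound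
    alone suffices, since [w] decreases. *)
Definition turan_bound (p q : nat) (C : R) : Prop :=
  let w k := minn p (q + 1 - p - k) in let S k := (q + 2 - k)%N in
  [/\ (w 2)%:R <= 2 * C,
      (2 * w 3 <= S 3)%N /\
      (forall u t : R, 0 <= u -> 0 <= t ->
        2 * (w 3)%:R * u * t + ((S 3)%:R - 2 * (w 3)%:R) * t ^+ 2 / 2
        <= C * (u + t) ^+ 2),
      (2 * w 4 <= S 4)%N /\ (S 4)%:R / 4 <= C,
      [/\ (2 * w 5 <= S 5)%N, (0 < S 5)%N &
        4 * (w 5)%:R * (S 5)%:R <= C * (12 * (w 5)%:R + (S 5)%:R)] &
      (w 6)%:R <= C].

Lemma clique_form_le (p q : nat) (C : R) s x : turan_bound p q C -> uniq s ->
  (forall a, 0 <= x a) -> (forall a b, (W a b <= p)%N) ->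
  {in s &, forall a b, a != b -> (W a b + p + size s <= q + 1)%N} ->
  {in s & &, forall a b c, uniq [:: a; b; c] ->
    (W a b + W a c + W b c + size s <= q + 2)%N} ->
  form s x <= C * mass s x ^+ 2.
Proof.
have le_w k v : (v + p + k <= q + 1)%N -> (v <= p)%N -> (v <= minn p (q + 1 - p - k))%N.
  by clear; lia.
have le_S k v : (v + k <= q + 2)%N -> (v <= q + 2 - k)%N by clear; lia.
have w_anti k : (5 < k)%N -> (minn p (q + 1 - p - k) <= minn p (q + 1 - p - 6))%N.
  by clear; lia.
move=> + us x0 Wp.
wlog xs : s us / sorted (fun a b => x b <= x a) s.
  move=> wl tb HA HB; pose r : rel T := fun a b => x b <= x a.
  have ps : perm_eq (sort r s) s by rewrite perm_sort.
  have E : form (sort r s) x = form s x.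
    by rewrite /form (perm_big _ ps) /=; apply: eq_bigr => a _; exact: perm_big.
  have E' : mass (sort r s) x = mass s x by exact: perm_big.
  rewrite -E -E'; apply: wl => //.
  - by rewrite sort_uniq.
  - by apply: sort_sorted => a b; exact: le_total.
  - by move=> a b; rewrite !mem_sort size_sort; exact: HA.
  - by move=> a b c; rewrite !mem_sort size_sort; exact: HB.
move=> [n2 [n3 n3'] [n4 n4'] [n5 n5' n5''] n6] HA HB.
have M0 : 0 <= mass s x ^+ 2 by exact: sqr_ge0.
have Q0 : 0 <= \sum_(a <- s) x a ^+ 2 by apply: sumr_ge0 => a _; exact: sqr_ge0.
have Ww : {in s &, forall a b, (W a b <= minn p (q + 1 - p - size s))%N}.
  move=> a b as_ bs; have [->|ab] := eqVneq a b; first by rewrite Wirr.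
  by apply: le_w => //; exact: HA.
have WS a b c : subseq [:: a; b; c] s ->
    (W a b)%:R + (W a c)%:R + (W b c)%:R <= (q + 2 - size s)%:R :> R.
  move=> abc; rewrite -!natrD ler_nat.
  have m z : z \in [:: a; b; c] -> z \in s by exact: mem_subseq.
  have := HB a b c (m _ _) (m _ _) (m _ _) (subseq_uniq abc us).
  by rewrite !inE !eqxx ?orbT => /(_ isT isT isT); exact: le_S.
have C0 : 0 <= C := le_trans (ler0n _ _) n6.
have [s6|] := ltnP 5 (size s).
  apply: le_trans (form_le_max us x0 Ww) _.
  have h : (minn p (q + 1 - p - size s))%:R * (mass s x ^+ 2 - \sum_(a <- s) x a ^+ 2)
      <= (minn p (q + 1 - p - size s))%:R * mass s x ^+ 2 by rewrite ler_wpM2l // gerBl.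
  by apply: (le_trans h); rewrite ler_wpM2r //; apply: le_trans n6; rewrite ler_nat w_anti.
have half (m n : nat) : (2 * m <= n)%N -> m%:R <= n%:R / 2 :> R.
  by move=> mn; rewrite ler_pdivlMr // mulrC -natrM ler_nat.
have WwR k : size s = k ->
    {in s &, forall a b, (W a b)%:R <= (minn p (q + 1 - p - k))%:R :> R}.
  by move=> <- a b as_ bs; rewrite ler_nat Ww.
case Es : (size s) => [|[|[|[|[|[|//]]]]]] _; rewrite ?Es in Ww WS.
- by rewrite /form (size0nil Es) big_nil mulr_ge0 ?sqr_ge0.
- case: s Es {us xs HA HB Ww WS WwR Q0} M0 => [|a []] // _; rewrite /form !big_seq1.
  by rewrite Wirr !mul0r => M0; rewrite mulr_ge0.
- apply: le_trans (form_le_max us x0 Ww) _; move: n2; rewrite /= => n2; clear - Es n2 x0.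
  case: s Es => [|a [|b []]] // _; rewrite /mass !big_cons !big_nil !addr0.
  set w := (minn _ _)%:R in n2 *.
  have h1 := x0 a; have h2 := x0 b; have h3 : 0 <= w by rewrite ler0n.
  have h4 : 0 <= (2 * C - w) * (x a + x b) ^+ 2 by rewrite mulr_ge0 ?sqr_ge0 ?subr_ge0.
  have h5 : 0 <= w * (x a - x b) ^+ 2 by rewrite mulr_ge0 ?sqr_ge0.
  lra.
- apply: (form_size3 Es us x0 xs (WwR _ Es)) WS _ n3'.
  by rewrite -natrM ler_nat.
- apply: (@le_trans _ _ ((q + 2 - 4)%:R / 4 * mass s x ^+ 2)); last by rewrite ler_wpM2r.
  apply: form_size4 => // a b as_ bs; apply: (le_trans (WwR _ Es a b as_ bs)).
  exact: half.
- by apply: (form_size5 Es us x0 xs Ww WS) => //; [exact: half|rewrite ltr0n].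
Qed.

(* Motzkin-Straus: [form] is linear along the exchange of mass between two
   vertices of weight 0, so the support of a maximiser may be taken a clique. *)
Lemma form_le_cliques (C : R) :
  (forall s x, uniq s -> (forall a, 0 <= x a) ->
    {in s &, forall a b, a != b -> (0 < W a b)%N} -> form s x <= C * mass s x ^+ 2) ->
  forall x, (forall a, 0 <= x a) -> form (enum T) x <= C * mass (enum T) x ^+ 2.
Proof.
move=> HC x; have [k] := ubnP #|[set a | x a != 0]|; elim: k x => // k IH x xk x0.
have [/existsP[a /existsP[b /and4P[xa xb ab /eqP Wab]]]|noW] :=
  boolP [exists a, exists b, [&& x a != 0, x b != 0, a != b & W a b == 0%N]].
  pose D (a : T) : R := \sum_(c <- enum T) (W a c)%:R * x c.
  wlog Dab : a b xa xb ab Wab / D b <= D a.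
    move=> wl; have [h|h] := leP (D b) (D a); first exact: wl xa xb ab Wab h.
    by apply: (wl b a xb xa); rewrite 1?eq_sym 1?Wsym // ltW.
  pose u (c : T) : R := (c == a)%:R - (c == b)%:R.
  (* All mass of [b] moves to [a]. As [W a b = 0], the form changes by the linear term
     [2 * x b * (D a - D b)], and the support loses [b]. *)
  pose x' c := x c + x b * u c.
  have sumu (f : T -> R) : \sum_(c <- enum T) f c * u c = f a - f b.
    rewrite /u (eq_bigr (fun c => f c * (c == a)%:R - f c * (c == b)%:R)) => [|c _]; last by ring.
    rewrite sumrB !big_enum /=.
    have del d : \sum_c f c * (c == d)%:R = f d.
      rewrite (bigD1 d) //= eqxx mulr1 big1 ?addr0 // => c /negbTE ->.
      by rewrite mulr0.
    by rewrite !del.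
  have x'0 c : 0 <= x' c.
    rewrite /x' /u; have [->|ca] := eqVneq c a; first by rewrite (negbTE ab) subr0 mulr1 addr_ge0.
    have [->|cb] := eqVneq c b; first by rewrite sub0r mulrN1 subrr.
    by rewrite subr0 mulr0 addr0.
  have Em : mass (enum T) x' = mass (enum T) x.
    rewrite /mass big_split /= -mulr_sumr.
    have -> : \sum_(c <- enum T) u c = 1 - 1.
      by rewrite -(sumu (fun=> 1)); apply: eq_bigr => c _; rewrite mul1r.
    by rewrite subrr mulr0 addr0.
  have Ef : form (enum T) x' = form (enum T) x + 2 * x b * (D a - D b).
    rewrite /form (eq_bigr (fun c => \sum_(d <- enum T) (W c d)%:R * x c * x d
       + x c * x b * ((W c a)%:R - (W c b)%:R)
       + (x b * D c + x b * x b * ((W c a)%:R - (W c b)%:R)) * u c)).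
      rewrite !big_split /= sumu !Wirr Wab (Wsym b a) Wab.
      suff -> : \sum_(c <- enum T) x c * x b * ((W c a)%:R - (W c b)%:R) = x b * (D a - D b) by ring.
      rewrite /D -sumrB mulr_sumr; apply: eq_bigr => c _.
      by rewrite !(Wsym c); ring.
    move=> c _; rewrite (eq_bigr (fun d => (W c d)%:R * x c * x d
      + (W c d)%:R * x c * x b * u d + ((W c d)%:R * x d * (x b * u c)
      + (W c d)%:R * x b * x b * u c * u d))); last by move=> d _; rewrite /x'; ring.
    rewrite !big_split /= !sumu -mulr_suml -/(D c).
    by ring.
  rewrite -Em; apply: (@le_trans _ _ (form (enum T) x')).
    by rewrite Ef lerDl !mulr_ge0 // subr_ge0.
  apply: IH => //; rewrite ltnS in xk; apply: leq_trans xk; apply: proper_card; apply/properP; split.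
    apply/subsetP => c; rewrite !inE /x' /u.
    have [->|ca] := eqVneq c a; first by [].
    have [->|cb] := eqVneq c b; first by [].
    by rewrite subr0 mulr0 addr0.
  by exists b; rewrite !inE //= /x' /u eqxx [b == a]eq_sym (negbTE ab) sub0r mulrN1 subrr eqxx.
pose s := [seq a <- enum T | x a != 0].
have Ef : form (enum T) x = form s x.
  rewrite /form /s [RHS]big_filter [RHS]big_mkcond; apply: eq_bigr => a _ /=.
  case: (eqVneq (x a) 0) => [->|_] /=.
    by rewrite big1 // => b _; rewrite mulr0 mul0r.
  rewrite big_filter [RHS]big_mkcond; apply: eq_bigr => b _ /=.
  by case: (eqVneq (x b) 0) => [->|_] //=; rewrite mulr0.
have Em : mass (enum T) x = mass s x.
  rewrite /mass /s [RHS]big_filter [RHS]big_mkcond; apply: eq_bigr => a _ /=.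
  by case: (eqVneq (x a) 0) => [->|_].
rewrite Ef Em; apply: HC => //; first by rewrite filter_uniq ?enum_uniq.
move=> a b; rewrite !mem_filter => /andP[xa _] /andP[xb _] ab.
rewrite lt0n; apply: contra noW => Wab.
by apply/existsP; exists a; apply/existsP; exists b; rewrite xa xb ab.
Qed.

Lemma weighted_turan (p q : nat) (C : R) : turan_bound p q C ->
  (forall a b, (W a b <= p)%N) ->
  (forall s, uniq s -> {in s &, forall a b, a != b -> (0 < W a b)%N} ->
    {in s &, forall a b, a != b -> (W a b + p + size s <= q + 1)%N} /\
    {in s & &, forall a b c, uniq [:: a; b; c] ->
      (W a b + W a c + W b c + size s <= q + 2)%N}) ->
  forall x, (forall a, 0 <= x a) -> form (enum T) x <= C * mass (enum T) x ^+ 2.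
Proof.
move=> tb Wp H; apply: form_le_cliques => s x us x0 Wpos.
by have [HA HB] := H s us Wpos; exact: (clique_form_le tb).
Qed.
End CliqueForm.

Ltac eval_nat :=
  repeat match goal with
  | |- context [minn ?a ?b] =>
      let v := eval vm_compute in (minn a b) in change (minn a b) with v
  | |- context [subn ?a ?b] =>
      let v := eval vm_compute in (subn a b) in change (subn a b) with v
  end.

Section TuranBounds.
Variable R : realFieldType.

(** The clause for three clusters is tight: its defect is [(4 u - 3 t)^2 / 7], so the extremal
    masses are 3 : 2 : 2. *)
Lemma turan_bound_4_11 : @turan_bound R 4 11 (16 / 7).
Proof.
rewrite /turan_bound; eval_nat.
split; [lra|split=> // u t u0 t0|split=> //; lra|split=> //; lra|lra].
have h := sqr_ge0 (4 * u - 3 * t); lra.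
Qed.

(** The defect for three clusters is [(10 u - 9 t)^2 / 38]; it vanishes at masses 9 : 5 : 5, the
    class sizes of the lower bound. *)
Lemma turan_bound_5_12 : @turan_bound R 5 12 (50 / 19).
Proof.
rewrite /turan_bound; eval_nat.
split; [lra|split=> // u t u0 t0|split=> //; lra|split=> //; lra|lra].
have h := sqr_ge0 (10 * u - 9 * t); lra.
Qed.

(** Here two clusters decide: [w 2 = 5 = 2 C]. The defect for three clusters,
    [(5 u - 3 t)^2 / 10 + t^2 / 10], leaves slack. *)
Lemma turan_bound_6_12 : @turan_bound R 6 12 (5 / 2).
Proof.
rewrite /turan_bound; eval_nat.
split; [lra|split=> // u t u0 t0|split=> //; lra|split=> //; lra|lra].
have h := sqr_ge0 (5 * u - 3 * t); have h2 := sqr_ge0 t; lra.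
Qed.

Lemma turan_bound_6_14 : @turan_bound R 6 14 (72 / 23).
Proof.
rewrite /turan_bound; eval_nat.
split; [lra|split=> // u t u0 t0|split=> //; lra|split=> //; lra|lra].
have h := sqr_ge0 (12 * u - 11 * t); lra.
Qed.
End TuranBounds.

(** * The regularity lemma *)

Section ConditionalExpectation.
Variables (R : realFieldType) (O : finType) (h : O -> R).

Definition cond_exp (K : finType) (F : O -> K) (w : O) : R :=
  (\sum_(z | F z == F w) h z) / #|[pred z | F z == F w]|%:R.

Lemma cond_exp_mul (K : finType) (F : O -> K) (u : K -> R) :
  \sum_w cond_exp F w * u (F w) = \sum_w h w * u (F w).
Proof.
rewrite (partition_big F predT) //= [RHS](partition_big F predT) //=.
apply: eq_bigr => k _.
rewrite (eq_bigr (fun=> (\sum_(z | F z == k) h z) / #|[pred z | F z == k]|%:R * u k)); last first.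
  by move=> w /eqP Fw; rewrite /cond_exp Fw.
rewrite [RHS](eq_bigr (fun w => h w * u k)) => [|w /eqP -> //].
rewrite big_const iter_addr_0 -mulr_suml -[LHS]mulr_natr [LHS]mulrAC; congr (_ * _).
rewrite (@eq_card _ (fun z => F z == k) [pred z | F z == k]) //.
case: (posnP #|[pred z | F z == k]|) => [k0|k0].
  by rewrite k0 mulr0 big_pred0 // => w; have := card0_eq k0 w; rewrite !inE.
by rewrite divfK // pnatr_eq0 -lt0n.
Qed.

(** Pythagoras: [cond_exp F] is the orthogonal projection of [cond_exp G], as both have the same
    scalar product with every function of [F]. *)
Lemma cond_exp_refine (K L : finType) (F : O -> K) (G : O -> L) (pi : L -> K) :
  (forall w, F w = pi (G w)) ->
  \sum_w (cond_exp F w - cond_exp G w) ^+ 2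
  = \sum_w cond_exp G w ^+ 2 - \sum_w cond_exp F w ^+ 2.
Proof.
move=> FG; pose phi k : R := (\sum_(z | F z == k) h z) / #|[pred z | F z == k]|%:R.
have E1 : \sum_w cond_exp F w ^+ 2 = \sum_w h w * phi (F w).
  by rewrite -cond_exp_mul; apply: eq_bigr.
have E2 : \sum_w cond_exp G w * cond_exp F w = \sum_w h w * phi (F w).
  transitivity (\sum_w cond_exp G w * phi (pi (G w))).
    by apply: eq_bigr => w _; rewrite -FG.
  by rewrite (cond_exp_mul G (phi \o pi)); apply: eq_bigr => w _; rewrite /= -FG.
rewrite (eq_bigr (fun w => cond_exp G w ^+ 2 + cond_exp F w ^+ 2
   - 2 * (cond_exp G w * cond_exp F w))) => [|w _]; last by ring.
by rewrite sumrB big_split /= -mulr_sumr E1 E2; ring.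
Qed.

Lemma cond_exp_sqr_le (K : finType) (F : O -> K) :
  \sum_w cond_exp F w ^+ 2 <= \sum_w h w ^+ 2.
Proof.
have E w : cond_exp id w = h w.
  by rewrite /cond_exp big_pred1_eq card1 divr1.
have := @cond_exp_refine _ _ F id F (fun=> erefl).
rewrite [\sum_w cond_exp id w ^+ 2](eq_bigr (fun w => h w ^+ 2)) => [H|w _]; last by rewrite E.
by rewrite -subr_ge0 -H sumr_ge0 // => w _; exact: sqr_ge0.
Qed.

End ConditionalExpectation.

Section Regularity.
Variables (R : realFieldType) (V : finType) (E : rel V).
Implicit Types (A B : {set V}) (d e : R).

Definition edges A B : nat := (\sum_(x in A) \sum_(y in B) E x y)%N.

Definition density A B : R := (edges A B)%:R / (#|A| * #|B|)%:R.

(** One-sided regularity: the embedding needs many neighbours and is never harmed by an excess of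
    edges. *)
Definition lower_regular (dl e : R) A B := forall A' B', A' \subset A -> B' \subset B ->
  dl * #|A|%:R <= #|A'|%:R -> dl * #|B|%:R <= #|B'|%:R ->
  e * (#|A'| * #|B'|)%:R <= (edges A' B')%:R.

Definition irregular_witness dl A B (W : {set V} * {set V}) : bool :=
  [&& W.1 \subset A, W.2 \subset B, dl * #|A|%:R <= #|W.1|%:R,
      dl * #|B|%:R <= #|W.2|%:R &
      (edges W.1 W.2)%:R < (density A B - dl) * (#|W.1| * #|W.2|)%:R].

Definition irregular dl A B : bool := [exists W, irregular_witness dl A B W].

Lemma regular_lower dl A B : ~~ irregular dl A B -> lower_regular dl (density A B - dl) A B.
Proof.
move=> /existsPn H A' B' sA sB hA hB; have := H (A', B').
by rewrite /irregular_witness /= sA sB hA hB /= -leNgt.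
Qed.

Section Coloring.
Variable C : finType.
Implicit Types (f : V -> C).

Definition color_class f (a : C) : {set V} := [set x | f x == a].

Definition edge_fun (z : V * V) : R := (E z.1 z.2)%:R.

Definition energy f : R :=
  \sum_z cond_exp edge_fun (fun z => (f z.1, f z.2)) z ^+ 2.

(** Irregular pairs are weighted by the product of their class sizes, because refinements are not
    kept balanced. *)
Definition irregular_mass dl f : nat :=
  (\sum_(ab : C * C | irregular dl (color_class f ab.1) (color_class f ab.2))
    #|color_class f ab.1| * #|color_class f ab.2|)%N.
End Coloring.

Lemma energy_le (C : finType) (f : V -> C) : energy f <= (#|V| ^ 2)%:R.
Proof.
apply: le_trans (cond_exp_sqr_le _ _) _.
apply: (@le_trans _ _ (\sum_(z : V * V) 1)).
  by apply: ler_sum => z _; rewrite /edge_fun; case: E; rewrite ?expr1n ?expr0n.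
by rewrite sumr_const card_prod mulnn.
Qed.

Lemma sum_edge_fun A B (u : V * V -> R) :
  (forall z, u z = ((z.1 \in A) && (z.2 \in B))%:R) ->
  \sum_z edge_fun z * u z = (edges A B)%:R.
Proof.
move=> Eu; rewrite /edges natr_sum [RHS]big_mkcond /=.
rewrite (eq_bigr (fun z => edge_fun (z.1, z.2) * u (z.1, z.2))) => [|[] //].
rewrite -(pair_bigA _ (fun x y => edge_fun (x, y) * u (x, y))) /=; apply: eq_bigr => x _.
case: ifP => xA; last by rewrite big1 // => y _; rewrite Eu /= xA mulr0.
rewrite natr_sum [RHS]big_mkcond; apply: eq_bigr => y _.
by rewrite Eu /= xA /edge_fun /=; case: ifP => _; rewrite ?mulr1 ?mulr0.
Qed.

Lemma cond_exp_density (C : finType) (f : V -> C) (z : V * V) :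
  cond_exp edge_fun (fun z => (f z.1, f z.2)) z
  = density (color_class f (f z.1)) (color_class f (f z.2)).
Proof.
rewrite /cond_exp /density; congr (_ / _%:R).
  rewrite -(@sum_edge_fun _ _ (fun w =>
    ((w.1 \in color_class f (f z.1)) && (w.2 \in color_class f (f z.2)))%:R)) //.
  rewrite big_mkcond; apply: eq_bigr => w _; rewrite !inE xpair_eqE.
  by case: ifP; rewrite ?mulr1 ?mulr0.
by rewrite -cardsX; apply: eq_card => w; rewrite !inE xpair_eqE.
Qed.

Lemma energy_increment (C : finType) (f : V -> C) dl : 0 < dl -> dl <= 1 ->
  exists g : V -> C * {ffun C -> bool} * {ffun C -> bool},
    (forall x, f x = (g x).1.1) /\
    energy f + dl ^+ 4 * (irregular_mass dl f)%:R <= energy g.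
Proof.
move=> dl0 dl1; pose cl := color_class f.
pose wit a b := odflt (set0, set0) [pick W | irregular_witness dl (cl a) (cl b) W].
(* A vertex records its colour and its membership in the witness sets of that colour against every
   other colour, on either side. *)
pose g x := (f x, [ffun b => x \in (wit (f x) b).1], [ffun a => x \in (wit a (f x)).2]).
exists g; split=> //.
pose F (z : V * V) := (f z.1, f z.2); pose G (z : V * V) := (g z.1, g z.2).
rewrite -lerBrDl natr_sum mulr_sumr.
have -> : energy g - energy f
  = \sum_z (cond_exp edge_fun F z - cond_exp edge_fun G z) ^+ 2.
  by rewrite (@cond_exp_refine _ _ _ _ _ F G (fun c => (c.1.1.1, c.2.1.1))).
rewrite [leRHS](partition_big F predT) //=.
rewrite [leRHS](bigID (fun ab : C * C => irregular dl (cl ab.1) (cl ab.2))) /=.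
rewrite -[leLHS]addr0; apply: lerD; last first.
  by apply: sumr_ge0 => ab _; apply: sumr_ge0 => z _; exact: sqr_ge0.
apply: ler_sum => -[a b] /= irr.
have := irr; rewrite /irregular => /existsP[W0 HW0].
have : irregular_witness dl (cl a) (cl b) (wit a b).
  by rewrite /wit; case: pickP => [W|/(_ W0)]; rewrite ?HW0.
case Ewit : (wit a b) => [A B] /and5P[/= sA sB hA hB eAB].
pose t z := cond_exp edge_fun F z - cond_exp edge_fun G z.
pose u (z : V * V) : R := ((z.1 \in A) && (z.2 \in B))%:R.
have uF z : u z != 0 -> F z = (a, b).
  rewrite /u pnatr_eq0 eqb0 negbK => /andP[zA zB].
  by move: (subsetP sA _ zA) (subsetP sB _ zB); rewrite !inE => /eqP Ea /eqP Eb; rewrite /F Ea Eb.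
have u01 z : u z ^+ 2 = u z by rewrite /u; case: (_ && _); rewrite ?expr1n ?expr0n.
have sum_u : \sum_z u z = (#|A| * #|B|)%:R.
  rewrite -cardsX -sum1_card natr_sum [RHS]big_mkcond; apply: eq_bigr => z _.
  by rewrite inE /u; case: (_ && _).
have sum_t : \sum_z t z * u z = density (cl a) (cl b) * (#|A| * #|B|)%:R - (edges A B)%:R.
  rewrite (eq_bigr (fun z => density (cl a) (cl b) * u z - cond_exp edge_fun G z * u z)); last first.
    move=> z _; have [->|/uF Fz] := eqVneq (u z) 0; first by rewrite !mulr0 subr0.
    rewrite /t cond_exp_density mulrBl; congr (density _ _ * _ - _).
      by case: Fz => ->.
    by case: Fz => _ ->.
  rewrite sumrB -mulr_sumr sum_u; congr (_ - _).
  pose uG (c : (C * {ffun C -> bool} * {ffun C -> bool}) *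
    (C * {ffun C -> bool} * {ffun C -> bool})) : R :=
    [&& c.1.1.1 == a, c.2.1.1 == b, c.1.1.2 b & c.2.2 a]%:R.
  have uE z : u z = uG (G z).
    rewrite /u /uG /= !ffunE; congr _%:R; congr nat_of_bool.
    have [Ea|Ea] := eqVneq (f z.1) a; last first.
      by apply/negP => /andP[/(subsetP sA)]; rewrite inE (negbTE Ea).
    have [Eb|Eb] := eqVneq (f z.2) b; last first.
      by apply/negP => /andP[_ /(subsetP sB)]; rewrite inE (negbTE Eb).
    by rewrite /= Ea Eb Ewit.
  rewrite -(@sum_edge_fun A B u) // (eq_bigr (fun z => cond_exp edge_fun G z * uG (G z))).
    by rewrite cond_exp_mul; apply: eq_bigr => z _; rewrite uE.
  by move=> z _; rewrite uE.
(* Linearised Cauchy-Schwarz: [(t - dl u)^2 >= 0] with [u] an indicator. The sum of [t u] exceeds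
   [dl |A| |B|], so the gain is at least [dl^2 |A| |B|], and [A], [B] fill a share [dl] of their
   classes. *)
apply: (@le_trans _ _ (\sum_(z | F z == (a, b)) (2 * dl * (t z * u z) - dl ^+ 2 * u z))); last first.
  apply: ler_sum => z _; have := sqr_ge0 (t z - dl * u z).
  have -> : (t z - dl * u z) ^+ 2 = t z ^+ 2 - 2 * dl * (t z * u z) + dl ^+ 2 * u z ^+ 2 by ring.
  by rewrite u01 -/(t z); lra.
have -> : \sum_(z | F z == (a, b)) (2 * dl * (t z * u z) - dl ^+ 2 * u z)
    = \sum_z (2 * dl * (t z * u z) - dl ^+ 2 * u z).
  rewrite big_mkcond; apply: eq_bigr => z _; case: ifPn => // Fz.
  have [->|/uF Fz'] := eqVneq (u z) 0; first by rewrite !mulr0 subr0.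
  by rewrite Fz' eqxx in Fz.
rewrite sumrB -!mulr_sumr sum_t sum_u.
have h1 : dl ^+ 4 * (#|cl a| * #|cl b|)%:R <= dl ^+ 2 * (#|A| * #|B|)%:R.
  rewrite !natrM (_ : dl ^+ 4 * _ = dl ^+ 2 * (dl * #|cl a|%:R * (dl * #|cl b|%:R))); last by ring.
  by rewrite ler_wpM2l ?sqr_ge0 // ler_pM // mulr_ge0 // ltW.
apply: (le_trans h1); have h2 := ler_wpM2l (ltW dl0) (ltW eAB).
by lra.
Qed.
End Regularity.

Section RegularityLemma.
Variables (R : archiRealFieldType).

(** The energy never exceeds [|V|^2], and refining an irregular colouring gains [tau |V|^2]. In the
    induction [r] counts the gains still possible; initially [r >= 1 / tau] makes the energy
    hypothesis vacuous. *)
Lemma regularity (dl eta : R) (m : nat) : 0 < dl -> dl <= 1 -> 0 < eta ->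
  exists M : nat, forall (V : finType) (E : rel V) (C0 : finType) (f0 : V -> C0),
    (#|C0| <= m)%N ->
    exists (C : finType) (f : V -> C) (pi : C -> C0), [/\ forall x, f0 x = pi (f x),
      (#|C| <= M)%N & (irregular_mass E dl f)%:R <= eta * (#|V| ^ 2)%:R].
Proof.
move=> dl0 dl1 eta0; pose tau := dl ^+ 4 * eta.
have tau0 : 0 < tau by rewrite mulr_gt0 ?exprn_gt0.
suff H r : forall m, exists M : nat, forall (V : finType) (E : rel V) (C0 : finType) (f0 : V -> C0),
    (#|C0| <= m)%N -> (1 - r%:R * tau) * (#|V| ^ 2)%:R <= energy R E f0 ->
    exists (C : finType) (f : V -> C) (pi : C -> C0), [/\ forall x, f0 x = pi (f x),
      (#|C| <= M)%N & (irregular_mass E dl f)%:R <= eta * (#|V| ^ 2)%:R].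
  have [M HM] := H (Num.bound tau^-1) m; exists M => V E C0 f0 C0m.
  apply: HM => //; apply: (@le_trans _ _ 0); last by apply: sumr_ge0 => z _; exact: sqr_ge0.
  rewrite mulr_le0_ge0 // subr_le0 -ler_pdivrMr // mul1r ltW //.
  by apply: archi_boundP; rewrite invr_ge0 ltW.
elim: r => [|r IH] {}m.
  exists m => V E C0 f0 C0m; rewrite mul0r subr0 mul1r => en.
  exists C0, f0, id; split=> //; rewrite leNgt; apply/negP => irr.
  have [g [_]] := energy_increment E f0 dl0 dl1.
  apply/negP; rewrite -ltNge; apply: le_lt_trans (energy_le R E g) _.
  apply: (le_lt_trans en); rewrite ltrDl mulr_gt0 ?exprn_gt0 //.
  by apply: le_lt_trans irr; rewrite mulr_ge0 // ltW.
have [M HM] := IH (m * 2 ^ m * 2 ^ m)%N; exists (maxn m M) => V E C0 f0 C0m en.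
have [reg|irr] := leP ((irregular_mass E dl f0)%:R : R) (eta * (#|V| ^ 2)%:R).
  by exists C0, f0, id; split=> //; rewrite leq_max C0m.
have [g [f0g en']] := energy_increment E f0 dl0 dl1.
have [||C [f [pi [pif CM reg]]]] := HM V E _ g.
- rewrite !card_prod !card_ffun card_bool.
  have h : (2 ^ #|C0| <= 2 ^ m)%N by rewrite leq_exp2l.
  by rewrite !leq_mul.
- apply: le_trans en'; have h := ler_wpM2l (exprn_ge0 4 (ltW dl0)) (ltW irr).
  move: en; rewrite -natr1 /tau; lra.
exists C, f, (fun c => (pi c).1.1); split=> //; last by rewrite leq_max CM orbT.
by move=> x; rewrite f0g pif.
Qed.
End RegularityLemma.

(** * Embedding cliques into regular clusters *)

Section Embedding.
Variables (R : realFieldType) (V : finType) (E : rel V).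
Hypotheses (Esym : symmetric E) (Eirr : irreflexive E).
Implicit Types (A B Q U : {set V}).

Definition rel_clique Q := {in Q &, forall x y, x != y -> E x y}.

Definition nbhd (v : V) : {set V} := [set y | E v y].

Lemma edgesE A B : edges E A B = (\sum_(x in A) #|B :&: nbhd x|)%N.
Proof.
apply: eq_bigr => x _; rewrite -sum1_card big_mkcond [RHS]big_mkcond.
by apply: eq_bigr => y _; rewrite !inE; case: (y \in B); case: E.
Qed.

Lemma edgesC A B : edges E A B = edges E B A.
Proof. by rewrite /edges exchange_big; do 2![apply: eq_bigr => ? _]; rewrite Esym. Qed.

(** Double counting between [Q] and [U]: if fewer than [kappa |U|] vertices of [U] had [w]
    neighbours in [Q], there would be fewer than [(w - 1 + p kappa) |U|] edges. The pigeonhole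
    principle over the subsets of [Q] then fixes the neighbourhood. This is why densities are
    rounded to multiples of [1 / p]. *)
Lemma common_nbhd_popular (p w : nat) (kappa : R) Q U : #|Q| = p -> (0 < w <= p)%N ->
  0 < kappa ->
  {in Q, forall v, ((w%:R - 1) / p%:R + kappa) * #|U|%:R <= #|U :&: nbhd v|%:R} ->
  exists A, [/\ A \subset Q, (w <= #|A|)%N &
    kappa / (2 ^ p)%:R * #|U|%:R <= #|[set y in U | A \subset nbhd y]|%:R].
Proof.
move=> Qp /andP[w0 wp] k0 HQ; have p0 : 0 < p%:R :> R by rewrite ltr0n (leq_trans w0).
pose cnt A := #|[set y in U | Q :&: nbhd y == A]|.
have [/existsP[A /and3P[AQ wA hA]]|no] := boolP [exists A : {set V},
  [&& A \subset Q, (w <= #|A|)%N & kappa / (2 ^ p)%:R * #|U|%:R <= (cnt A)%:R]].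
  exists A; split=> //; apply: (le_trans hA); rewrite ler_nat; apply: subset_leq_card.
  by apply/subsetP => y; rewrite !inE => /andP[-> /eqP <-]; rewrite subsetIr.
have [U0|U0] := posnP #|U|.
  by exists Q; split; rewrite ?Qp // U0 mulr0.
have U0' : 0 < #|U|%:R :> R by rewrite ltr0n.
pose big := [set y in U | (w <= #|Q :&: nbhd y|)%N].
have bigU : #|big|%:R < kappa * #|U|%:R :> R.
  have -> : #|big| = (\sum_(A in [set A in powerset Q | w <= #|A|]) cnt A)%N.
    rewrite -sum1_card (partition_big (fun y => Q :&: nbhd y)
      [in [set A in powerset Q | (w <= #|A|)%N]]) /=.
      apply: eq_bigr => A; rewrite inE => /andP[_ wA]; rewrite /cnt -sum1_card.
      apply: eq_bigl => y; rewrite !inE andbAC; case: eqP => [->|]; rewrite ?wA ?andbT ?andbF //.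
    by move=> y; rewrite !inE => /andP[_ ->]; rewrite subsetIl.
  rewrite natr_sum; apply: (@lt_le_trans _ _
    (\sum_(A in [set A in powerset Q | (w <= #|A|)%N]) (kappa / (2 ^ p)%:R * #|U|%:R))).
    apply: ltr_sum; last first.
      move=> A; rewrite !inE => /andP[AQ wA]; rewrite ltNge.
      by apply: contra no => h; apply/existsP; exists A; rewrite AQ wA.
    by apply/hasP; exists Q; rewrite ?mem_index_enum // !inE subxx Qp.
  rewrite sumr_const -[_ *+ _]mulr_natl.
  have h : (#|[set A in powerset Q | (w <= #|A|)%N]| <= 2 ^ p)%N.
    by rewrite -Qp -card_powerset subset_leq_card //; apply/subsetP => A; rewrite !inE => /andP[].
  rewrite mulrA ler_pM2r // mulrCA ler_piMr ?(ltW k0) //.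
  by rewrite ler_pdivrMr ?ltr0n ?expn_gt0 // mul1r ler_nat.
have sumQ : (\sum_(v in Q) #|U :&: nbhd v| = \sum_(y in U) #|Q :&: nbhd y|)%N.
  by rewrite -!edgesE edgesC.
have up : (\sum_(y in U) #|Q :&: nbhd y| <= (w - 1) * #|U| + p * #|big|)%N.
  apply: (@leq_trans (\sum_(y in U) ((w - 1) + p * (y \in big)))%N).
    apply: leq_sum => y yU; rewrite inE yU /=.
    have := subset_leq_card (subsetIl Q (nbhd y)); rewrite Qp.
    by case: leqP => h1 h2; rewrite ?muln1 ?muln0; lia.
  rewrite big_split /= sum_nat_const -big_distrr /= mulnC leq_add2l leq_mul //.
  rewrite -sum1_card big_mkcond [leqRHS]big_mkcond /=; apply: leq_sum => y _.
  by case: (y \in U); case: (y \in big).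
have lo : (w%:R - 1 + p%:R * kappa) * #|U|%:R <= (\sum_(v in Q) #|U :&: nbhd v|)%:R.
  rewrite natr_sum; apply: (@le_trans _ _ (\sum_(v in Q) (((w%:R - 1) / p%:R + kappa) * #|U|%:R))).
    rewrite sumr_const Qp -[leRHS]mulr_natl mulrA ler_pM2r //.
    by rewrite mulrDr mulrCA divff ?mulr1 // lt0r_neq0.
  exact: ler_sum.
move: lo; rewrite sumQ => lo.
have := le_trans lo (_ : _ <= ((w - 1) * #|U| + p * #|big|)%:R); rewrite ler_nat => /(_ up).
rewrite natrD !natrM natrB // => h.
have h' : p%:R * #|big|%:R < p%:R * (kappa * #|U|%:R) by rewrite ltr_pM2l.
by exfalso; clear - h h'; lra.
Qed.

Lemma card_common (I : eqType) (p : nat) Q (A : I -> {set V}) (w : I -> nat) (l : seq I) :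
  #|Q| = p -> {in l, forall i, (w i <= #|A i|)%N} -> {in l, forall i, A i \subset Q} ->
  (p <= #|Q :&: \bigcap_(i <- l) A i| + \sum_(i <- l) (p - w i))%N.
Proof.
move=> Qp; elim: l => [|i l IH] wA AQ; first by rewrite !big_nil setIT Qp addn0.
rewrite !big_cons.
have h1 : (w i <= #|A i|)%N by apply: wA; rewrite inE eqxx.
have h2 : A i \subset Q by apply: AQ; rewrite inE eqxx.
have {}IH := IH (fun j jl => wA j (mem_behead (s := i :: l) jl))
  (fun j jl => AQ j (mem_behead (s := i :: l) jl)).
set B := \bigcap_(j <- l) A j in IH *.
have h3 : (#|Q :&: B| <= #|Q :&: (A i :&: B)| + #|Q :\: A i|)%N.
  rewrite -(cardsID (A i) (Q :&: B)) setIAC -setIA leq_add2l subset_leq_card //.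
  by rewrite setSD // subsetIl.
have h4 : #|Q :\: A i| = (p - #|A i|)%N by rewrite cardsD (setIidPr h2) Qp.
have h5 : (#|A i| <= p)%N by rewrite -Qp subset_leq_card.
lia.
Qed.

Lemma subset_of_card (A : {set V}) k : (k <= #|A|)%N -> exists2 B : {set V}, B \subset A & #|B| = k.
Proof.
move=> kA; have : (0 < #|[set B : {set V} | (B \subset A) && (#|B| == k)]|)%N.
  by rewrite cards_draws bin_gt0.
by case/card_gt0P => B; rewrite inE => /andP[BA /eqP Bk]; exists B.
Qed.

Section Clusters.
Variables (T : finType) (p K : nat) (W : T -> T -> nat) (cl : T -> {set V}).
Variables (dl kappa mu : R).
Hypotheses (p0 : (0 < p)%N) (dl0 : 0 < dl) (kappa0 : 0 < kappa) (kappa1 : kappa <= 1).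
Hypothesis mu0 : 0 < mu.
Hypothesis Kp_dense : forall A, mu <= #|A|%:R ->
  exists Q, [/\ Q \subset A, #|Q| = p & rel_clique Q].

(* A profile lists clusters together with the number of vertices to be chosen in
   each; [a] of the vertices of a K_p in the first cluster can have large common
   neighbourhoods in all the others as soon as a <= 1 or a <= p - sum (p - W). *)
Fixpoint profile_ok (l : seq (T * nat)) : bool :=
  if l is (t, a) :: l' then
    [&& (a == 1)%N || (a + \sum_(s <- l') (p - W t s.1) <= p)%N & profile_ok l']
  else true.

Let c : R := kappa / (2 ^ p)%:R.

Lemma c_gt0 : 0 < c. Proof. by rewrite divr_gt0 // ltr0n expn_gt0. Qed.

Lemma c_le_kappa : c <= kappa.
Proof.
by rewrite ler_pdivrMr ?ltr0n ?expn_gt0 // ler_pMr // ler1n expn_gt0.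
Qed.

(** [U t] is the part of cluster [t] still available and [th] its guaranteed share; each cluster
    filled costs a factor [c]. The hypothesis on [th] keeps the share above [(K + 1) dl], which
    leaves room to discard at most [K] exceptional sets of size [dl |cl t|] and still find a K_p. *)
Lemma embed_profile (l : seq (T * nat)) (th : R) (U : T -> {set V}) :
  (size l <= K)%N -> uniq [seq s.1 | s <- l] -> profile_ok l ->
  {in [seq s.1 | s <- l] &, forall s t, s != t ->
    (0 < W s t <= p)%N /\
    lower_regular E dl (((W s t)%:R - 1) / p%:R + kappa) (cl s) (cl t)} ->
  {in [seq s.1 | s <- l], forall t, mu <= dl * #|cl t|%:R} ->
  (K.+1)%:R * dl <= th * c ^+ size l ->
  {in [seq s.1 | s <- l], forall t, U t \subset cl t /\ th * #|cl t|%:R <= #|U t|%:R} ->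
  exists Q, [/\ rel_clique Q, #|Q| = (\sum_(s <- l) s.2)%N &
    {in Q, forall x, exists2 t, t \in [seq s.1 | s <- l] & x \in U t}].
Proof.
elim: l th U => [|[t a] l IH] th U.
  by move=> *; exists set0; split; rewrite ?cards0 ?big_nil // => x; rewrite inE.
rewrite /= => lK /andP[tl ul] /andP[Ha okl] HW Hmu Hth HU.
have c0 := c_gt0; have ck := c_le_kappa.
have c1 : c <= 1 by exact: le_trans ck kappa1.
have [Ut thU] := HU t (mem_head _ _).
have inl s : s \in [seq s.1 | s <- l] -> s \in t :: [seq s.1 | s <- l] by rewrite inE orbC => ->.
have th0 : 0 < th.
  rewrite -(pmulr_lgt0 _ (exprn_gt0 (size l).+1 c0)); apply: lt_le_trans Hth.
  by rewrite mulr_gt0.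
have thK : K.+1%:R * dl <= th.
  by apply: (le_trans Hth); apply: ler_piMr (ltW th0) (exprn_ile1 _ (ltW c0) c1).
have dlth : dl <= th.
  by apply: le_trans thK; rewrite ler_peMl ?ler1n // ltW.
have clt0 s : s \in t :: [seq s.1 | s <- l] -> 0 < #|cl s|%:R :> R.
  by move=> /Hmu h; rewrite -(pmulr_rgt0 _ dl0); exact: lt_le_trans h.
pose dens s : R := ((W t s)%:R - 1) / p%:R + kappa.
pose bad s := [set v in U t | #|U s :&: nbhd v|%:R < dens s * #|U s|%:R].
have badP s : s \in [seq s.1 | s <- l] -> #|bad s|%:R < dl * #|cl t|%:R.
  move=> sl; rewrite ltNge; apply/negP => hbad.
  have st : t != s by apply: contraNneq tl => ->.
  have [Us thUs] := HU s (inl s sl).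
  have [_ reg] := HW t s (mem_head _ _) (inl s sl) st.
  have badt : bad s \subset cl t.
    by apply: subset_trans Ut; apply/subsetP => v; rewrite inE => /andP[].
  have := reg _ _ badt Us hbad (le_trans (ler_wpM2r (ler0n _ _) dlth) thUs).
  apply/negP; rewrite -ltNge edgesE natr_sum natrM mulrCA -/(dens s).
  apply: (@lt_le_trans _ _ (\sum_(x in bad s) dens s * #|U s|%:R)); last first.
    by rewrite sumr_const -[leLHS]mulr_natl.
  apply: ltr_sum => [|v]; last by rewrite inE => /andP[].
  have : (0 < #|bad s|)%N.
    by rewrite -(ltr0n R); apply: lt_le_trans hbad; rewrite mulr_gt0 ?clt0 ?mem_head.
  by case/card_gt0P => v vb; apply/hasP; exists v; rewrite ?mem_index_enum.
pose good := U t :\: \bigcup_(s <- [seq s.1 | s <- l]) bad s.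
have goodU : mu <= #|good|%:R.
  apply: (le_trans (Hmu t (mem_head _ _))).
  have h : #|U t|%:R - (size l)%:R * (dl * #|cl t|%:R) <= #|good|%:R.
    rewrite lerBlDr; apply: (@le_trans _ _ (#|good| + #|\bigcup_(s <- [seq s.1 | s <- l]) bad s|)%:R).
      by rewrite ler_nat -(cardsID (\bigcup_(s <- [seq s.1 | s <- l]) bad s) (U t)) addnC leq_add2l
        subset_leq_card ?subsetIr.
    rewrite natrD lerD2l.
    have -> : size l = size [seq s.1 | s <- l] by rewrite size_map.
    elim: [seq s.1 | s <- l] badP => [|s r IHr] hb; first by rewrite big_nil cards0 mul0r.
    rewrite big_cons /= -natr1 mulrDl mul1r addrC.
    apply: (@le_trans _ _ (#|bad s| + #|\bigcup_(j <- r) bad j|)%:R).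
      by rewrite ler_nat cardsU leq_subr.
    rewrite natrD lerD ?IHr //; first by apply/ltW/hb; rewrite mem_head.
    by move=> j jr; apply: hb; rewrite inE jr orbT.
  have h2 : (size l).+1%:R * dl * #|cl t|%:R <= th * #|cl t|%:R.
    rewrite ler_wpM2r //; apply: le_trans thK; rewrite ler_wpM2r ?(ltW dl0) // ler_nat.
    exact: leq_trans lK _.
  by move: h h2 thU; rewrite -natr1; lra.
have [Q [Qgood Qp Qcl]] := Kp_dense goodU.
have Qdeg s v : s \in [seq s.1 | s <- l] -> v \in Q -> dens s * #|U s|%:R <= #|U s :&: nbhd v|%:R.
  move=> sl /(subsetP Qgood); rewrite inE => /andP[vb vU]; rewrite leNgt.
  apply: contra vb => h; rewrite bigcup_seq; apply/bigcupP; exists s => //.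
  by rewrite inE vU.
have Qt : Q \subset U t by apply: subset_trans Qgood _; exact: subsetDl.
have [A [AQ Aa HA]] : exists A, [/\ A \subset Q, #|A| = a &
    {in [seq s.1 | s <- l], forall s, c * #|U s|%:R <= #|[set y in U s | A \subset nbhd y]|%:R}].
  (* For [a = 1] any vertex of the K_p serves, since [W t s >= 1] gives it a share [kappa >= c] of
     every [U s]. Otherwise the popular sets [As s] miss at most [p - W t s] vertices each, so their
     intersection has at least [a]. *)
  case/orP: Ha => [/eqP ->|Ha].
    have /card_gt0P[v vQ] : (0 < #|Q|)%N by rewrite Qp.
    exists [set v]; split; rewrite ?cards1 ?sub1set // => s sl.
    apply: (@le_trans _ _ #|U s :&: nbhd v|%:R).
      apply: le_trans (Qdeg s v sl vQ); rewrite ler_wpM2r //.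
      apply: (le_trans ck); rewrite lerDr divr_ge0 // subr_ge0 ler1n.
      have st : t != s by apply: contraNneq tl => ->.
      by have [/andP[]] := HW t s (mem_head _ _) (inl s sl) st.
    rewrite ler_nat subset_leq_card //; apply/subsetP => y; rewrite !inE => /andP[-> vy].
    by rewrite sub1set inE Esym.
  have ex s : s \in [seq s.1 | s <- l] -> exists A, [&& A \subset Q, (W t s <= #|A|)%N &
      c * #|U s|%:R <= #|[set y in U s | A \subset nbhd y]|%:R].
    move=> sl; have st : t != s by apply: contraNneq tl => ->.
    have [wp _] := HW t s (mem_head _ _) (inl s sl) st.
    have [A [h1 h2 h3]] := common_nbhd_popular Qp wp kappa0 (fun v vQ => Qdeg s v sl vQ).
    by exists A; rewrite h1 h2.
  pose As s := odflt Q [pick A : {set V} | [&& A \subset Q, (W t s <= #|A|)%N &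
      c * #|U s|%:R <= #|[set y in U s | A \subset nbhd y]|%:R]].
  have AsP s : s \in [seq s.1 | s <- l] -> [&& As s \subset Q, (W t s <= #|As s|)%N &
      c * #|U s|%:R <= #|[set y in U s | As s \subset nbhd y]|%:R].
    by move=> /ex[A hA]; rewrite /As; case: pickP => [//|/(_ A)]; rewrite hA.
  have := @card_common _ p Q As (W t) [seq s.1 | s <- l] Qp.
  have h1 : {in [seq s.1 | s <- l], forall i, (W t i <= #|As i|)%N}.
    by move=> s /AsP/and3P[].
  have h2 : {in [seq s.1 | s <- l], forall i, As i \subset Q} by move=> s /AsP/and3P[].
  move=> /(_ h1 h2); rewrite [X in (_ <= _ + X)%N]big_map => hc.
  have {}hc : (a <= #|Q :&: \bigcap_(i <- [seq s.1 | s <- l]) As i|)%N.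
    by move: Ha hc => Ha hc; rewrite -(leq_add2r (\sum_(s <- l) (p - W t s.1))) (leq_trans Ha).
  have [A AI Aa] := subset_of_card hc; exists A; split=> //.
    by apply: subset_trans AI (subsetIl _ _).
  move=> s sl; have /and3P[_ _ h] := AsP s sl; apply: (le_trans h).
  rewrite ler_nat subset_leq_card //; apply/subsetP => y; rewrite !inE => /andP[-> hy] /=.
  apply: subset_trans hy; apply: subset_trans AI _.
  apply: subset_trans (subsetIr _ _) _; rewrite bigcap_seq.
  exact: bigcap_inf.
have [|||||||Q' [Q'cl Q'c Q'U]] := IH (th * c) (fun s => [set y in U s | A \subset nbhd y]) => //.
- exact: ltnW.
- by move=> s s' sl sl'; apply: HW; exact: inl.
- by move=> s sl; exact: Hmu (inl s sl).
- by rewrite -mulrA -exprS.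
- move=> s sl; have [h1 h2] := HU s (inl s sl); split.
    by apply: subset_trans h1; apply/subsetP => y; rewrite inE => /andP[].
  by apply: le_trans (HA s sl); rewrite -mulrA mulrCA ler_pM2l.
have AQ' x y : x \in A -> y \in Q' -> E x y.
  by move=> xA /Q'U[s _]; rewrite inE => /andP[_ /subsetP/(_ x xA)]; rewrite inE Esym.
exists (A :|: Q'); split.
- move=> x y; rewrite !inE => /orP[xA|xQ] /orP[yA|yQ] xy.
  + by apply: Qcl xy; apply: (subsetP AQ).
  + exact: AQ'.
  + by rewrite Esym AQ'.
  + exact: Q'cl.
- rewrite cardsU (_ : A :&: Q' = set0) ?cards0 ?subn0 ?big_cons ?Aa ?Q'c //.
  apply/setP => x; rewrite !inE; apply/negP => /andP[xA xQ].
  by have := AQ' x x xA xQ; rewrite Eirr.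
- move=> x; rewrite inE => /orP[xA|/Q'U[s sl]].
    by exists t; rewrite ?mem_head // (subsetP Qt) // (subsetP AQ).
  by rewrite inE => /andP[xU _]; exists s => //; exact: inl.
Qed.
End Clusters.
End Embedding.

(** * The upper bound for a single graph *)

Section UpperBound.
Variables (R : archiRealFieldType).

Lemma irregularC (V : finType) (E : rel V) (dl : R) A B : symmetric E ->
  irregular E dl A B -> irregular E dl B A.
Proof.
move=> Es /existsP[[A' B'] /and5P[/= h1 h2 h3 h4 h5]]; apply/existsP; exists (B', A').
rewrite /irregular_witness /= h1 h2 h3 h4 /= /density edgesC //.
by rewrite (edgesC Es B) (mulnC #|B|) (mulnC #|B'|).
Qed.

Lemma balanced_coloring (V : finType) (m : nat) : (0 < m)%N ->
  exists f : V -> 'I_m, forall a, (#|color_class f a| <= #|V| %/ m + 1)%N.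
Proof.
case: m => // m _; exists (fun x => inord (enum_rank x %% m.+1)) => a.
have lt (x : V) : (enum_rank x %/ m.+1 < #|V| %/ m.+1 + 1)%N.
  by rewrite addn1 ltnS leq_div2r // ltnW.
rewrite -[leqRHS]card_ord -(card_in_imset (f := fun x => Ordinal (lt x))) ?max_card //.
move=> x y; rewrite !inE => /eqP <- /eqP/(congr1 val) /=.
rewrite !inordK ?ltn_pmod // => h1 /(congr1 val) /= h2.
apply: enum_rank_inj; apply: val_inj => /=.
by rewrite (divn_eq (enum_rank x) m.+1) (divn_eq (enum_rank y) m.+1) h1 h2.
Qed.

(** Rounding up to a multiple of [1 / p], with value 0 for all [d <= 0]. *)
Definition weight_of (p : nat) (d : R) : nat :=
  find (fun w => d <= w%:R / p%:R) (iota 0 p.+1).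

Lemma weight_ofP (p : nat) (d : R) : (0 < p)%N -> d <= 1 ->
  [/\ (weight_of p d <= p)%N, d <= (weight_of p d)%:R / p%:R &
      (0 < weight_of p d)%N -> ((weight_of p d)%:R - 1) / p%:R < d].
Proof.
move=> p0 d1; have p0' : p%:R != 0 :> R by rewrite pnatr_eq0 -lt0n.
have hw : has (fun w => d <= w%:R / p%:R) (iota 0 p.+1).
  by apply/hasP; exists p; rewrite ?mem_iota ?divff // add0n ltnSn.
have hp : (weight_of p d < p.+1)%N by move: hw; rewrite has_find size_iota.
split=> //; first by have := nth_find 0%N hw; rewrite nth_iota.
rewrite /weight_of in hp *; case E: find hp => [//|w] wp _.
have := @before_find _ 0%N (fun w => d <= w%:R / p%:R) (iota 0 p.+1) w.
rewrite E nth_iota ?add0n ?ltnS // => [/(_ (leqnn _))/negbT|]; last exact: ltnW.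
by rewrite -ltNge -natr1 addrK.
Qed.

(** * The weighted reduced graph *)

Section Reduced.
Variables (V : finType) (E : rel V) (C : finType) (f : V -> C).
Variables (p q : nat) (kappa gamma dl : R).
Hypotheses (Esym : symmetric E) (Eirr : irreflexive E).
Let cl := color_class f.
Hypotheses (p0 : (0 < p)%N) (kappa0 : 0 < kappa) (gamma0 : 0 < gamma).
Hypothesis V0 : (0 < #|V|)%N.
Let K := (q + 3)%N.
Let c : R := kappa / (2 ^ p)%:R.
Hypotheses (kappa1 : kappa <= 1) (dl0 : 0 < dl) (dlK : K.+1%:R * dl <= c ^+ K).
Hypothesis Kp_dense : forall A : {set V}, dl * (gamma * #|V|%:R) <= #|A|%:R ->
  exists Q : {set V}, [/\ Q \subset A, #|Q| = p & rel_clique E Q].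
Hypothesis Kq_free : forall Q : {set V}, #|Q| = q -> ~ rel_clique E Q.

Definition large (a : C) : bool := gamma * #|V|%:R <= #|cl a|%:R.

(** Lowering the density by [2 * kappa] before rounding up ensures that a weight [w > 0] means
    density above [(w - 1) / p + 2 kappa]. One [kappa] absorbs the regularity error [dl], the other
    is the surplus that the embedding needs. *)
Definition reduced_weight (a b : C) : nat :=
  if [&& a != b, ~~ irregular E dl (cl a) (cl b), large a & large b]
  then weight_of p (density R E (cl a) (cl b) - 2 * kappa) else 0.

Lemma density_le1 (A B : {set V}) : density R E A B <= 1.
Proof.
rewrite /density; case: (posnP (#|A| * #|B|)) => [->|h]; first by rewrite invr0 mulr0.
rewrite ler_pdivrMr ?ltr0n // mul1r ler_nat /edges -[leqRHS]sum_nat_const.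
apply: leq_sum => x _; rewrite -sum1_card; apply: leq_sum => y _.
exact: leq_b1.
Qed.

Lemma reduced_weightC a b : reduced_weight a b = reduced_weight b a.
Proof.
rewrite /reduced_weight eq_sym andbCA [large a && _]andbC andbCA.
have -> : irregular E dl (cl a) (cl b) = irregular E dl (cl b) (cl a).
  by apply/idP/idP; exact: irregularC.
by rewrite /density edgesC // mulnC.
Qed.

Lemma reduced_weight_irr a : reduced_weight a a = 0%N.
Proof. by rewrite /reduced_weight eqxx. Qed.

Lemma density_shift_le1 (A B : {set V}) : density R E A B - 2 * kappa <= 1.
Proof. by have h := density_le1 A B; have k0 := kappa0; lra. Qed.

Lemma reduced_weight_le a b : (reduced_weight a b <= p)%N.
Proof.
rewrite /reduced_weight; case: ifP => // _.
by have [] := @weight_ofP p (density R E (cl a) (cl b) - 2 * kappa) p0 (density_shift_le1 _ _).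
Qed.

Lemma dl_le_kappa : dl <= kappa.
Proof.
have c0 : 0 < c by apply: c_gt0.
have cK : c <= kappa by apply: c_le_kappa.
apply: le_trans cK; apply: (@le_trans _ _ (c ^+ K)).
  by apply: le_trans dlK; rewrite ler_peMl ?ler1n // ltW.
rewrite /K addn3 exprS ler_piMr ?(ltW c0) //.
by apply: exprn_ile1; [exact: ltW|apply: le_trans kappa1; apply: c_le_kappa].
Qed.

Lemma reduced_weight_regular a b : (0 < reduced_weight a b)%N ->
  lower_regular E dl (((reduced_weight a b)%:R - 1) / p%:R + kappa) (cl a) (cl b)
  /\ large a.
Proof.
rewrite /reduced_weight; case: ifP => // /and4P[ab reg la lb] w0; split=> //.
move=> A' B' sA sB hA hB; have := regular_lower reg sA sB hA hB.
apply: le_trans; rewrite ler_wpM2r //.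
have [_ _ /(_ w0)] := @weight_ofP p (density R E (cl a) (cl b) - 2 * kappa) p0 (density_shift_le1 _ _).
by move=> h; have h2 := dl_le_kappa; lra.
Qed.

(** At least two clusters are required because a cluster is known to be large only through a
    positive weight to another one. *)
Lemma reduced_profile (l : seq (C * nat)) : (size l <= K)%N -> (1 < size l)%N ->
  uniq [seq s.1 | s <- l] -> profile_ok p reduced_weight l ->
  {in [seq s.1 | s <- l] &, forall s t, s != t -> (0 < reduced_weight s t)%N} ->
  (\sum_(s <- l) s.2 < q)%N.
Proof.
move=> lK l1 ul okl Wl; rewrite ltnNge; apply/negP => ql.
have c0 : 0 < c by apply: c_gt0.
have c1 : c <= 1 by apply: le_trans kappa1; apply: c_le_kappa.
have large_l : {in [seq s.1 | s <- l], forall t, large t}.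
  move=> t tl; have [s sl st] : exists2 s, s \in [seq s.1 | s <- l] & s != t.
    case: l ul l1 {lK okl ql Wl} tl => [|s1 [|s2 l]] //= /andP[h _] _ _.
    have [Et|Et] := eqVneq s1.1 t; last by exists s1.1; rewrite ?mem_head.
    exists s2.1; first by rewrite !inE eqxx orbT.
    by apply: contraNneq h => Es2; rewrite Et -Es2 mem_head.
  by have [] := reduced_weight_regular (Wl t s tl sl _); rewrite // eq_sym.
have [|||||Q [Qcl Qc _]] := @embed_profile R V E Esym Eirr C p K reduced_weight cl dl kappa
  (dl * (gamma * #|V|%:R)) p0 dl0 kappa0 kappa1 _ Kp_dense l 1 cl lK ul okl.
- by rewrite !mulr_gt0 // ltr0n.
- move=> s t sl tl st; have w0 := Wl s t sl tl st.
  by rewrite w0 reduced_weight_le; split=> //; have [] := reduced_weight_regular w0.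
- by move=> t /large_l h; rewrite ler_wpM2l // ltW.
- rewrite mul1r; apply: (le_trans dlK); rewrite -/c.
  by apply: ler_wiXn2l => //; exact: ltW.
- by move=> t _; rewrite mul1r.
have [B BQ Bq] := subset_of_card (leq_trans ql (eq_leq (esym Qc))).
by apply: (Kq_free Bq) => x y /(subsetP BQ) xQ /(subsetP BQ) yQ; exact: Qcl.
Qed.

Lemma profile_ones (r : seq C) l : profile_ok p reduced_weight l ->
  profile_ok p reduced_weight ([seq (t, 1%N) | t <- r] ++ l).
Proof. by move=> okl; elim: r => //= t r ->. Qed.

(** One vertex is taken from each cluster of [s] outside [l], before those of [l]. Truncating this
    list to [q] clusters keeps the profile within [K = q + 3]; if anything were cut off, the single
    vertices alone would already form a K_q. *)
Lemma reduced_extend (s : seq C) l : uniq s ->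
  {in s &, forall a b, a != b -> (0 < reduced_weight a b)%N} ->
  uniq [seq t.1 | t <- l] -> {subset [seq t.1 | t <- l] <= s} ->
  profile_ok p reduced_weight l -> (1 < size l <= 3)%N ->
  (\sum_(t <- l) t.2 + size s < q + size l)%N.
Proof.
move=> us Ws ul ls okl /andP[l1 l3]; set h := [seq t.1 | t <- l] in ul ls.
pose r := [seq t <- s | t \notin h].
have sz : (size s = size r + size l)%N.
  rewrite size_filter -(count_predC [in h] s) addnC; congr (_ + _)%N.
  rewrite -size_filter -[RHS](size_map fst); apply/perm_size/uniq_perm; rewrite ?filter_uniq //.
  by move=> t; rewrite mem_filter; case: (boolP (t \in h)) => // /ls ->.
pose l' := [seq (t, 1%N) | t <- take q r] ++ l.
have El' : [seq t.1 | t <- l'] = take q r ++ h.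
  by rewrite map_cat -map_comp map_id_in.
have rs : {subset take q r <= s} by move=> t /mem_take; rewrite mem_filter => /andP[].
have := @reduced_profile l'; rewrite El' => H.
have : (\sum_(t <- l') t.2 < q)%N.
  apply: H.
  - by rewrite size_cat size_map size_take_min leq_add // geq_minl.
  - by rewrite size_cat (leq_trans l1) // leq_addl.
  - rewrite cat_uniq take_uniq ?filter_uniq //= ul andbT.
    apply/hasPn => t th; apply/negP => /mem_take; rewrite mem_filter => /andP[].
    by rewrite th.
  - exact: profile_ones.
  - move=> u v; rewrite !mem_cat => ur vr; apply: Ws.
      by case/orP: ur => [/rs|/ls].
    by case/orP: vr => [/rs|/ls].
rewrite big_cat big_map /= sum1_size size_take_min sz => hh.
rewrite addnA ltn_add2r addnC; apply: leq_ltn_trans (hh); rewrite leq_add2r.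
move: hh; rewrite leq_min leqnn andbT; case: (leqP (size r) q) => // _ hh.
by have := leq_ltn_trans (leq_addr _ _) hh; rewrite ltnn.
Qed.

(** Profile: [W a b] vertices in [a], a whole K_p in [b], one vertex in each other cluster. *)
Lemma reduced_pair (s : seq C) : uniq s ->
  {in s &, forall a b, a != b -> (0 < reduced_weight a b)%N} ->
  {in s &, forall a b, a != b -> (reduced_weight a b + p + size s <= q + 1)%N}.
Proof.
move=> us Ws a b as_ bs ab.
have := @reduced_extend s [:: (a, reduced_weight a b); (b, p)] us Ws.
rewrite /= !big_cons !big_nil /= !addn0 inE ab subnKC ?reduced_weight_le // leqnn !orbT.
rewrite addn2 ltnS addn1; apply => //.
by move=> t; rewrite !inE => /orP[]/eqP ->.
Qed.

(** Profile: [W a b + W a d - p] vertices in [a], [W b d] in [b] and [p] in [d]. If the first number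
    is not positive, the sum is at most [p + W b d] and the pair inequality for [b], [d]
    suffices. *)
Lemma reduced_triple (s : seq C) : uniq s ->
  {in s &, forall a b, a != b -> (0 < reduced_weight a b)%N} ->
  {in s & &, forall a b c, uniq [:: a; b; c] ->
    (reduced_weight a b + reduced_weight a c + reduced_weight b c + size s <= q + 2)%N}.
Proof.
move=> us Ws a b d as_ bs ds; rewrite /= !inE negb_or => /and3P[/andP[ab ad] bd _].
have wab := reduced_weight_le a b; have wad := reduced_weight_le a d.
have wbd := reduced_weight_le b d.
have [small|big] := leqP (reduced_weight a b + reduced_weight a d) p.
  have := reduced_pair us Ws bs ds bd; move: small.
  by move: (reduced_weight _ _) (reduced_weight _ _) (reduced_weight _ _) (size s) => x y z k; clear; lia.
have := @reduced_extend s [:: (a, reduced_weight a b + reduced_weight a d - p)%N;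
  (b, reduced_weight b d); (d, p)] us Ws.
rewrite /= !big_cons !big_nil /= !addn0 !inE negb_or ab ad bd (subnKC wbd) leqnn !orbT.
move: wab wad wbd big; set x := reduced_weight a b; set y := reduced_weight a d.
set z := reduced_weight b d; move=> wab wad wbd big H.
have {}H : (x + y - p + (z + p) + size s < q + 3)%N.
  apply: H => //; last by apply/andP; split=> //; apply/orP; right; clear - wab wad big; lia.
  by move=> t; rewrite !inE => /or3P[]/eqP ->.
by clear - H big; lia.
Qed.

Lemma sum_color_class : (\sum_a #|cl a| = #|V|)%N.
Proof.
rewrite -sum1_card (partition_big f predT) //=; apply: eq_bigr => a _.
by rewrite -sum1_card; apply: eq_bigl => x; rewrite inE.
Qed.

Lemma edges_le (A B : {set V}) : (edges E A B <= #|A| * #|B|)%N.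
Proof.
rewrite -[leqRHS]sum_nat_const; apply: leq_sum => x _.
by rewrite -sum1_card; apply: leq_sum => y _; exact: leq_b1.
Qed.

Lemma edges_color_classes :
  (edges E setT setT = \sum_(ab : C * C) edges E (cl ab.1) (cl ab.2))%N.
Proof.
rewrite -(pair_bigA _ (fun a b => edges E (cl a) (cl b))) /=.
transitivity (\sum_x \sum_y E x y)%N.
  by apply: eq_big => [x|x _]; rewrite ?inE //; apply: eq_bigl => y; rewrite inE.
rewrite (partition_big f predT) //=; apply: eq_bigr => a _.
rewrite exchange_big /= [LHS](eq_bigr (fun y => \sum_(x in cl a) E x y)%N) => [|y _]; last first.
  by apply: eq_bigl => x; rewrite inE.
rewrite (partition_big f predT) //=; apply: eq_bigr => b _.
by rewrite exchange_big; apply: eq_bigr => x _; apply: eq_bigl => y; rewrite inE.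
Qed.

(** A regular pair of distinct large classes has density at most [W / p + 2 kappa]. All other pairs
    have weight 0 and are paid for in full by the last three terms: irregular pairs, pairs with a
    small class on either side, and pairs inside one class. *)
Lemma edges_reduced : (edges E setT setT)%:R <=
  form reduced_weight (enum C) (fun a => #|cl a|%:R : R) / p%:R
  + 2 * kappa * (#|V| ^ 2)%:R + (irregular_mass E dl f)%:R
  + 2 * #|C|%:R * gamma * (#|V| ^ 2)%:R + \sum_a #|cl a|%:R ^+ 2.
Proof.
have n2 : (#|V| ^ 2)%:R = \sum_(ab : C * C) (#|cl ab.1| * #|cl ab.2|)%:R :> R.
  rewrite -natr_sum -(pair_bigA _ (fun a b => #|cl a| * #|cl b|)%N) /=; congr _%:R.
  under eq_bigr do rewrite -big_distrr /=.
  by rewrite -big_distrl /= sum_color_class mulnn.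
have diag : \sum_a #|cl a|%:R ^+ 2
    = \sum_(ab : C * C) (ab.1 == ab.2)%:R * (#|cl ab.1| * #|cl ab.2|)%:R :> R.
  rewrite -(pair_bigA _ (fun a b => (a == b)%:R * (#|cl a| * #|cl b|)%:R)) /=.
  apply: eq_bigr => a _; rewrite (bigD1 a) //= eqxx mul1r big1 ?addr0 ?natrM ?expr2 //.
  by move=> b; rewrite eq_sym => /negbTE ->; rewrite mul0r.
have irr : (irregular_mass E dl f)%:R
    = \sum_(ab : C * C) (irregular E dl (cl ab.1) (cl ab.2))%:R * (#|cl ab.1| * #|cl ab.2|)%:R :> R.
  rewrite natr_sum big_mkcond; apply: eq_bigr => ab _.
  by case: irregular; rewrite ?mul1r ?mul0r.
have frm : form reduced_weight (enum C) (fun a => #|cl a|%:R : R) / p%:R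
    = \sum_(ab : C * C) (reduced_weight ab.1 ab.2)%:R / p%:R * (#|cl ab.1| * #|cl ab.2|)%:R.
  rewrite -(pair_bigA _ (fun a b => (reduced_weight a b)%:R / p%:R * (#|cl a| * #|cl b|)%:R)) /=.
  rewrite /form big_enum /= mulr_suml; apply: eq_bigr => a _.
  rewrite big_enum /= mulr_suml; apply: eq_bigr => b _.
  by rewrite natrM; ring.
have small1 : \sum_(ab : C * C) (~~ large ab.1)%:R * (#|cl ab.1| * #|cl ab.2|)%:R
    <= #|C|%:R * gamma * (#|V| ^ 2)%:R.
  rewrite -(pair_bigA _ (fun a b => (~~ large a)%:R * (#|cl a| * #|cl b|)%:R)) /=.
  rewrite (_ : _ * _ * _ = \sum_(a : C) gamma * (#|V| ^ 2)%:R); last first.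
    by rewrite sumr_const -[RHS]mulr_natl mulrA.
  apply: ler_sum => a _; rewrite -mulr_sumr -natr_sum -big_distrr /= sum_color_class.
  rewrite /large -ltNge; case: ltP => h; last by rewrite mul0r mulr_ge0 // ltW.
  by rewrite mul1r -mulnn !natrM mulrA ler_wpM2r // ltW.
have small2 : \sum_(ab : C * C) (~~ large ab.2)%:R * (#|cl ab.1| * #|cl ab.2|)%:R
    <= #|C|%:R * gamma * (#|V| ^ 2)%:R.
  apply: le_trans small1; rewrite le_eqVlt; apply/orP; left; apply/eqP.
  rewrite -(pair_bigA _ (fun a b => (~~ large b)%:R * (#|cl a| * #|cl b|)%:R)) /=.
  rewrite -(pair_bigA _ (fun a b => (~~ large a)%:R * (#|cl a| * #|cl b|)%:R)) /=.
  by rewrite exchange_big /=; do 2![apply: eq_bigr => ? _]; rewrite mulnC.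
apply: (@le_trans _ _ (\sum_(ab : C * C)
   ((reduced_weight ab.1 ab.2)%:R / p%:R + 2 * kappa
    + (irregular E dl (cl ab.1) (cl ab.2))%:R + ((~~ large ab.1)%:R + (~~ large ab.2)%:R)
    + (ab.1 == ab.2)%:R) * (#|cl ab.1| * #|cl ab.2|)%:R)); last first.
  rewrite (eq_bigr (fun ab : C * C =>
    (reduced_weight ab.1 ab.2)%:R / p%:R * (#|cl ab.1| * #|cl ab.2|)%:R
    + 2 * kappa * (#|cl ab.1| * #|cl ab.2|)%:R
    + (irregular E dl (cl ab.1) (cl ab.2))%:R * (#|cl ab.1| * #|cl ab.2|)%:R
    + ((~~ large ab.1)%:R * (#|cl ab.1| * #|cl ab.2|)%:R
      + (~~ large ab.2)%:R * (#|cl ab.1| * #|cl ab.2|)%:R)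
    + (ab.1 == ab.2)%:R * (#|cl ab.1| * #|cl ab.2|)%:R)); last by move=> ab _; ring.
  rewrite !big_split /= -frm -irr -diag -mulr_sumr -n2 lerD2r lerD2l.
  by rewrite -!mulrA [leRHS]mulr_natl mulr2n !mulrA lerD.
rewrite edges_color_classes natr_sum; apply: ler_sum => -[a b] _ /=.
have k2 : 0 <= 2 * kappa by rewrite mulr_ge0 // ltW.
have w0 : 0 <= (reduced_weight a b)%:R / p%:R :> R by rewrite divr_ge0.
set X := (#|cl a| * #|cl b|)%N.
have trivial_bound (u : R) : 1 <= u -> (edges E (cl a) (cl b))%:R <= u * X%:R.
  move=> u1; apply: (@le_trans _ _ X%:R); first by rewrite ler_nat edges_le.
  by rewrite ler_peMl.
have b0 (t : bool) : 0 <= t%:R :> R by [].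
have [ab|ab] := eqVneq a b.
  by apply: trivial_bound; rewrite lerDr !addr_ge0.
have [irab|irab] := boolP (irregular E dl (cl a) (cl b)).
  apply: trivial_bound; have h1 := b0 (~~ large a); have h2 := b0 (~~ large b).
  by rewrite /=; lra.
have [la|la] := boolP (large a); last first.
  apply: trivial_bound; have h1 := b0 (~~ large b).
  by rewrite /=; lra.
have [lb|lb] := boolP (large b); last first.
  by apply: trivial_bound; rewrite /=; lra.
rewrite /= !addr0 {trivial_bound w0}/reduced_weight ab irab la lb /=.
have [_ h _] := @weight_ofP p _ p0 (density_shift_le1 (cl a) (cl b)).
have [X0|X0] := posnP X.
  by rewrite X0 mulr0 (_ : edges _ _ _ = 0%N) //; apply/eqP; rewrite -leqn0 -X0 edges_le.
rewrite -ler_pdivrMr ?ltr0n // -/(density R E (cl a) (cl b)).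
by rewrite -lerBlDr.
Qed.

End Reduced.

Lemma ramsey_turan_upper (p q : nat) (D eta : R) : turan_bound p q D -> (0 < p)%N ->
  0 < eta -> exists2 eps : R, 0 < eps & exists N : nat,
  forall (V : finType) (E : rel V), symmetric E -> irreflexive E -> (N <= #|V|)%N ->
    (forall A : {set V}, eps * #|V|%:R < #|A|%:R ->
      exists Q : {set V}, [/\ Q \subset A, #|Q| = p & rel_clique E Q]) ->
    (forall Q : {set V}, #|Q| = q -> ~ rel_clique E Q) ->
    (edges E setT setT)%:R <= (D / p%:R + eta) * (#|V| ^ 2)%:R.
Proof.
move=> tb p0 eta0.
(* The four errors are made at most [eta / 4] (rounding), [eta / 8] (irregular pairs), [eta / 8]
   (small classes) and [eta / 4] (inside classes). The parameters are chosen in the order [kappa],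
   [dl], [M], [gamma], [eps]. *)
pose kappa := Num.min 1 (eta / 8).
have kappa0 : 0 < kappa by rewrite lt_min ltr01 divr_gt0.
have kappa1 : kappa <= 1 by rewrite ge_min lexx.
have kappa2 : kappa <= eta / 8 by rewrite ge_min lexx orbT.
pose K := (q + 3)%N; pose c := kappa / (2 ^ p)%:R; pose dl := c ^+ K / K.+1%:R.
have c0 : 0 < c by apply: c_gt0.
have c1 : c <= 1 by apply: le_trans kappa1; apply: c_le_kappa.
have dl0 : 0 < dl by rewrite divr_gt0 ?exprn_gt0.
have dlK : K.+1%:R * dl <= c ^+ K by rewrite mulrC divfK ?pnatr_eq0.
have dl1 : dl <= 1.
  rewrite ler_pdivrMr // mul1r; apply: (@le_trans _ _ 1); last by rewrite ler1n.
  by apply: exprn_ile1; rewrite // ltW.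
have eta8 : 0 < eta / 8 by rewrite divr_gt0.
pose m0 := (Num.bound (8 / eta)).+1.
have m0P : 8 / eta < m0%:R.
  apply: lt_trans (archi_boundP _) _; first by rewrite divr_ge0 // ltW.
  by rewrite ltr_nat.
have [M HM] := regularity m0 dl0 dl1 eta8.
pose gamma := eta / 16 / M.+1%:R.
have gamma0 : 0 < gamma by rewrite !divr_gt0.
(* Halving turns the weak inequality on the size of [A] into the strict one assumed for [eps]. *)
exists (dl * gamma / 2); first by rewrite !divr_gt0 // mulr_gt0.
exists m0 => V E Es Ei NV Kp Kq.
have V0 : (0 < #|V|)%N by apply: leq_trans NV.
have V0' : 0 < #|V|%:R :> R by rewrite ltr0n.
have [f0 f0P] := balanced_coloring V (ltn0Sn _ : (0 < m0)%N).
have [|C [f [pi [pif CM reg]]]] := HM V E _ f0; first by rewrite card_ord.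
have Kp' (A : {set V}) : dl * (gamma * #|V|%:R) <= #|A|%:R ->
    exists Q : {set V}, [/\ Q \subset A, #|Q| = p & rel_clique E Q].
  move=> hA; apply: Kp; apply: lt_le_trans hA.
  rewrite [ltRHS]mulrA ltr_pM2r //.
  by have dg0 := mulr_gt0 dl0 gamma0; lra.
have H1 : (edges E setT setT)%:R <=
  form (reduced_weight E f p kappa gamma dl) (enum C) (fun a => #|color_class f a|%:R : R) / p%:R
  + 2 * kappa * (#|V| ^ 2)%:R + (irregular_mass E dl f)%:R
  + 2 * #|C|%:R * gamma * (#|V| ^ 2)%:R + \sum_a #|color_class f a|%:R ^+ 2.
  by apply: edges_reduced.
have H2 : form (reduced_weight E f p kappa gamma dl) (enum C) (fun a => #|color_class f a|%:R : R)
    <= D * (#|V| ^ 2)%:R.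
  have -> : (#|V| ^ 2)%:R = mass (enum C) (fun a => #|color_class f a|%:R : R) ^+ 2.
    by rewrite /mass big_enum /= -natr_sum sum_color_class natrX.
  apply: (weighted_turan _ _ tb) => //.
  - by move=> a b; apply: reduced_weightC.
  - by move=> a; apply: reduced_weight_irr.
  - by move=> a b; apply: reduced_weight_le.
  - move=> s us Ws; split.
      by apply: (reduced_pair Es Ei _ _ _ _ _ _ _ Kp' Kq us Ws).
    by apply: (reduced_triple Es Ei _ _ _ _ _ _ _ Kp' Kq us Ws).
have n20 : 0 <= (#|V| ^ 2)%:R :> R by [].
have H3 : 2 * kappa * (#|V| ^ 2)%:R <= eta / 4 * (#|V| ^ 2)%:R.
  by rewrite ler_wpM2r //; lra.
have H4 : 2 * #|C|%:R * gamma * (#|V| ^ 2)%:R <= eta / 8 * (#|V| ^ 2)%:R.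
  rewrite ler_wpM2r // /gamma !mulrA ler_pdivrMr ?ltr0n //.
  have -> : 2 * #|C|%:R * eta / 16 = eta / 8 * #|C|%:R by field.
  by rewrite ler_wpM2l ?(ltW eta8) // ler_nat (leq_trans CM).
have H5 : \sum_a #|color_class f a|%:R ^+ 2 <= eta / 4 * (#|V| ^ 2)%:R.
  have cla a : #|color_class f a|%:R <= eta / 4 * #|V|%:R.
    apply: (@le_trans _ _ (#|V| %/ m0 + 1)%:R).
      rewrite ler_nat; apply: leq_trans (f0P (pi a)); apply: subset_leq_card.
      by apply/subsetP => x; rewrite !inE pif => /eqP ->.
    have m00 : 0 < m0%:R :> R by rewrite ltr0n.
    have h1 : (#|V| %/ m0)%:R <= eta / 8 * #|V|%:R.
      apply: (@le_trans _ _ (#|V|%:R / m0%:R)).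
        by rewrite ler_pdivlMr // -natrM ler_nat leq_trunc_div.
      rewrite mulrC ler_wpM2r // -[eta / 8]invrK lef_pV2 ?posrE ?invr_gt0 //.
      by rewrite invf_div ltW.
    have h2 : 1 <= eta / 8 * #|V|%:R.
      have : eta / 8 * (8 / eta) <= eta / 8 * #|V|%:R.
        rewrite ler_pM2l //; apply: (le_trans (ltW m0P)); by rewrite ler_nat.
      by have -> : eta / 8 * (8 / eta) = 1 by field; rewrite lt0r_neq0.
    by rewrite natrD; lra.
  apply: (@le_trans _ _ (\sum_a eta / 4 * #|V|%:R * #|color_class f a|%:R)).
    by apply: ler_sum => a _; rewrite expr2 ler_wpM2r.
  by rewrite -mulr_sumr -natr_sum sum_color_class natrX expr2 mulrA.
have p0' : 0 < p%:R :> R by rewrite ltr0n.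
have H6 : form (reduced_weight E f p kappa gamma dl) (enum C) (fun a => #|color_class f a|%:R : R) / p%:R
   <= D / p%:R * (#|V| ^ 2)%:R.
  by rewrite mulrAC ler_pM2r // invr_gt0.
move: H1 H3 H4 H5 H6 reg; set F := form _ _ _ / _.
set S := \sum_a _; set DP := D / p%:R; set N2 := (#|V| ^ 2)%:R; set I := (irregular_mass _ _ _)%:R.
set CC := 2 * _ * gamma * _; set LL := edges _ _ _; move=> H1 H3 H4 H5 H6 H7.
have H8 : 0 <= eta * N2 by rewrite mulr_ge0 // ltW.
clear - H1 H3 H4 H5 H6 H7 H8; lra.
Qed.
End UpperBound.

(** * Passage to the densities *)

Section Densities.
Variable R : realType.

Lemma limn_esup_le (u : nat -> \bar R) (c : \bar R) N :
  (forall n, (N <= n)%N -> (u n <= c)%E) -> (limn_esup u <= c)%E.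
Proof.
move=> uc; rewrite /limn_esup limf_esupE.
apply: (@le_trans _ _ (ereal_sup [set u n | n in [set n | (N <= n)%N]]%classic)).
  by apply: ereal_inf_lbound; exists [set n | (N <= n)%N]%classic => //; exists N.
by apply: ge_ereal_sup => _ [n /= Nn <-]; exact: uc.
Qed.

Lemma le_limn_einf (u : nat -> \bar R) (c : \bar R) N :
  (forall n, (N <= n)%N -> (c <= u n)%E) -> (c <= limn_einf u)%E.
Proof.
move=> cu; rewrite /limn_einf leeNr.
by apply: (@limn_esup_le _ _ N) => n Nn; rewrite leeN2 cu.
Qed.

Lemma upper_density_le p q (c : R) :
  (forall eta : R, 0 < eta -> exists2 eps : R, 0 < eps & exists N, forall n, (N <= n)%N ->
    ramsey_turan_ratio p q eps n <= c + eta) ->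
  (upper_ramsey_turan_density R p q <= c%:E)%E.
Proof.
move=> H; apply/lee_addgt0Pr => e e0; have [eps eps0 [N HN]] := H e e0.
apply: lime_le; first exact: is_cvg_ramsey_turan_limsup.
near=> y; apply: (@limn_esup_le _ _ N) => n Nn.
rewrite lee_fin; apply: le_trans (HN n Nn); apply: ramsey_turan_ratio_mono.
by apply: ltW; near: y; exact: nbhs_right_lt.
Unshelve. all: by end_near. Qed.

Lemma le_lower_density p q (c : R) :
  (forall eta eps : R, 0 < eta -> 0 < eps -> exists N, forall n, (N <= n)%N ->
    c - eta <= ramsey_turan_ratio p q eps n) ->
  (c%:E <= lower_ramsey_turan_density R p q)%E.
Proof.
move=> H; apply/lee_subgt0Pr => e e0.
apply: lime_ge; first exact: is_cvg_ramsey_turan_liminf.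
near=> y; have y0 : 0 < y by near: y; exact: nbhs_right_gt.
have [N HN] := H e y e0 y0; apply: (@le_limn_einf _ _ N) => n Nn.
by rewrite -EFinB lee_fin HN.
Unshelve. all: by end_near. Qed.

Lemma lower_le_upper_density p q :
  (lower_ramsey_turan_density R p q <= upper_ramsey_turan_density R p q)%E.
Proof.
rewrite /lower_ramsey_turan_density /upper_ramsey_turan_density.
apply: lee_lim; [exact: is_cvg_ramsey_turan_liminf|exact: is_cvg_ramsey_turan_limsup|].
by near=> y; exact: limn_einf_sup.
Unshelve. all: by end_near. Qed.
End Densities.

(** * Edge sets as adjacency relations *)

Section GraphRelation.
Variables (T : finType) (E : {set {set T}}).

Definition adj : rel T := fun x y => (x != y) && ([set x; y] \in E).

Lemma adj_sym : symmetric adj.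
Proof. by move=> x y; rewrite /adj eq_sym setUC. Qed.

Lemma adj_irr : irreflexive adj.
Proof. by move=> x; rewrite /adj eqxx. Qed.

Lemma is_clique_adj W : reflect (rel_clique adj W) (is_clique E W).
Proof.
apply: (iffP forall_inP) => [H x y xW yW xy|H x xW].
  by rewrite /adj xy; have /forall_inP/(_ y yW)/implyP/(_ xy) := H x xW.
by apply/forall_inP => y yW; apply/implyP => xy; have /andP[] := H x y xW yW xy.
Qed.

Lemma edges_adj : is_sgraph E -> edges adj setT setT = (2 * #|E|)%N.
Proof.
move=> /forall_inP sE.
transitivity (\sum_(z : T * T) (adj z.1 z.2))%N.
  rewrite -(pair_bigA _ (fun x y => nat_of_bool (adj x y))) /= /edges.
  by apply: eq_big => [x|x _]; rewrite ?inE //; apply: eq_bigl => y; rewrite inE.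
rewrite -big_mkcond /=.
rewrite (partition_big (fun z => [set z.1; z.2]) [in E]) => [|[x y]] /=; last by case/andP.
rewrite mulnC -[RHS]sum_nat_const; apply: eq_bigr => e eE.
have /cards2P[a [b [ab Ee]]] := sE e eE; rewrite Ee in eE *.
rewrite (eq_bigl [in [set (a, b); (b, a)]]) => [|[x y]].
  by rewrite sum1_card cards2 xpair_eqE (negbTE ab).
rewrite !inE /= !xpair_eqE /adj; apply/idP/idP.
  move=> /andP[/andP[xy _] /eqP/setP Eab]; have := Eab x; have := Eab y.
  rewrite !inE !eqxx orbT /=.
  move=> /esym/orP[/eqP yE|/eqP yE] /esym/orP[/eqP xE|/eqP xE]; rewrite xE yE ?eqxx ?orbT //;
    by rewrite xE yE eqxx in xy.
case/orP => /andP[/eqP -> /eqP ->]; first by rewrite ab eE eqxx.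
by rewrite eq_sym ab setUC eE eqxx.
Qed.
End GraphRelation.

Section Upper.
Variable R : realType.

Lemma bin2R n : 'C(n, 2)%:R * 2 = n%:R * (n%:R - 1) :> R.
Proof.
rewrite -natrM -[X in (_ * X)%N]/(2`!) bin_ffact ffactnS ffactn1 natrM.
by case: n => [|n]; rewrite ?mul0r //= -natr1 addrK.
Qed.

Lemma Kfree_adj (T : finType) (E : {set {set T}}) q : Kfree E q ->
  forall Q : {set T}, #|Q| = q -> ~ rel_clique (adj E) Q.
Proof.
move=> /forallP H Q Qq /is_clique_adj; have := H Q.
by rewrite finset.subsetT Qq eqxx /= => /negbTE ->.
Qed.

Lemma independence_adj (T : finType) (E : {set {set T}}) p (A : {set T}) :
  (independence_number E p < #|A|)%N ->
  exists Q : {set T}, [/\ Q \subset A, #|Q| = p & rel_clique (adj E) Q].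
Proof.
move=> hA; have : ~~ Kfree_on E p A.
  apply: contraL hA => KA; rewrite -leqNgt.
  exact: (@leq_bigmax_cond _ _ (fun U : {set T} => #|U|)).
rewrite negb_forall => /existsP[Q]; rewrite negb_imply negbK => /andP[/andP[QA /eqP Qp] cl].
by exists Q; split=> //; apply/is_clique_adj.
Qed.

Lemma upper_bound_density (p q : nat) (D : R) : turan_bound p q D -> (0 < p)%N ->
  (upper_ramsey_turan_density R p q <= (D / p%:R)%:E)%E.
Proof.
move=> tb p0; apply: upper_density_le => eta eta0.
have eta2 : 0 < eta / 2 by rewrite divr_gt0.
have [eps eps0 [N HN]] := ramsey_turan_upper tb p0 eta2.
set c := D / p%:R in HN *.
have c0 : 0 <= c.
  by case: tb => _ _ _ _ D0; rewrite divr_ge0 //; apply: le_trans D0.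
(* For such [n] the other half of [eta] pays for replacing [n^2] by [n (n - 1)]. *)
exists eps => //; exists (maxn (maxn N 2) (Num.bound (2 * (c + eta / 2) / eta)).+1) => n.
rewrite !geq_max => /andP[/andP[Nn n2] nb].
have nR : 2 * (c + eta / 2) <= eta * (n%:R - 1).
  have h : 0 <= 2 * (c + eta / 2) / eta by rewrite divr_ge0 ?mulr_ge0 ?addr_ge0 // ltW.
  rewrite [leRHS]mulrC -ler_pdivrMr //; apply: (le_trans (ltW (archi_boundP h))).
  by rewrite lerBrDr natr1 ler_nat.
rewrite /ramsey_turan_ratio ler_pdivrMr ?ltr0n ?bin_gt0 //.
have rt : (ramsey_turan p n q (eps * n%:R))%:R * 2 <= (c + eta / 2) * (n ^ 2)%:R.
  pose P (E : {set {set 'I_n}}) := [&& is_sgraph E, Kfree E q &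
    (independence_number E p)%:R <= eps * n%:R].
  rewrite (_ : ramsey_turan _ _ _ _ = \max_(E | P E) #|E|)%N //.
  have [E0 PE0|P0] := pickP P; last by rewrite big_pred0 // mul0r mulr_ge0 // addr_ge0 // ltW.
  have [|E PE ->] := @eq_bigmax_cond _ P (fun E : {set {set 'I_n}} => #|E|).
    by apply/card_gt0P; exists E0.
  move: PE => /and3P[gE KE aE]; rewrite mulrC -natrM -edges_adj //.
  have := HN 'I_n (adj E) (adj_sym E) (adj_irr E); rewrite card_ord; apply => //.
    move=> A hA; apply: independence_adj; rewrite -(ltr_nat R).
    exact: le_lt_trans hA.
  exact: Kfree_adj.
have c2 : 0 <= c + eta / 2 by rewrite addr_ge0 // ltW.
rewrite -(ler_pM2r (ltr0n R 2)) //; apply: (le_trans rt).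
rewrite -mulrA bin2R natrX expr2.
have n0 : 0 <= n%:R :> R by [].
have h := ler_wpM2l n0 nR.
lra.
Qed.
End Upper.

(** * Concentration of measure on the discrete torus *)

Section Poincare.
Variables (R : realFieldType) (X : finZmodType) (m : nat).
Hypothesis m0 : (0 < m)%N.
Implicit Types (f g : X -> R) (e : X).

Definition averaging e f (x : X) : R := (\sum_(t < m) f (x + e *+ t)) / m%:R.

Definition step_energy e f : R := \sum_x (f (x + e) - f x) ^+ 2.

Lemma sum_translate (z : X) f : \sum_x f (x + z) = \sum_x f x.
Proof. by rewrite [RHS](reindex_inj (addIr z)). Qed.

Let mR : 0 < m%:R :> R. Proof. by rewrite ltr0n. Qed.

Lemma sqr_sum_le (n : nat) (F : 'I_n -> R) : (\sum_i F i) ^+ 2 <= n%:R * \sum_i F i ^+ 2.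
Proof.
have : 0 <= \sum_i \sum_j (F i - F j) ^+ 2.
  by apply: sumr_ge0 => i _; apply: sumr_ge0 => j _; exact: sqr_ge0.
rewrite (eq_bigr (fun i => n%:R * F i ^+ 2 + \sum_j F j ^+ 2 - 2 * F i * \sum_j F j)).
  rewrite sumrB big_split /= -mulr_sumr sumr_const card_ord -mulr_suml -mulr_sumr.
  by rewrite -[_ *+ n]mulr_natl expr2; set S := \sum_i F i; set Q := \sum_i _; lra.
move=> i _; rewrite (eq_bigr (fun j => F i ^+ 2 + F j ^+ 2 - 2 * F i * F j)).
  by rewrite sumrB big_split /= sumr_const card_ord -[_ *+ n]mulr_natl mulr_sumr.
by move=> j _; ring.
Qed.

Lemma sum_averaging e f : \sum_x averaging e f x = \sum_x f x.
Proof.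
rewrite /averaging -mulr_suml exchange_big /=.
rewrite (eq_bigr (fun=> \sum_x f x)) => [|t _]; last exact: sum_translate.
by rewrite sumr_const card_ord -[_ *+ _]mulr_natl mulrAC divff ?mul1r // lt0r_neq0.
Qed.

Lemma averaging_period e f x : e *+ m = 0 -> averaging e f (x + e) = averaging e f x.
Proof.
move=> em; rewrite /averaging; congr (_ / _).
case: m m0 em => // n _ em; rewrite big_ord_recr [RHS]big_ord_recl /= addrC.
rewrite -addrA -mulrS em mulr0n; congr (_ + _).
by apply: eq_bigr => t _; rewrite -addrA -mulrS.
Qed.

Lemma averaging_invariant e e' f : (forall x, f (x + e') = f x) ->
  forall x, averaging e f (x + e') = averaging e f x.
Proof. by move=> fe x; congr (_ / _); apply: eq_bigr => t _; rewrite addrAC fe. Qed.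

Lemma averaging_shift e f x t : e *+ m = 0 -> averaging e f (x + e *+ t) = averaging e f x.
Proof.
move=> em; elim: t => [|t IH]; first by rewrite mulr0n addr0.
by rewrite mulrSr addrA averaging_period.
Qed.

(* [averaging e] is an orthogonal projection. *)
Lemma averaging_pythagoras e f : e *+ m = 0 ->
  \sum_x f x ^+ 2 - \sum_x averaging e f x ^+ 2 = \sum_x (f x - averaging e f x) ^+ 2.
Proof.
move=> em; have E : \sum_x f x * averaging e f x = \sum_x averaging e f x ^+ 2.
  transitivity (\sum_x averaging e (fun x => f x * averaging e f x) x).
    by rewrite sum_averaging.
  apply: eq_bigr => x _; rewrite [LHS]/averaging expr2 [X in _ = X * _]/averaging [RHS]mulrAC.
  congr (_ / _).
  by rewrite mulr_suml; apply: eq_bigr => t _; rewrite averaging_shift.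
rewrite [RHS](eq_bigr (fun x => f x ^+ 2 + averaging e f x ^+ 2 - 2 * (f x * averaging e f x))).
  by rewrite sumrB big_split /= -mulr_sumr E; lra.
by move=> x _; ring.
Qed.

Lemma averaging_contract e f : e *+ m = 0 ->
  \sum_x averaging e f x ^+ 2 <= \sum_x f x ^+ 2.
Proof.
by move=> em; rewrite -subr_ge0 averaging_pythagoras // sumr_ge0 // => x _; exact: sqr_ge0.
Qed.

(** [f - averaging e f] is a mean of differences [f x - f (x + e *+ t)], each a telescoping sum of
    at most [m] steps. Cauchy-Schwarz for the mean and for the telescope gives [m^2]. *)
Lemma averaging_poincare e f : e *+ m = 0 ->
  \sum_x f x ^+ 2 - \sum_x averaging e f x ^+ 2 <= m%:R ^+ 2 * step_energy e f.
Proof.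
move=> em; rewrite averaging_pythagoras //.
have step x t : (t <= m)%N -> (f x - f (x + e *+ t)) ^+ 2
    <= m%:R * \sum_(s < m) (f (x + e *+ s + e) - f (x + e *+ s)) ^+ 2.
  move=> tm; have -> : f x - f (x + e *+ t)
      = - \sum_(s < t) (f (x + e *+ s + e) - f (x + e *+ s)).
    elim: t {tm} => [|t IH]; first by rewrite big_ord0 mulr0n addr0; lra.
    by rewrite big_ord_recr /= opprD -IH mulrSr addrA; lra.
  rewrite sqrrN; apply: (le_trans (sqr_sum_le _)); apply: ler_pM => //.
  - by apply: sumr_ge0 => s _; exact: sqr_ge0.
  - by rewrite ler_nat.
  - rewrite (big_ord_widen m (fun s => (f (x + e *+ s + e) - f (x + e *+ s)) ^+ 2) tm).
    rewrite big_mkcond; apply: ler_sum => s _; case: ifP => // _; exact: sqr_ge0.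
apply: (@le_trans _ _ (\sum_x m%:R * \sum_(s < m) (f (x + e *+ s + e) - f (x + e *+ s)) ^+ 2)).
  apply: ler_sum => x _.
  have -> : f x - averaging e f x = (\sum_(t < m) (f x - f (x + e *+ t))) / m%:R.
    rewrite sumrB sumr_const card_ord mulrBl -[f x *+ m]mulr_natl mulrAC divff ?mul1r //.
    by rewrite lt0r_neq0.
  rewrite expr_div_n ler_pdivrMr ?exprn_gt0 //; apply: (le_trans (sqr_sum_le _)).
  rewrite [leRHS]mulrC expr2 -[leRHS]mulrA ler_pM2l //.
  rewrite -[m in m%:R * (m%:R * _)]card_ord; apply: (@le_trans _ _
    (\sum_(t < m) m%:R * \sum_(s < m) (f (x + e *+ s + e) - f (x + e *+ s)) ^+ 2)).
    by apply: ler_sum => t _; apply: step; exact: ltnW.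
  by rewrite sumr_const -[leLHS]mulr_natl !card_ord.
rewrite -mulr_sumr exchange_big /= expr2 -mulrA ler_pM2l //.
rewrite (eq_bigr (fun=> step_energy e f)) => [|s _].
  by rewrite sumr_const card_ord -[leLHS]mulr_natl.
exact: (sum_translate (e *+ s) (fun x => (f (x + e) - f x) ^+ 2)).
Qed.

Lemma step_energy_averaging e e' f : e *+ m = 0 ->
  step_energy e' (averaging e f) <= step_energy e' f.
Proof.
move=> em; apply: le_trans (averaging_contract (fun x => f (x + e') - f x) em).
rewrite le_eqVlt; apply/orP; left; apply/eqP; apply: eq_bigr => x _; congr (_ ^+ 2).
rewrite /averaging -mulrBl -sumrB; congr (_ / _); apply: eq_bigr => t _.
by rewrite addrAC.
Qed.

Definition averaging_seq := foldr averaging.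

(** Tensorisation: the losses of the successive averagings add up. The induction also carries that
    averaging in one direction never increases the step energy in another. *)
Lemma averaging_seq_poincare f (l : seq X) : {in l, forall e, e *+ m = 0} ->
  \sum_x f x ^+ 2 - \sum_x averaging_seq f l x ^+ 2
    <= m%:R ^+ 2 * \sum_(e <- l) step_energy e f.
Proof.
move=> lm; have [H _] : \sum_x f x ^+ 2 - \sum_x averaging_seq f l x ^+ 2
    <= m%:R ^+ 2 * \sum_(e <- l) step_energy e f /\
    (forall e, step_energy e (averaging_seq f l) <= step_energy e f); last by [].
elim: l lm => [|e l IH] lm /=; first by rewrite big_nil subrr mulr0.
have {}lm e' : e' \in e :: l -> e' *+ m = 0 by exact: lm.
have [IH1 IH2] := IH (fun e' e'l => lm e' (mem_behead (s := e :: l) e'l)).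
have em := lm e (mem_head _ _); split; last first.
  by move=> e'; apply: le_trans (IH2 e'); exact: step_energy_averaging.
have h := averaging_poincare (averaging_seq f l) em.
have m20 : 0 <= m%:R ^+ 2 :> R by exact: sqr_ge0.
have h2 := ler_wpM2l m20 (IH2 e); rewrite big_cons mulrDr.
by move: h h2 IH1; rewrite -/(averaging_seq f l); lra.
Qed.

Lemma averaging_seq_sum f l : \sum_x averaging_seq f l x = \sum_x f x.
Proof. by elim: l => //= e l IH; rewrite sum_averaging. Qed.

Lemma averaging_seq_invariant f (l : seq X) : {in l, forall e, e *+ m = 0} ->
  forall e, e \in l -> forall x, averaging_seq f l (x + e) = averaging_seq f l x.
Proof.
elim: l => //= e l IH lm e'; rewrite inE => /orP[/eqP ->|e'l] x.
  by apply: averaging_period; apply: lm; rewrite inE eqxx.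
apply: averaging_invariant => y; apply: IH => // z zl.
by apply: lm; rewrite inE zl orbT.
Qed.

(** When the steps in [l] generate, averaging over all of them leaves the constant mean, and the
    left side is [|X|^2] times the variance. *)
Lemma poincare (l : seq X) f : {in l, forall e, e *+ m = 0} ->
  (forall g, (forall e x, e \in l -> g (x + e) = g x) -> forall x, g x = g 0) ->
  #|X|%:R * \sum_x f x ^+ 2 - (\sum_x f x) ^+ 2
    <= #|X|%:R * (m%:R ^+ 2 * \sum_(e <- l) step_energy e f).
Proof.
move=> lm gen; set g := averaging_seq f l.
have gc x : g x = g 0 by apply: gen => e y el; exact: averaging_seq_invariant.
have -> : (\sum_x f x) ^+ 2 = #|X|%:R * \sum_x g x ^+ 2.
  rewrite -(averaging_seq_sum f l) -/g (eq_bigr (fun=> g 0)) // sumr_const.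
  rewrite [in RHS](eq_bigr (fun=> g 0 ^+ 2)) => [|x _]; last by rewrite gc.
  by rewrite sumr_const -[g 0 *+ _]mulr_natl -[_ ^+ 2 *+ _]mulr_natl exprMn expr2 mulrA.
by rewrite -mulrBr ler_wpM2l //; exact: averaging_seq_poincare.
Qed.
End Poincare.

(* The real and imaginary parts of a character of Z with values in the unit circle. *)
Record circle_char (R : realFieldType) (Z : zmodType) := CircleChar {
  cosz : Z -> R;
  sinz : Z -> R;
  cosz0 : cosz 0 = 1;
  sinz0 : sinz 0 = 0;
  coszN : forall a, cosz (- a) = cosz a;
  sinzN : forall a, sinz (- a) = - sinz a;
  coszD : forall a b, cosz (a + b) = cosz a * cosz b - sinz a * sinz b;
  sinzD : forall a b, sinz (a + b) = sinz a * cosz b + cosz a * sinz b }.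

Section Chord.
Variables (R : realFieldType) (Z : zmodType) (chi : circle_char R Z).
Notation c := (cosz chi).
Notation s := (sinz chi).

Lemma cosz2_sinz2 a : c a ^+ 2 + s a ^+ 2 = 1.
Proof. by rewrite -(cosz0 chi) -(subrr a) coszD coszN sinzN mulrN opprK !expr2. Qed.

Definition chord2 a b : R := (c a - c b) ^+ 2 + (s a - s b) ^+ 2.

Lemma chord2_ge0 a b : 0 <= chord2 a b.
Proof. by rewrite addr_ge0 ?sqr_ge0. Qed.

Lemma chord2_cos a b : chord2 a b = 2 - 2 * c (a - b).
Proof.
rewrite /chord2 coszD coszN sinzN.
by have ha := cosz2_sinz2 a; have hb := cosz2_sinz2 b; lra.
Qed.

Lemma chord2_translate t a b : chord2 (a + t) (b + t) = chord2 a b.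
Proof. by rewrite !chord2_cos opprD addrACA subrr addr0. Qed.

Lemma chord2C a b : chord2 a b = chord2 b a.
Proof. by rewrite /chord2 -(opprB (c b)) -(opprB (s b)) !sqrrN. Qed.

Lemma chord2_triangle a b z : chord2 a z <= 2 * chord2 a b + 2 * chord2 b z.
Proof.
rewrite -subr_ge0; have -> : 2 * chord2 a b + 2 * chord2 b z - chord2 a z
  = (c a + c z - 2 * c b) ^+ 2 + (s a + s z - 2 * s b) ^+ 2 by rewrite /chord2; ring.
by rewrite addr_ge0 ?sqr_ge0.
Qed.

(** With [u] the step and [v] the chord, the difference is [|u|^2 + 2 <u, v>]; the two squares in
    the proof are convexity and Lagrange's identity. *)
Lemma chord2_step e a b :
  (chord2 (a + e) b - chord2 a b) ^+ 2
  <= 2 * chord2 e 0 ^+ 2 + 8 * chord2 e 0 * chord2 a b.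
Proof.
have -> : chord2 e 0 = chord2 (a + e) a by rewrite !chord2_cos subr0 [a + e]addrC addrK.
rewrite /chord2; move: (c (a + e)) (s (a + e)) (c a) (s a) (c b) (s b) => c' s' c1 s1 c2 s2.
rewrite -subr_ge0; set u1 := c' - c1; set u2 := s' - s1; set v1 := c1 - c2; set v2 := s1 - s2.
have -> : c' - c2 = u1 + v1 by rewrite /u1 /v1; ring.
have -> : s' - s2 = u2 + v2 by rewrite /u2 /v2; ring.
have h1 := sqr_ge0 (u1 ^+ 2 + u2 ^+ 2 - 2 * (u1 * v1 + u2 * v2)).
have h2 := sqr_ge0 (u1 * v2 - u2 * v1).
lra.
Qed.
End Chord.

Lemma sqr_le_sqr (R : realFieldType) (a b : R) : 0 <= a -> a <= b -> a ^+ 2 <= b ^+ 2.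
Proof. by move=> a0 ab; rewrite !expr2 ler_pM. Qed.

(** * The distance to a dense set *)

Section Torus.
Variables (R : rcfType) (n d : nat).
Notation Z := 'I_n.+2.
Notation X := 'rV[Z]_d.
Variable chi : circle_char R Z.
Implicit Types (x y : X) (A : {set X}).

Definition dist2 x y : R := \sum_k chord2 chi (x 0 k) (y 0 k).

Lemma dist2_ge0 x y : 0 <= dist2 x y.
Proof. by apply: sumr_ge0 => k _; exact: chord2_ge0. Qed.

Lemma dist2xx x : dist2 x x = 0.
Proof. by rewrite /dist2 big1 // => k _; rewrite /chord2 !subrr expr0n addr0. Qed.

Lemma dist2C x y : dist2 x y = dist2 y x.
Proof. by apply: eq_bigr => k _; exact: chord2C. Qed.

Lemma dist2_translate t x y : dist2 (x + t) (y + t) = dist2 x y.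
Proof. by apply: eq_bigr => k _; rewrite !mxE chord2_translate. Qed.

Lemma dist2_triangle x y z : dist2 x z <= 2 * dist2 x y + 2 * dist2 y z.
Proof. by rewrite !mulr_sumr -big_split; apply: ler_sum => k _; exact: chord2_triangle. Qed.

Section Concentration.
Hypothesis chi_step : n.+2%:R ^+ 2 * chord2 chi 1 0 <= 64.
Hypothesis dn : (d <= n.+2 ^ 2)%N.
Variables (A : {set X}) (a0 : X).
Hypothesis a0A : a0 \in A.

Definition nearest x : X := [arg min_(a < a0 | a \in A) dist2 x a]%O.

(** A smoothed distance to [A]: the summand 1 keeps it away from 0, so that increments of its square
    can be divided by it. *)
Definition smooth_dist x : R := Num.sqrt (1 + dist2 x (nearest x)).

Lemma nearestP x : nearest x \in A /\ forall a, a \in A -> dist2 x (nearest x) <= dist2 x a.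
Proof. by rewrite /nearest; case: Order.TotalTheory.arg_minP. Qed.

Lemma smooth_dist_sqr x : smooth_dist x ^+ 2 = 1 + dist2 x (nearest x).
Proof. by rewrite sqr_sqrtr // addr_ge0 // dist2_ge0. Qed.

Lemma smooth_dist_ge1 x : 1 <= smooth_dist x.
Proof.
by rewrite -[1]sqrtr1 /smooth_dist ler_wsqrtr // lerDl dist2_ge0.
Qed.

Let d2 : R := chord2 chi 1 0.

Definition unit_step (k : 'I_d) : X := delta_mx 0 k.

(** The point nearest to [x] is a candidate for [x + e], so an increase is bounded by data at [x]
    alone. A decrease is an increase seen from its other end, which is why both signs of [e] occur
    and each is allowed half of the bound. *)
Lemma smooth_dist_step x k (e : X) : e = unit_step k \/ e = - unit_step k ->
  smooth_dist x <= smooth_dist (x + e) ->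
  (smooth_dist (x + e) - smooth_dist x) ^+ 2
  <= (d2 ^+ 2 + 4 * d2 * chord2 chi (x 0 k) (nearest x 0 k)) / (2 * smooth_dist x ^+ 2).
Proof.
move=> He fxe; set f := smooth_dist x in fxe *; set f' := smooth_dist (x + e) in fxe *.
have f1 : 1 <= f := smooth_dist_ge1 x.
have f0 : 0 < f by apply: lt_le_trans f1.
have e0 j : j != k -> e 0 j = 0.
  by case: He => ->; rewrite !mxE eqxx => /negbTE -> //=; rewrite ?oppr0.
have ek : chord2 chi (e 0 k) 0 = d2.
  by case: He => ->; rewrite !mxE !eqxx //= chord2_cos subr0 coszN /d2 chord2_cos subr0.
have diff : f' ^+ 2 - f ^+ 2 <=
    chord2 chi (x 0 k + e 0 k) (nearest x 0 k) - chord2 chi (x 0 k) (nearest x 0 k).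
  have [nA _] := nearestP x; have [_ /(_ _ nA) h] := nearestP (x + e).
  rewrite /f' /f !smooth_dist_sqr; move: h; rewrite [X in _ <= X -> _]/dist2 [dist2 x _]/dist2.
  rewrite (bigD1 k) //= [X in _ -> _ - (1 + X) <= _](bigD1 k) //= mxE.
  rewrite (eq_bigr (fun j => chord2 chi (x 0 j) (nearest x 0 j))) => [|j jk]; first by lra.
  by rewrite mxE e0 // addr0.
have step := chord2_step chi (e 0 k) (x 0 k) (nearest x 0 k); rewrite ek in step.
have df0 : 0 <= f' ^+ 2 - f ^+ 2.
  by rewrite subr_ge0 sqr_le_sqr // ltW.
rewrite ler_pdivlMr ?mulr_gt0 ?exprn_gt0 //.
have h1 : (2 * f * (f' - f)) ^+ 2 <= (f' ^+ 2 - f ^+ 2) ^+ 2.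
  have df : 0 <= f' - f by rewrite subr_ge0.
  have f2 : 0 <= 2 * f by rewrite mulr_ge0 // ltW.
  apply: sqr_le_sqr; first by rewrite mulr_ge0.
  rewrite subr_sqr mulrC ler_wpM2l //; lra.
have h2 : (f' ^+ 2 - f ^+ 2) ^+ 2 <= (chord2 chi (x 0 k + e 0 k) (nearest x 0 k)
    - chord2 chi (x 0 k) (nearest x 0 k)) ^+ 2.
  exact: sqr_le_sqr.
have := le_trans h1 (le_trans h2 step); set C := chord2 _ _ _; clear => h.
lra.
Qed.

Lemma smooth_dist_step_energy k :
  step_energy (unit_step k) smooth_dist <=
  \sum_(x : X) (d2 ^+ 2 + 4 * d2 * chord2 chi (x 0 k) (nearest x 0 k)) / smooth_dist x ^+ 2.
Proof.
set f := smooth_dist; set e := unit_step k; 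
pose bd x := (d2 ^+ 2 + 4 * d2 * chord2 chi (x 0 k) (nearest x 0 k)) / f x ^+ 2.
pose pos (r : R) : R := if 0 <= r then r ^+ 2 else 0.
have split_sq r : r ^+ 2 <= pos r + pos (- r).
  rewrite /pos oppr_ge0 sqrrN; have h := sqr_ge0 r.
  by case: (lerP 0 r) => h1; case: (lerP r 0) => h2; lra.
have half x : pos (f (x + e) - f x) + pos (f (x - e) - f x) <= bd x.
  have bd0 : 0 <= bd x.
    by rewrite divr_ge0 ?sqr_ge0 // addr_ge0 ?sqr_ge0 // !mulr_ge0 ?chord2_ge0.
  have hb e' : e' = e \/ e' = - e -> pos (f (x + e') - f x) <= bd x / 2.
    move=> He'; rewrite /pos; case: ifPn => h; last by rewrite divr_ge0.
    rewrite subr_ge0 in h; apply: (le_trans (smooth_dist_step He' h)).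
    by rewrite /bd invfM mulrA [leRHS]mulrAC mulrAC.
  have -> : bd x = bd x / 2 + bd x / 2 by move: (bd x) => r; field.
  by apply: lerD; apply: hb; [left|right].
apply: (@le_trans _ _ (\sum_x (pos (f (x + e) - f x) + pos (f x - f (x + e))))).
  by apply: ler_sum => x _; rewrite -[f x - _]opprB; exact: split_sq.
rewrite big_split /=; apply: le_trans (ler_sum _ (fun x _ => half x)); rewrite big_split /=.
rewrite lerD2l -(sum_translate (- e) (fun x => pos (f x - f (x + e)))).
by apply: ler_sum => x _; rewrite subrK.
Qed.

(** The variance is bounded independently of [d]; [dn] makes the second-order term [d * d2^2]
    harmless. *)
Lemma smooth_dist_variance :
  #|X|%:R * \sum_x smooth_dist x ^+ 2 - (\sum_x smooth_dist x) ^+ 2 <= 4352 * #|X|%:R ^+ 2.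
Proof.
have Zm : n.+2%:R = 0 :> Z by apply: val_inj; rewrite Zp_nat /= modnn.
have period : {in [seq unit_step k | k <- enum 'I_d], forall e, e *+ n.+2 = 0}.
  by move=> _ /mapP[k _ ->]; rewrite -scaler_nat Zm scale0r.
have gen (g : X -> R) : (forall e x, e \in [seq unit_step k | k <- enum 'I_d] ->
    g (x + e) = g x) -> forall x, g x = g 0.
  move=> ginv x; rewrite (row_sum_delta x) -[X in g X]add0r.
  have h (l : seq 'I_d) : forall y, g (y + \sum_(k <- l) x 0 k *: delta_mx 0 k) = g y.
    elim: l => [|k l IH] y; first by rewrite big_nil addr0.
    rewrite big_cons addrA IH -[x 0 k]natr_Zp scaler_nat.
    elim: (nat_of_ord _) => [|t IHt]; first by rewrite mulr0n addr0.
    by rewrite mulrSr addrA ginv // map_f // mem_enum.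
  exact: h.
apply: le_trans (@poincare R X n.+2 isT _ smooth_dist period gen) _.
rewrite expr2 [leRHS]mulrCA ler_wpM2l //.
rewrite big_map big_enum /=.
(* Over all coordinates the chords add up to [dist2 x (nearest x)], which the denominator
   [smooth_dist x ^+ 2] dominates. *)
apply: (@le_trans _ _ (n.+2%:R ^+ 2 * \sum_(x : X) (d%:R * d2 ^+ 2 + 4 * d2))).
  rewrite ler_wpM2l ?sqr_ge0 //; apply: (@le_trans _ _ (\sum_k \sum_(x : X)
    (d2 ^+ 2 + 4 * d2 * chord2 chi (x 0 k) (nearest x 0 k)) / smooth_dist x ^+ 2)).
    by apply: ler_sum => k _; exact: smooth_dist_step_energy.
  rewrite exchange_big /=; apply: ler_sum => x _.
  rewrite -mulr_suml big_split /= sumr_const card_ord -[_ *+ _]mulr_natl -mulr_sumr -/(dist2 _ _).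
  have f1 := smooth_dist_ge1 x; have fs := smooth_dist_sqr x.
  have f2 : 1 <= smooth_dist x ^+ 2 by rewrite fs lerDl dist2_ge0.
  rewrite ler_pdivrMr; last by apply: lt_le_trans f2.
  have d20 : 0 <= d2 := chord2_ge0 _ _ _.
  rewrite [leRHS]mulrDl; apply: lerD; first by rewrite ler_peMr // mulr_ge0 ?sqr_ge0.
  by rewrite ler_wpM2l ?mulr_ge0 // fs lerDr.
rewrite sumr_const -[(_ + _) *+ _]mulr_natl [leLHS]mulrCA [leRHS]mulrC ler_wpM2l //.
have d20 : 0 <= d2 := chord2_ge0 _ _ _.
have m20 : 0 <= n.+2%:R ^+ 2 :> R by exact: sqr_ge0.
have h1 : d%:R <= n.+2%:R ^+ 2 :> R by rewrite -natrX ler_nat.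
have h2 : d%:R * d2 ^+ 2 * n.+2%:R ^+ 2 <= (n.+2%:R ^+ 2 * d2) ^+ 2.
  have -> : d%:R * d2 ^+ 2 * n.+2%:R ^+ 2 = d%:R * (n.+2%:R ^+ 2 * d2 ^+ 2) by ring.
  have -> : (n.+2%:R ^+ 2 * d2) ^+ 2 = n.+2%:R ^+ 2 * (n.+2%:R ^+ 2 * d2 ^+ 2) by ring.
  by rewrite ler_wpM2r // mulr_ge0 // sqr_ge0.
have h3 : (n.+2%:R ^+ 2 * d2) ^+ 2 <= 64 ^+ 2.
  by apply: sqr_le_sqr; rewrite ?mulr_ge0.
have h4 := chi_step; rewrite -/d2 in h4.
lra.
Qed.

(* 4352 = 64^2 + 4 * 64 is the variance bound of [smooth_dist_variance]. *)
Definition conc_radius (eps : R) : R :=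
  (1 + Num.sqrt (4352 / eps) + Num.sqrt (6 * 4352)) ^+ 2.

(** Chebyshev twice: the function equals 1 on the dense set [A], so its mean is at most
    [1 + sqrt (4352 / eps)]; and it exceeds the mean by [sqrt (6 * 4352)] on at most a sixth of the
    space. A sixth, so that five translates of the exceptional set cannot cover. *)
Lemma concentration (eps : R) : 0 < eps -> eps * #|X|%:R <= #|A|%:R ->
  (6 * #|[set x | (conc_radius eps < dist2 x (nearest x))%R]| <= #|X|)%N.
Proof.
move=> eps0 hA; set B := [set x | _]; set f := smooth_dist.
have X0 : 0 < #|X|%:R :> R by rewrite ltr0n; apply/card_gt0P; exists 0.
pose mu := (\sum_x f x) / #|X|%:R.
have var : \sum_x (f x - mu) ^+ 2 <= 4352 * #|X|%:R.
  rewrite -(ler_pM2l X0).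
  have -> : #|X|%:R * \sum_x (f x - mu) ^+ 2 = #|X|%:R * \sum_x f x ^+ 2 - (\sum_x f x) ^+ 2.
    rewrite (eq_bigr (fun x => f x ^+ 2 + mu ^+ 2 - 2 * mu * f x)) => [|x _]; last by ring.
    rewrite sumrB big_split /=.
    have -> : \sum_x 2 * mu * f x = 2 * mu * \sum_x f x by rewrite mulr_sumr.
    have -> : \sum_(x : X) mu ^+ 2 = #|X|%:R * mu ^+ 2 by rewrite sumr_const mulr_natl.
    have -> : \sum_x f x = mu * #|X|%:R by rewrite divfK // lt0r_neq0.
    by ring.
  by apply: (le_trans smooth_dist_variance); rewrite expr2 mulrCA.
have sub_var (S : {set X}) t : (forall x, x \in S -> t <= (f x - mu) ^+ 2) ->
    #|S|%:R * t <= 4352 * #|X|%:R.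
  move=> tS; apply: le_trans var; rewrite mulr_natl -sumr_const.
  apply: (@le_trans _ _ (\sum_(x in S) (f x - mu) ^+ 2)); first exact: ler_sum.
  by rewrite big_mkcond; apply: ler_sum => x _; case: ifP => // _; exact: sqr_ge0.
have mu1 : mu - 1 <= Num.sqrt (4352 / eps).
  apply: (le_trans (ler_norm _)); rewrite -sqrtr_sqr ler_wsqrtr // ler_pdivlMr //.
  rewrite -(ler_pM2r X0); apply: le_trans (sub_var A ((mu - 1) ^+ 2) _).
    have -> : (mu - 1) ^+ 2 * eps * #|X|%:R = eps * #|X|%:R * (mu - 1) ^+ 2 by ring.
    by rewrite ler_wpM2r ?sqr_ge0.
  move=> a aA; have [_ /(_ a aA)] := nearestP a; rewrite dist2xx => h.
  have h0 := dist2_ge0 a (nearest a).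
  have -> : f a = 1 by rewrite /f /smooth_dist (_ : dist2 _ _ = 0) ?addr0 ?sqrtr1 //; lra.
  by rewrite -[mu - 1]opprB sqrrN.
have hB := sub_var B (6 * 4352) _; rewrite -(ler_nat R) natrM.
have s0 : 0 <= 6 * 4352 :> R by lra.
suff h : #|B|%:R * (6 * 4352) <= 4352 * #|X|%:R :> R by lra.
apply: hB => x; rewrite inE => hx.
rewrite -{1}(sqr_sqrtr s0); apply: sqr_le_sqr; first exact: sqrtr_ge0.
suff h : 1 + Num.sqrt (4352 / eps) + Num.sqrt (6 * 4352) <= f x.
  by move: mu1 h; set s1 := Num.sqrt _; set s2 := Num.sqrt _ => mu1 h; lra.
have r0 : 0 <= 1 + Num.sqrt (4352 / eps) + Num.sqrt (6 * 4352).
  by rewrite !addr_ge0 ?sqrtr_ge0.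
rewrite leNgt; apply/negP => /ltW h.
have := sqr_le_sqr (le_trans ler01 (smooth_dist_ge1 x)) h.
by apply/negP; rewrite -ltNge smooth_dist_sqr -/(conc_radius eps); lra.
Qed.
End Concentration.

Lemma dense_near_translates (A : {set X}) (eps : R) (t : 'I_5 -> X) :
  n.+2%:R ^+ 2 * chord2 chi 1 0 <= 64 -> (d <= n.+2 ^ 2)%N ->
  0 < eps -> eps * #|X|%:R <= #|A|%:R ->
  exists x, forall i, exists2 a, a \in A & dist2 (x + t i) a <= conc_radius eps.
Proof.
move=> chi1 dn eps0 hA.
have X0 : (0 < #|X|)%N by apply/card_gt0P; exists 0.
have /card_gt0P[a0 a0A] : (0 < #|A|)%N.
  by rewrite -(ltr0n R); apply: lt_le_trans hA; rewrite mulr_gt0 // ltr0n.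
have conc := concentration chi1 dn a0A eps0 hA; set B := [set x | _] in conc.
pose Bt i := [set x | x + t i \in B].
have Bt_card i : #|Bt i| = #|B|.
  rewrite -(card_imset B (addIr (- t i))); apply: eq_card => x; rewrite inE.
  apply/idP/imsetP => [xB|[y yB ->]]; last by rewrite subrK.
  by exists (x + t i); rewrite ?addrK.
have [x xB] : exists x, x \notin \bigcup_i Bt i.
  have : (#|\bigcup_i Bt i| < #|X|)%N.
    apply: (@leq_ltn_trans (\sum_(i < 5) #|Bt i|)%N).
      elim/big_ind2: _ => // [|S1 k1 S2 k2 h1 h2]; first by rewrite cards0.
      by rewrite (leq_trans (leq_card_setU _ _)) // leq_add.
    rewrite (eq_bigr (fun=> #|B|)) // sum_nat_const card_ord.
    by move: conc X0; clear; lia.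
  move=> h; have /card_gt0P[x] : (0 < #|~: \bigcup_i Bt i|)%N by rewrite cardsCs setCK subn_gt0.
  by rewrite inE; exists x.
exists x => i; exists (nearest A a0 (x + t i)).
  by have [] := nearestP a0A (x + t i).
rewrite leNgt; apply: contra xB => h; apply/bigcupP; exists i => //.
by rewrite !inE.
Qed.
End Torus.

(** * Cliques of rotated points *)

Section Pentagon.
Variables (R : realFieldType) (Z : zmodType) (chi : circle_char R Z) (w : Z).
Notation c := (cosz chi).
Notation s := (sinz chi).
Hypotheses (w5 : w *+ 5 = 0) (cw0 : 0 < c w) (cw1 : c w != 1).

(** As [w *+ 5 = 0], the cosines at [w *+ 2] and [w *+ 3] agree; dividing the resulting cubic by
    [c w - 1] leaves this factor. *)
Lemma pentagon_min : 4 * c w ^+ 2 + 2 * c w - 1 = 0.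
Proof.
have c2 : c (w *+ 2) = 2 * c w ^+ 2 - 1.
  by rewrite mulr2n coszD; have h := cosz2_sinz2 chi w; lra.
have s2 : s (w *+ 2) = 2 * s w * c w by rewrite mulr2n sinzD; ring.
have c3 : c (w *+ 2) = 4 * c w ^+ 3 - 3 * c w.
  have -> : w *+ 2 = - (w *+ 3) by apply/eqP; rewrite -addr_eq0 -mulrnDr w5.
  rewrite coszN mulrSr coszD c2 s2; have h := cosz2_sinz2 chi w.
  have -> : 2 * s w * c w * s w = 2 * c w * s w ^+ 2 by ring.
  have -> : s w ^+ 2 = 1 - c w ^+ 2 by rewrite -h; ring.
  ring.
apply/eqP; rewrite -(mulrI_eq0 _ (_ : GRing.lreg (c w - 1))); last first.
  by apply/lregP; rewrite subr_eq0.
by apply/eqP; move: c3; rewrite c2 => h; lra.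
Qed.

Lemma pentagon_cos2 : c (w *+ 2) = - c w - 1 / 2.
Proof.
rewrite mulr2n coszD; have h := cosz2_sinz2 chi w; have h2 := pentagon_min; lra.
Qed.

Lemma pentagon_neg i : (i <= 5)%N -> w *+ (5 - i) = - (w *+ i).
Proof. by move=> i5; apply/eqP; rewrite -addr_eq0 -mulrnDr subnK // w5. Qed.

Lemma pentagon_chord (i : 'I_5) : i != 0 -> 1 <= chord2 chi (w *+ i) 0.
Proof.
have cw_le : c w <= 1 / 2.
  have := pentagon_min; rewrite leNgt => h; apply/negP => h2.
  have h3 : 0 < (c w - 1 / 2) * (c w + 1) by rewrite mulr_gt0 //; have := cw0; lra.
  lra.
have c2 := pentagon_cos2; have h0 := cw0.
rewrite chord2_cos subr0; case: i => [[|[|[|[|[|//]]]]]] //= _ _.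
- by rewrite mulr1n; lra.
- by rewrite c2; lra.
- by rewrite (pentagon_neg (i := 2)) // coszN c2; lra.
- by rewrite (pentagon_neg (i := 1)) // coszN mulr1n; lra.
Qed.

Lemma pentagon_step a : c (a + w *+ 2) + c a = 2 * c w * c (a + w).
Proof.
have -> : a + w *+ 2 = (a + w) + w by rewrite -addrA -mulr2n.
have -> : c a = c (a + w - w) by rewrite addrK.
by rewrite !(coszD _ (a + w)) coszN sinzN; ring.
Qed.

Lemma pentagon_sum a : \sum_(t < 5) c (a + w *+ t) = 0.
Proof.
rewrite !big_ord_recr big_ord0 /= add0r mulr0n addr0 mulr1n.
rewrite (pentagon_neg (i := 2)) // (pentagon_neg (i := 1)) // mulr1n.
rewrite !(coszD chi a) !coszN !sinzN pentagon_cos2.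
by field.
Qed.

(* If at least four of the five values V_t = Re(w^t v) were positive, a vanishing
   sum would force a value to be negative, while the sum of its two neighbours is a
   positive multiple of it. *)
Lemma pentagon_no_four (V : nat -> R) (I : {set 'I_5}) :
  (forall t, V (t + 2)%N + V t = 2 * c w * V t.+1) -> (forall t, V (t + 5)%N = V t) ->
  \sum_(t < 5) V t = 0 -> {in I, forall i : 'I_5, 0 < V i} -> (#|I| <= 3)%N.
Proof.
move=> Vstep V5 Vsum Vpos; rewrite leqNgt; apply/negP => I4.
have [j jI] : exists j, forall i, i != j -> i \in I.
  have I1 : (#|~: I| <= 1)%N by rewrite cardsCs setCK card_ord; lia.
  have [E|[j jI]] := set_0Vmem (~: I).
    by exists ord0 => i _; rewrite -[I]setCK E setC0 inE.
  exists j => i ij; rewrite -[I]setCK inE; apply: contra ij => iI.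
  by apply/eqP; exact: (card_le1_eqP I1).
have Vmod t : V t = V (t %% 5)%N.
  rewrite {1}(divn_eq t 5); elim: (t %/ 5)%N => [|r IH]; first by rewrite mul0n add0n.
  by rewrite mulSn -addnA [(5 + _)%N]addnC V5.
have Vj : V j < 0.
  have : 0 < \sum_(i < 5 | i != j) V i.
    have [i0 i0j] : exists i0 : 'I_5, i0 != j.
      have [->|j0] := eqVneq j ord0; first by exists (lift ord0 ord0).
      by exists ord0; rewrite eq_sym.
    rewrite (bigD1 i0) //= ltr_pwDl ?(Vpos _ (jI _ i0j)) // sumr_ge0 // => i /andP[ij _].
    by apply/ltW/Vpos/jI.
  by move: Vsum; rewrite (bigD1 j) //= => h h2; lra.
have pos t : (t %% 5 != j)%N -> 0 < V t.
  move=> tj; rewrite Vmod.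
  have -> : (t %% 5)%N = Ordinal (ltn_pmod t (isT : (0 < 5)%N)) by [].
  by apply: Vpos; apply: jI.
(* Modulo 5, [j + 4] and [j + 6] are the neighbours of [j]. *)
have h := Vstep (j + 4)%N.
have h1 : 0 < V (j + 4 + 2)%N by apply: pos; clear; case: j => [[|[|[|[|[|//]]]]]].
have h2 : 0 < V (j + 4)%N by apply: pos; clear; case: j => [[|[|[|[|[|//]]]]]].
have h3 : c w * V j < 0 by rewrite pmulr_rlt0.
by move: h; rewrite -addnS V5 => h; lra.
Qed.
End Pentagon.

Lemma addr_insert (V : zmodType) (x a b y : V) : x + (a + b) - y = x + a - y + b.
Proof. by rewrite -!addrA [b - y]addrC. Qed.

Section TorusCliques.
Variables (R : rcfType) (n d : nat).
Notation Z := 'I_n.+2.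
Notation X := 'rV[Z]_d.
Variables (chi : circle_char R Z) (rho : R).
Hypothesis rho0 : 0 < rho.
Hypothesis sep : 10 * rho < d%:R.
Notation c := (cosz chi).
Notation s := (sinz chi).
Notation dist2 := (dist2 chi).
Implicit Types (x y : X) (w : Z) (t : nat).

Definition rot w t : X := const_mx (w *+ t).

Lemma rotD w t t' : rot w (t + t') = rot w t + rot w t'.
Proof. by apply/matrixP => i j; rewrite !mxE mulrnDr. Qed.

Lemma rot5 w : w *+ 5 = 0 -> rot w 5 = 0.
Proof. by move=> w5; apply/matrixP => i j; rewrite !mxE w5. Qed.

Lemma rot0 w : rot w 0 = 0.
Proof. by apply/matrixP => i j; rewrite !mxE mulr0n. Qed.

Lemma rotN w t : rot (- w) t = - rot w t.
Proof. by apply/matrixP => i j; rewrite !mxE mulNrn. Qed.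

(* The points of X stand for vectors of unit complex numbers, and [inner w t x y]
   for Re <e^(2 pi i t / 5) x, y> when w is a fifth of a turn. *)
Definition near_adj w x y : bool :=
  [exists i : 'I_5, (i != 0) && (dist2 y (x + rot w i) <= rho)].

Definition inner w t x y : R := \sum_k c (x 0 k + w *+ t - y 0 k).

Definition cross_adj w x y : bool := (inner w 0 x y <= - rho) && (rho <= inner w 1 x y).

Section FixedRotation.
Variable w : Z.
Hypotheses (w5 : w *+ 5 = 0) (cw0 : 0 < c w) (cw1 : c w != 1).

Lemma rot_opp (i : 'I_5) : rot w (- i)%R = - rot w i.
Proof.
apply/eqP; rewrite -addr_eq0 -rotD; apply/eqP; case: i => [[|[|[|[|[|//]]]]]] /= _;
  by rewrite ?rot0 // rot5.
Qed.

Lemma rot_far x (i : 'I_5) : i != 0 -> 10 * rho < dist2 x (x + rot w i).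
Proof.
move=> i0; apply: (lt_le_trans sep); rewrite dist2C /dist2.
apply: (@le_trans _ _ (\sum_(k < d) 1)); first by rewrite sumr_const card_ord.
apply: ler_sum => k _; rewrite !mxE addrC -[X in chord2 _ _ X]add0r chord2_translate.
exact: pentagon_chord.
Qed.

Lemma near_adj_sym x y : near_adj w x y = near_adj w y x.
Proof.
suff h x' y' : near_adj w x' y' -> near_adj w y' x' by apply/idP/idP; exact: h.
move=> /existsP[i /andP[i0 h]]; apply/existsP; exists (- i); rewrite oppr_eq0 i0.
by rewrite rot_opp dist2C -(dist2_translate _ (rot w i)) subrK.
Qed.

Lemma near_adj_irr x : near_adj w x x = false.
Proof.
apply/existsP => -[i /andP[i0 h]]; have h1 := rot_far x i0; have r0 := rho0; clear i0; lra.
Qed.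

(** Every member lies near a rotate of [x0]. Two members near the same rotate would be close to each
    other, whereas adjacency puts one near a nontrivial rotate of the other. *)
Lemma near_clique_index (S : {set X}) x0 : rel_clique (near_adj w) S -> x0 \in S ->
  exists iota : X -> 'I_5, {in S, forall x, dist2 x (x0 + rot w (iota x)) <= rho} /\
    {in S &, injective iota}.
Proof.
move=> cl x0S; pose iota x := odflt 0 [pick i : 'I_5 | dist2 x (x0 + rot w i) <= rho].
have iotaP x : x \in S -> dist2 x (x0 + rot w (iota x)) <= rho.
  move=> xS; rewrite /iota; case: pickP => [//|no].
  have [E|x0x] := eqVneq x0 x.
    by have := no 0; rewrite -E rot0 addr0 dist2xx ltW.
  by have /existsP[i /andP[_ h]] := cl _ _ x0S xS x0x; have := no i; rewrite h.
exists iota; split=> // x y xS yS Exy; apply/eqP; apply: contraT => xy.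
have /existsP[i /andP[i0 h]] := cl _ _ xS yS xy.
have h1 := iotaP x xS; have := iotaP y yS; rewrite -Exy => h2.
have t1 := dist2_triangle chi x (x0 + rot w (iota x)) y; rewrite dist2C in h2.
(* Two uses of the triangle inequality with factor 2 give [2 (2 rho + 2 rho) + 2 rho], the origin of
   the 10 in [sep]. *)
have t2 := dist2_triangle chi x y (x + rot w i).
by have h3 := rot_far x i0; have r0 := rho0; clear i0 Exy; lra.
Qed.

Lemma near_clique_card (S : {set X}) : rel_clique (near_adj w) S -> (#|S| <= 5)%N.
Proof.
move=> cl; have [->|[x0 x0S]] := set_0Vmem S; first by rewrite cards0.
have [iota [_ inj]] := near_clique_index cl x0S.
by rewrite -(card_in_imset inj) -[leqRHS](card_ord 5) max_card.
Qed.

Lemma inner_step t x y : inner w (t + 2) x y + inner w t x y = 2 * c w * inner w t.+1 x y.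
Proof.
rewrite /inner -big_split mulr_sumr; apply: eq_bigr => k _ /=.
have -> : x 0 k + w *+ (t + 2) - y 0 k = x 0 k + w *+ t - y 0 k + w *+ 2.
  by rewrite mulrnDr addr_insert.
by rewrite pentagon_step [w *+ t.+1]mulrSr addr_insert.
Qed.

Lemma inner_period t x y : inner w (t + 5) x y = inner w t x y.
Proof. by apply: eq_bigr => k _; rewrite mulrnDr w5 addr0. Qed.

Lemma inner_sum x y : \sum_(t < 5) inner w t x y = 0.
Proof.
rewrite exchange_big big1 //= => k _; rewrite -[RHS](pentagon_sum w5 cw1 (x 0 k - y 0 k)).
by apply: eq_bigr => t _; rewrite addrAC.
Qed.

Lemma inner_rotl t u x y : inner w t (x + rot w u) y = inner w (t + u) x y.
Proof.
by apply: eq_bigr => k _; rewrite !mxE mulrnDr [x 0 k + (_ + _)]addrA [x 0 k + _ + _]addrAC.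
Qed.

Lemma inner_rotr t u x y : inner w t x (y - rot w u) = inner w (t + u) x y.
Proof. by apply: eq_bigr => k _; rewrite !mxE mulrnDr opprB !addrA. Qed.

(* The mixed difference of the bilinear form: a scalar product of two short vectors. *)
Lemma inner_mixed t x x' y y' :
  inner w t x' y' - inner w t x' y - (inner w t x y' - inner w t x y)
  <= (dist2 x' x + dist2 y' y) / 2.
Proof.
rewrite /inner /dist2 -big_split mulr_suml -!sumrB; apply: ler_sum => k _ /=.
rewrite -(chord2_translate chi (w *+ t) (x' 0 k)) !(coszD chi (_ + _)) !coszN !sinzN /chord2.
move: (c (x' 0 k + w *+ t)) (s (x' 0 k + w *+ t)) (c (x 0 k + w *+ t)) (s (x 0 k + w *+ t)).
move: (c (y' 0 k)) (s (y' 0 k)) (c (y 0 k)) (s (y 0 k)) => a1 b1 a2 b2 a3 b3 a4 b4.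
have h1 := sqr_ge0 (a3 - a4 - (a1 - a2)); have h2 := sqr_ge0 (b3 - b4 - (b1 - b2)).
lra.
Qed.

(** Rotating [y'] back gives a point [yt] near [y], and each [xt i] rotates back to a point near
    [x0]. The cross conditions make the difference of the inner products with [yt] and [y] at least
    [2 rho]; [inner_mixed] transfers this to [x0] at a loss of [rho]. So [V i > 0] on [I], and the
    pentagon lemma applies. *)
Lemma cross_no_four (I : {set 'I_5}) (xt : 'I_5 -> X) x0 y y' (b : 'I_5) :
  {in I, forall i, dist2 (xt i) (x0 + rot w i) <= rho} -> b != 0 ->
  dist2 y' (y + rot w b) <= rho ->
  {in I, forall i, cross_adj w (xt i) y /\ cross_adj w (xt i) y'} -> (#|I| <= 3)%N.
Proof.
move=> xtI b0 yb; wlog b2 : b y y' b0 yb / (b <= 2)%N.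
  move=> wl cr; have [b2|b2] := leqP b 2; first exact: wl b2 cr.
  apply: (wl (- b) y' y); rewrite ?oppr_eq0 //; last by move=> i /cr[].
    by rewrite rot_opp dist2C -(dist2_translate _ (rot w b)) subrK.
  by move: b2; clear; case: b => [[|[|[|[|[|//]]]]]].
move=> cr; pose yt := y' - rot w b.
have ytb : dist2 yt y <= rho by rewrite -(dist2_translate _ (rot w b)) subrK.
pose V t := inner w t x0 yt - inner w t x0 y.
apply: (@pentagon_no_four R Z chi w cw0 cw1 V) => [t|t||i iI].
- have h1 := inner_step t x0 yt; have h2 := inner_step t x0 y.
  by rewrite /V mulrBr -h1 -h2; ring.
- by rewrite /V !inner_period.
- by rewrite sumrB !inner_sum subrr.
pose xi := xt i - rot w i.
have xi0 : dist2 xi x0 <= rho by rewrite -(dist2_translate _ (rot w i)) subrK xtI.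
have [/andP[cy0 cy1] /andP[cy'0 cy'1]] := cr i iI.
have Ey : inner w i xi y = inner w 0 (xt i) y.
  by rewrite -[i : nat]add0n -inner_rotl subrK.
have Ey' : inner w i xi yt = inner w b (xt i) y'.
  by rewrite -[i : nat]add0n -inner_rotl subrK inner_rotr.
(* For [b = 1] this is a cross condition; for [b = 2] the recurrence expresses the value as [2 c w]
   times a positive number minus one that is at most [- rho]. Exchanging [y] and [y'] has excluded 3
   and 4. *)
have hb : rho <= inner w b (xt i) y'.
  move: b0 b2; case: (b) => [[|[|[|//]]]] //= _ _ _.
  have := inner_step 0 (xt i) y'; rewrite add0n => h.
  have h2 : 0 <= c w * inner w 1 (xt i) y' by rewrite mulr_ge0 ?(ltW cw0) // (le_trans (ltW rho0)).
  by have r0 := rho0; lra.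
have := inner_mixed i x0 xi y yt; rewrite Ey Ey' -/(V i) => h.
by have r0 := rho0; lra.
Qed.

End FixedRotation.

(** Exchanging the arguments is complex conjugation; this lets one bound on cliques serve both
    sides. *)
Lemma cross_adjN w x y : cross_adj (- w) y x = cross_adj w x y.
Proof.
have E t : inner (- w) t y x = inner w t x y.
  by apply: eq_bigr => k _; rewrite -coszN opprB opprD mulNrn opprK [- y 0 k + _]addrC addrA.
by rewrite /cross_adj !E.
Qed.

Lemma near_adjN w x y : w *+ 5 = 0 -> near_adj (- w) x y = near_adj w x y.
Proof.
move=> w5; apply/existsP/existsP => -[i /andP[i0 h]]; exists (- i); rewrite oppr_eq0 i0.
  by rewrite rot_opp // -rotN.
by rewrite rotN rot_opp // opprK.
Qed.

Lemma cross_cliques_le w (S S' : {set X}) : w *+ 5 = 0 -> 0 < c w -> c w != 1 ->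
  rel_clique (near_adj w) S -> rel_clique (near_adj w) S' ->
  {in S & S', forall x y, cross_adj w x y} -> (1 < #|S'|)%N -> (#|S| <= 3)%N.
Proof.
move=> w5 cw0 cw1 clS clS' cr /card_gt1P[y [y' [yS y'S yy']]].
have /existsP[b /andP[b0 yb]] := clS' _ _ yS y'S yy'.
have [->|[x0 x0S]] := set_0Vmem S; first by rewrite cards0.
have [iota [near inj]] := near_clique_index w5 cw0 cw1 clS x0S.
rewrite -(card_in_imset inj).
pose xt i := odflt x0 [pick x in S | iota x == i].
have xtP i : i \in iota @: S -> xt i \in S /\ iota (xt i) = i.
  move=> /imsetP[x xS ->]; rewrite /xt; case: pickP => [z /andP[zS /eqP ->] //|/(_ x)].
  by rewrite xS eqxx.
apply: (cross_no_four w5 cw0 cw1 (xt := xt) (x0 := x0) (b := b) _ b0 yb).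
  by move=> i /xtP[xS {2}<-]; exact: near.
by move=> i /xtP[xS _]; split; exact: cr.
Qed.

(** Two points on one side limit the other side to three. Hence the sizes are at most 3 and 3, or at
    most 1 and 5. *)
Lemma cross_cliques w (S S' : {set X}) : w *+ 5 = 0 -> 0 < c w -> c w != 1 ->
  rel_clique (near_adj w) S -> rel_clique (near_adj w) S' ->
  {in S & S', forall x y, cross_adj w x y} -> (#|S| + #|S'| <= 6)%N.
Proof.
move=> w5 cw0 cw1 clS clS' cr.
have S5 := near_clique_card w5 cw0 cw1 clS; have S'5 := near_clique_card w5 cw0 cw1 clS'.
have h1 := cross_cliques_le w5 cw0 cw1 clS clS' cr.
have Nw5 : (- w) *+ 5 = 0 by rewrite mulNrn w5 oppr0.
have clN T : rel_clique (near_adj w) T -> rel_clique (near_adj (- w)) T.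
  by move=> clT x y xT yT xy; rewrite near_adjN //; exact: clT.
have h2 : (1 < #|S|)%N -> (#|S'| <= 3)%N.
  apply: (cross_cliques_le (w := - w)); rewrite ?coszN //; try exact: clN.
  by move=> y x yS xS; rewrite cross_adjN; exact: cr.
by move: h1 h2 S5 S'5; clear; lia.
Qed.
End TorusCliques.

Lemma card_disjoint_images (T I : finType) (E : {set T}) (phi : I -> T -> T) :
  (forall i i' x x', x \in E -> x' \in E -> phi i x = phi i' x' -> i = i' /\ x = x') ->
  (#|I| * #|E| <= #|T|)%N.
Proof.
move=> inj; have -> : (#|I| * #|E|)%N = #|setX [set: I] E| by rewrite cardsX cardsT.
rewrite -(card_in_imset (f := fun u : I * T => phi u.1 u.2)) ?max_card //.
move=> [i x] [i' x']; rewrite !inE /= => xE xE' /inj h.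
by have [-> ->] := h xE xE'.
Qed.

(** * Anticoncentration of sums of characters *)

Section AntiConcentration.
Variables (R : realFieldType) (n d : nat).
Notation Z := 'I_n.+2.
Notation X := 'rV[Z]_d.
Variable chi : circle_char R Z.
Hypothesis chi1 : cosz chi 1 != 1.
Notation c := (cosz chi).
Notation s := (sinz chi).
Implicit Types (x y : X) (B : {set 'I_d}) (t : Z).

Definition reZ B x : R := \sum_(k in B) c (x 0 k).
Definition imZ B x : R := \sum_(k in B) s (x 0 k).
Definition normZ B x : R := reZ B x ^+ 2 + imZ B x ^+ 2.
Definition brot B t : X := \row_k (if k \in B then t else 0).

(** Translation by 1 rotates the vector of cosine and sine sums by a nontrivial angle and also fixes
    it. *)
Lemma sum_char a : \sum_(t : Z) c (t + a) = 0.
Proof.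
rewrite (_ : \sum_(t : Z) c (t + a) = \sum_(t : Z) c t); last first.
  by rewrite [RHS](reindex_inj (addIr a)).
set C := \sum_(t : Z) c t; pose S := \sum_(t : Z) s t.
have hC : C = C * c 1 - S * s 1.
  rewrite {1}/C (reindex_inj (addIr (1 : Z))) /= !mulr_suml -sumrB.
  by apply: eq_bigr => t _; rewrite coszD.
have hS : S = S * c 1 + C * s 1.
  rewrite {1}/S (reindex_inj (addIr (1 : Z))) /= !mulr_suml -big_split.
  by apply: eq_bigr => t _; rewrite sinzD.
have h := cosz2_sinz2 chi 1.
have : C * (2 - 2 * c 1) = 0.
  have -> : 2 - 2 * c 1 = (1 - c 1) ^+ 2 + s 1 ^+ 2 by lra.
  have h1 : C * (1 - c 1) = - S * s 1 by lra.
  have h2 : S * (1 - c 1) = C * s 1 by lra.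
  by rewrite mulrDr expr2 mulrA h1 -mulrA [s 1 * _]mulrC mulrA mulNr h2; ring.
move/eqP; rewrite mulf_eq0 => /orP[/eqP //|]; have c1 := chi1.
by rewrite subr_eq0 -[X in X == _]mulr1 (inj_eq (mulfI _)) ?pnatr_eq0 // eq_sym (negbTE c1).
Qed.

Lemma normZ_pairs B x : normZ B x = \sum_(k in B) \sum_(l in B) c (x 0 k - x 0 l).
Proof.
rewrite /normZ !expr2 /reZ /imZ !mulr_suml -big_split; apply: eq_bigr => k _ /=.
rewrite !mulr_sumr -big_split; apply: eq_bigr => l _ /=.
by rewrite coszD coszN sinzN; ring.
Qed.

Lemma normZ_le B x : normZ B x <= #|B|%:R ^+ 2.
Proof.
have c_le t : c t <= 1.
  rewrite leNgt; apply/negP => h; have := cosz2_sinz2 chi t; have := sqr_ge0 (s t).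
  have h1 : 0 < (c t - 1) * (c t + 1) by rewrite mulr_gt0 //; lra.
  by move=> h2 h3; lra.
rewrite normZ_pairs; apply: (@le_trans _ _ (\sum_(k in B) \sum_(l in B) 1)).
  by apply: ler_sum => k _; apply: ler_sum => l _.
by rewrite !sumr_const -mulrnA expr2 -natrM.
Qed.

Definition invariant_on B (S : {set X}) :=
  forall k t x, k \in B -> (x + brot [set k] t \in S) = (x \in S).

(** Second moment: a term with [k != l] cancels when coordinate [k] runs through the whole group,
    which invariance permits. *)
Lemma sum_normZ B S : invariant_on B S -> \sum_(x in S) normZ B x = #|B|%:R * #|S|%:R.
Proof.
move=> inv; rewrite (eq_bigr (fun x => \sum_(k in B) \sum_(l in B) c (x 0 k - x 0 l))).
  rewrite exchange_big /= mulr_natl -sumr_const; apply: eq_bigr => k kB.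
  rewrite exchange_big /= (bigD1 k) //= [X in _ + X]big1 ?addr0 => [|l /andP[lB lk]].
    rewrite (eq_bigr (fun=> 1)) => [|x _]; last by rewrite subrr cosz0.
    by rewrite sumr_const.
  have shift t : \sum_(x in S) c (x 0 k - x 0 l) = \sum_(x in S) c (t + (x 0 k - x 0 l)).
    rewrite (reindex_inj (addIr (brot [set k] t))) /=; apply: eq_big => x; first exact: inv.
    by rewrite !mxE !inE eqxx (negbTE lk) addr0 [t + _]addrC addrAC.
  have Z0 : n.+2%:R != 0 :> R by rewrite pnatr_eq0.
  apply: (mulfI Z0); rewrite mulr0.
  transitivity (\sum_(t : Z) \sum_(x in S) c (t + (x 0 k - x 0 l))).
    rewrite -(eq_bigr _ (fun t _ => shift t)) sumr_const card_ord.
    by rewrite mulr_natl.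
  by rewrite exchange_big big1 //= => x _; exact: sum_char.
by move=> x _; exact: normZ_pairs.
Qed.

(** Reverse Markov inequality: the mean of [normZ] is [|B|], its maximum at most [|B|^2], and [Q] at
    most half the mean. *)
Lemma large_block_card B S (Q : R) : invariant_on B S -> (0 < #|B|)%N -> 0 <= Q ->
  2 * Q <= #|B|%:R -> (#|S| <= 2 * #|B| * #|[set x in S | (Q <= normZ B x)%R]|)%N.
Proof.
move=> inv B0 Q0 QB; rewrite -(ler_nat R) !natrM.
have B0' : 0 < #|B|%:R :> R by rewrite ltr0n.
set big := [set x in S | _].
have h : #|B|%:R * #|S|%:R <= Q * #|S|%:R + #|B|%:R ^+ 2 * #|big|%:R.
  rewrite -(sum_normZ inv).
  apply: (@le_trans _ _ (\sum_(x in S) (Q + #|B|%:R ^+ 2 * (x \in big)%:R))).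
    apply: ler_sum => x xS; rewrite inE xS /=; case: (leP Q (normZ B x)) => hQ.
      by rewrite mulr1 (le_trans (normZ_le B x)) // lerDr.
    by rewrite mulr0 addr0 ltW.
  rewrite big_split /= sumr_const -[Q *+ _]mulr_natr lerD2l -mulr_sumr.
  rewrite ler_wpM2l ?sqr_ge0 // -natr_sum ler_nat.
  suff -> : (\sum_(x in S) (x \in big) = #|big|)%N by [].
  rewrite -sum1_card big_mkcond [RHS]big_mkcond; apply: eq_bigr => x _.
  by rewrite !inE; case: (x \in S) => //=; case: (Q <= _).
have S0 : 0 <= #|S|%:R :> R by [].
rewrite -(ler_pM2l B0'); have h2 := ler_wpM2r S0 QB.
by lra.
Qed.

Lemma reZ_brot B t x : reZ B (x + brot B t) = c t * reZ B x - s t * imZ B x.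
Proof.
rewrite /reZ /imZ !mulr_sumr -sumrB; apply: eq_bigr => k kB.
by rewrite !mxE kB coszD; ring.
Qed.

Lemma imZ_brot B t x : imZ B (x + brot B t) = c t * imZ B x + s t * reZ B x.
Proof.
rewrite /reZ /imZ !mulr_sumr -big_split; apply: eq_bigr => k kB /=.
by rewrite !mxE kB sinzD; ring.
Qed.

Lemma normZ_brot B t x : normZ B (x + brot B t) = normZ B x.
Proof.
rewrite /normZ reZ_brot imZ_brot.
transitivity ((c t ^+ 2 + s t ^+ 2) * (reZ B x ^+ 2 + imZ B x ^+ 2)); first by ring.
by rewrite cosz2_sinz2 mul1r.
Qed.

Lemma reZ_out B B' t x : [disjoint B & B'] -> reZ B (x + brot B' t) = reZ B x.
Proof.
move=> dis; apply: eq_bigr => k kB; rewrite !mxE.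
by rewrite (disjointFr dis kB) addr0.
Qed.

Lemma imZ_out B B' t x : [disjoint B & B'] -> imZ B (x + brot B' t) = imZ B x.
Proof.
move=> dis; apply: eq_bigr => k kB; rewrite !mxE.
by rewrite (disjointFr dis kB) addr0.
Qed.

Lemma normZ_out B B' t x : [disjoint B & B'] -> normZ B (x + brot B' t) = normZ B x.
Proof. by move=> dis; rewrite /normZ reZ_out ?imZ_out. Qed.

Lemma reZ_split B x : reZ setT x = reZ B x + reZ (~: B) x.
Proof. by rewrite /reZ (big_setID B) setTI setTD. Qed.

Lemma imZ_split B x : imZ setT x = imZ B x + imZ (~: B) x.
Proof. by rewrite /imZ (big_setID B) setTI setTD. Qed.

Lemma brotD B t t' : brot B (t + t') = brot B t + brot B t'.
Proof. by apply/rowP => k; rewrite !mxE; case: (k \in B); rewrite ?addr0. Qed.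

Section Rotations.
Variables (M : nat) (r : Z) (kap2 : R).
Hypothesis kap2_sin : forall j, (0 < j < M)%N -> kap2 <= s (r *+ j) ^+ 2.

Lemma kap2_chord j : (0 < j < M)%N -> kap2 <= chord2 chi (r *+ j) 0.
Proof.
move=> jM; apply: (le_trans (kap2_sin jM)); rewrite chord2_cos subr0.
by have h := cosz2_sinz2 chi (r *+ j); have h2 := sqr_ge0 (1 - c (r *+ j)); lra.
Qed.

(** [f x] is the block rotated at [x]. As rotating does not change the selected block, a coincidence
    of two rotated points would put a point of [E] and a proper rotate of it both in [E]. *)
Lemma rotation_inj (E : {set X}) (f : X -> {set 'I_d}) :
  (forall x x' (j : nat), x \in E -> x' \in E -> f x = f x' -> (0 < j < M)%N ->
     x' = x + brot (f x) (r *+ j) -> False) ->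
  (forall x t, x \in E -> f (x + brot (f x) t) = f x) ->
  (M * #|E| <= #|X|)%N.
Proof.
move=> no inv; rewrite -[in leqLHS](card_ord M).
apply: (card_disjoint_images (phi := fun (i : 'I_M) x => x + brot (f x) (r *+ i))).
suff H (i i' : 'I_M) x x' : x \in E -> x' \in E -> (i' <= i)%N ->
    x + brot (f x) (r *+ i) = x' + brot (f x') (r *+ i') -> i = i' /\ x = x'.
  move=> i i' x x' xE x'E h; have [ii|/ltnW ii] := leqP i' i; first exact: H.
  by have [] := H i' i x' x x'E xE ii (esym h).
move=> xE x'E ii h; have ff : f x = f x' by rewrite -(inv x (r *+ i)) // h inv.
have Ex' : x' = x + brot (f x) (r *+ (i - i')).
  apply: (addIr (brot (f x') (r *+ i'))); rewrite -h -ff -addrA -brotD -mulrnDr.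
  by rewrite subnK.
have [ii'|ne] := eqVneq i i'.
  split=> //; rewrite Ex' ii' subnn mulr0n.
  by apply/rowP => k; rewrite !mxE if_same addr0.
exfalso; apply: (no x x' (i - i')%N) => //; rewrite subn_gt0 ltn_neqAle ii andbT.
rewrite eq_sym; apply/andP; split; first by apply: contra ne => /eqP e; apply/eqP/val_inj.
by apply: leq_ltn_trans (ltn_ord i); exact: leq_subr.
Qed.

(** Rotating everything moves the real part by the sine times the large imaginary part, hence out of
    the strip. *)
Lemma strip_card (rho2 Q2 : R) : 0 <= kap2 -> 4 * rho2 <= kap2 * Q2 ->
  (M * #|[set x | (reZ setT x ^+ 2 < rho2)%R && (Q2 <= imZ setT x ^+ 2)%R]| <= #|X|)%N.
Proof.
move=> k0 hQ; apply: (rotation_inj (f := fun=> setT)) => // x x' j.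
rewrite !inE => /andP[xr xi] /andP[x'r _] _ jM Ex'.
have := reZ_brot setT (r *+ j) x; rewrite -Ex' => h.
have h1 : kap2 * Q2 <= (s (r *+ j) * imZ setT x) ^+ 2.
  rewrite exprMn; apply: (@le_trans _ _ (kap2 * imZ setT x ^+ 2)).
    by rewrite ler_wpM2l.
  by rewrite ler_wpM2r ?sqr_ge0 // kap2_sin.
have h2 : (s (r *+ j) * imZ setT x) ^+ 2 = (c (r *+ j) * reZ setT x - reZ setT x') ^+ 2.
  by rewrite h; ring.
have c2 : c (r *+ j) ^+ 2 <= 1.
  by rewrite -(cosz2_sinz2 chi (r *+ j)) lerDl sqr_ge0.
have h3 : (c (r *+ j) * reZ setT x) ^+ 2 <= reZ setT x ^+ 2.
  by rewrite exprMn ler_piMl ?sqr_ge0.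
have h4 := sqr_ge0 (c (r *+ j) * reZ setT x + reZ setT x').
lra.
Qed.

Lemma disc_card (P2 Q2 : R) (L : nat) (blk : nat -> {set 'I_d}) :
  (forall b b', b != b' -> [disjoint blk b & blk b']) -> 0 <= kap2 -> 0 <= Q2 ->
  4 * P2 <= kap2 * Q2 ->
  (M * #|[set x | (normZ setT x < P2)%R && [exists b : 'I_L, Q2 <= normZ (blk b) x]%R]| <= #|X|)%N.
Proof.
move=> dis k0 Q20 hQ; set E := [set x | _].
(* Rotating a block changes no [normZ] of any block, so the first large block stays the first. *)
pose first x := find (fun b => Q2 <= normZ (blk b) x) (iota 0 L).
have firstP x : x \in E -> Q2 <= normZ (blk (first x)) x.
  rewrite inE => /andP[_ /existsP[b hb]].
  have hs : has (fun b => Q2 <= normZ (blk b) x) (iota 0 L).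
    by apply/hasP; exists (b : nat); rewrite ?mem_iota ?add0n ?ltn_ord.
  have := nth_find 0%N hs; rewrite nth_iota ?add0n //.
  by move: hs; rewrite has_find size_iota.
apply: (rotation_inj (f := fun x => blk (first x))) => [x x' j xE x'E _ jM Ex'|x t xE].
  set B := blk (first x) in Ex'.
  have hB := firstP x xE; rewrite -/B in hB.
  move: xE x'E; rewrite !inE => /andP[xP _] /andP[x'P _].
  have disC : [disjoint ~: B & B] by rewrite disjoint_sym -subsets_disjoint.
  have h1 := reZ_split B x'; have h2 := imZ_split B x'.
  rewrite {2 3}Ex' reZ_brot reZ_out // in h1; rewrite {2 3}Ex' imZ_brot imZ_out // in h2.
  have h3 := reZ_split B x; have h4 := imZ_split B x.
  have ch := kap2_chord jM; rewrite chord2_cos subr0 in ch.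
  have h5 : kap2 * Q2 <= (2 - 2 * c (r *+ j)) * normZ B x.
    by apply: ler_pM.
  have h6 : (reZ setT x' - reZ setT x) ^+ 2 + (imZ setT x' - imZ setT x) ^+ 2
      = (2 - 2 * c (r *+ j)) * normZ B x.
    have -> : reZ setT x' - reZ setT x = (c (r *+ j) - 1) * reZ B x - s (r *+ j) * imZ B x.
      by rewrite h1 h3; ring.
    have -> : imZ setT x' - imZ setT x = (c (r *+ j) - 1) * imZ B x + s (r *+ j) * reZ B x.
      by rewrite h2 h4; ring.
    have e1 : 2 - 2 * c (r *+ j) = (c (r *+ j) - 1) ^+ 2 + s (r *+ j) ^+ 2.
      by have e := cosz2_sinz2 chi (r *+ j); lra.
    by rewrite e1 /normZ; ring.
  have h7 := sqr_ge0 (reZ setT x' + reZ setT x); have h8 := sqr_ge0 (imZ setT x' + imZ setT x).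
  rewrite /normZ in xP x'P.
  have h9 : (reZ setT x' - reZ setT x) ^+ 2 + (imZ setT x' - imZ setT x) ^+ 2 < 4 * P2 by lra.
  by rewrite h6 in h9; lra.
congr blk; rewrite /first; apply: eq_find => b.
have [->|bf] := eqVneq b (first x); first by rewrite normZ_brot.
by rewrite normZ_out // dis.
Qed.
End Rotations.

(** Independence by invariance: the event that the first [l] blocks are small ignores block [l], so
    [large_block_card] applies inside it and leaves at most a share [1 - 1 / (2 n0)]. *)
Lemma no_large_block_card (Q : R) (n0 L : nat) (blk : nat -> {set 'I_d}) :
  (forall b b', b != b' -> [disjoint blk b & blk b']) ->
  (forall b, (b < L)%N -> #|blk b| = n0) -> (0 < n0)%N -> 0 <= Q -> 2 * Q <= n0%:R ->
  ((2 * n0) ^ L * #|[set x | ~~ [exists b : 'I_L, (Q <= normZ (blk b) x)%R]]|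
    <= (2 * n0 - 1) ^ L * #|X|)%N.
Proof.
move=> dis cb n00 Q0 Qn.
pose S l := [set x | [forall b : 'I_l, normZ (blk b) x < Q]].
have -> : [set x | ~~ [exists b : 'I_L, Q <= normZ (blk b) x]] = S L.
  by apply/setP => x; rewrite !inE negb_exists; apply: eq_forallb => b; rewrite ltNge.
suff H l : (l <= L)%N -> ((2 * n0) ^ l * #|S l| <= (2 * n0 - 1) ^ l * #|X|)%N by exact: H.
elim: l => [|l IH] lL; first by rewrite !expn0 !mul1n max_card.
have {}IH := IH (ltnW lL).
have inv : invariant_on (blk l) (S l).
  move=> k t x kl; rewrite !inE; apply: eq_forallb => b; rewrite normZ_out //.
  rewrite disjoint_sym disjoints1; have := dis l b.
  by rewrite gtn_eqF ?ltn_ord // => /(_ isT) h; rewrite (disjointFr h).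
have Bl : #|blk l| = n0 by apply: cb.
have := @large_block_card (blk l) (S l) Q inv; rewrite Bl => /(_ n00 Q0 Qn).
have -> : #|[set x in S l | Q <= normZ (blk l) x]| = (#|S l| - #|S l.+1|)%N.
  have sub : S l.+1 \subset S l.
    apply/subsetP => x; rewrite !inE => /forallP h; apply/forallP => b.
    exact: (h (widen_ord (leqnSn l) b)).
  rewrite -(cardsDS sub); apply: eq_card => x; rewrite !inE.
  apply/andP/andP => -[h1 h2]; split=> //.
    apply/forallP => /(_ ord_max); apply/negP; by rewrite -leNgt.
  rewrite leNgt; apply: contra h1 => h1; apply/forallP => b.
  have [bl|bl] := ltnP b l; first exact: (forallP h2 (Ordinal bl)).
  by have -> : nat_of_ord b = l by apply/eqP; rewrite eqn_leq bl -ltnS ltn_ord.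
have le : (#|S l.+1| <= #|S l|)%N.
  apply: subset_leq_card; apply/subsetP => x; rewrite !inE => /forallP h; apply/forallP => b.
  exact: (h (widen_ord (leqnSn l) b)).
move=> h; have {}h : (2 * n0 * #|S l.+1| <= (2 * n0 - 1) * #|S l|)%N.
  have aux (u v z : nat) : (z <= v - u)%N -> (u <= v)%N -> (u <= v - z)%N by clear; lia.
  rewrite mulnBr in h; rewrite mulnBl mul1n; apply: aux h _.
  exact: leq_mul (leqnn _) le.
rewrite !expnS -mulnA mulnCA; apply: (leq_trans (leq_mul (leqnn _) h)).
by rewrite mulnCA -mulnA leq_mul.
Qed.
End AntiConcentration.

(** Bernoulli's inequality [(1 + 1/a)^L >= 1 + L/a], cleared of denominators. *)
Lemma pow_ratio (a L : nat) : (a ^ L * (a + L) <= a * a.+1 ^ L)%N.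
Proof.
elim: L => [|L IH]; first by rewrite !expn0 addn0 mul1n muln1.
have h : (a * (a + L.+1) <= (a + L) * a.+1)%N by nia.
rewrite !expnS (mulnC a) -mulnA; apply: (leq_trans (leq_mul (leqnn _) h)).
by rewrite mulnA (mulnC a.+1) mulnA leq_mul.
Qed.

Section Density.
Variable R : archiRealFieldType.

(* A block of coordinates has a large sum with a probability bounded below; so with
   many disjoint blocks some block does, and rotating that block by the M powers of r
   moves the total sum to points pairwise far apart, at most a constant number of
   which lie in a given disc.  Rotating all coordinates does the same for a strip. *)
Lemma anticoncentration (rho2 eta kap2 : R) (M : nat) : 0 <= rho2 -> 0 < kap2 -> 0 < eta ->
  3 <= eta * M%:R ->
  exists d0, forall n d (chi : circle_char R 'I_n.+2) (r : 'I_n.+2), (d0 <= d)%N ->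
    cosz chi 1 != 1 -> (forall j, (0 < j < M)%N -> kap2 <= sinz chi (r *+ j) ^+ 2) ->
    #|[set x : 'rV['I_n.+2]_d | reZ chi setT x ^+ 2 < rho2]|%:R
      <= eta * #|{: 'rV['I_n.+2]_d}|%:R.
Proof.
move=> rho0 kap0 eta0 etaM.
(* In the strip, either the imaginary part squared reaches [Q2a], or the sum lies in the disc [P2];
   in the disc, either some block reaches [Q2], or none does. These are [E1], [E2], [E3], each of
   share at most [eta / 3]. *)
pose Q2a := 4 * rho2 / kap2; pose P2 := rho2 + Q2a; pose Q2 := 4 * P2 / kap2.
have Q2a0 : 0 <= Q2a by rewrite divr_ge0 ?mulr_ge0 // ltW.
have P20 : 0 <= P2 by rewrite addr_ge0.
have Q20 : 0 <= Q2 by rewrite divr_ge0 ?mulr_ge0 // ltW.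
pose n0 := (Num.bound (2 * Q2)).+1.
have n0Q : 2 * Q2 <= n0%:R.
  apply: ltW; apply: lt_trans (archi_boundP _) _; first by rewrite mulr_ge0.
  by rewrite ltr_nat.
pose a := (2 * n0 - 1)%N; pose L := Num.bound (3 * a%:R / eta).
have aL : 3 * a%:R <= eta * L%:R.
  rewrite [leRHS]mulrC -ler_pdivrMr //; apply/ltW/archi_boundP.
  by rewrite divr_ge0 ?mulr_ge0 // ltW.
exists (n0 * L)%N => n d chi r dL c1 hkap; set X := 'rV_d.
pose blk b := [set k : 'I_d | (k %/ n0 == b)%N].
have dis b b' : b != b' -> [disjoint blk b & blk b'].
  move=> bb'; rewrite -setI_eq0; apply/eqP/setP => k; rewrite !inE.
  by apply/negP => /andP[/eqP -> h]; rewrite h in bb'.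
have blk_card b : (b < L)%N -> #|blk b| = n0.
  move=> bL; have lt (j : 'I_n0) : (b * n0 + j < d)%N.
    apply: leq_trans dL; apply: (@leq_trans (b.+1 * n0)); first by rewrite mulSn addnC ltn_add2r.
    by rewrite mulnC leq_mul2l bL orbT.
  rewrite -[RHS]card_ord -(card_imset _ (f := fun j : 'I_n0 => Ordinal (lt j))); last first.
    by move=> i j /(congr1 val) /= /addnI /val_inj.
  apply: eq_card => k; rewrite inE; apply/eqP/imsetP => [kb|[j _ ->] /=].
    exists (Ordinal (ltn_pmod k (ltn0Sn _ : (0 < n0)%N))) => //.
    by apply: val_inj; rewrite /= -kb -divn_eq.
  by rewrite divnMDl // divn_small ?addn0.
have kE u : kap2 * (4 * u / kap2) = 4 * u by rewrite mulrC divfK // lt0r_neq0.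
have kQ2a : 4 * rho2 <= kap2 * Q2a by rewrite kE.
have kQ2 : 4 * P2 <= kap2 * Q2 by rewrite kE.
have strip := strip_card d hkap (ltW kap0) kQ2a.
have disc := disc_card hkap L dis (ltW kap0) Q20 kQ2.
have none := no_large_block_card c1 dis blk_card (ltn0Sn _) Q20 n0Q.
set E1 := [set x | _] in strip; set E2 := [set x | _] in disc; set E3 := [set x | _] in none.
have sub : [set x : X | reZ chi setT x ^+ 2 < rho2] \subset E1 :|: E2 :|: E3.
  apply/subsetP => x; rewrite !inE => xr; rewrite xr /=.
  case: (leP Q2a) => //= xi.
  have -> : normZ chi [set: 'I_d] x < P2 by exact: ltrD.
  exact: orbN.
have {}sub : (#|[set x : X | (reZ chi setT x ^+ 2 < rho2)%R]| <= #|E1| + #|E2| + #|E3|)%N.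
  apply: (leq_trans (subset_leq_card sub)); apply: (leq_trans (leq_card_setU _ _)).
  by rewrite leq_add2r leq_card_setU.
have third (e : nat) : (M * e <= #|{: X}|)%N -> e%:R <= eta / 3 * #|{: X}|%:R :> R.
  move=> h; have {}h : M%:R * e%:R <= #|{: X}|%:R :> R by rewrite -natrM ler_nat.
  have e0 : 0 <= e%:R :> R by [].
  have h1 := ler_wpM2r e0 etaM; have h2 := ler_wpM2l (ltW eta0) h.
  by lra.
have h3 : #|E3|%:R <= eta / 3 * #|{: X}|%:R :> R.
  have an0 : (2 * n0 = a.+1)%N by rewrite /a subn1 prednK // muln_gt0.
  have rat := pow_ratio a L; rewrite -/a an0 in none.
  have h4 : ((a + L) * #|E3| <= a * #|{: X}|)%N.
    have a1 : (0 < a.+1 ^ L)%N by rewrite expn_gt0.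
    rewrite -(leq_pmul2l a1) mulnCA; apply: (leq_trans (leq_mul (leqnn _) none)).
    by rewrite mulnA (mulnC (a + L)%N) [leqRHS]mulnA (mulnC (_ ^ _)%N a) leq_mul.
  have {}h4 : (a%:R + L%:R) * #|E3|%:R <= a%:R * #|{: X}|%:R :> R.
    by rewrite -natrD -!natrM ler_nat.
  have aL0 : 0 < a%:R + L%:R :> R by rewrite -natrD ltr0n addn_gt0 /a subn_gt0 mul2n -addnn addnS.
  rewrite -(ler_pM2l aL0); apply: (le_trans h4); rewrite mulrA ler_wpM2r //.
  have la : 0 <= eta * a%:R by rewrite mulr_ge0 // ltW.
  lra.
have h1 := third _ strip; have h2 := third _ disc.
have : #|[set x : X | reZ chi setT x ^+ 2 < rho2]|%:R <= (#|E1| + #|E2| + #|E3|)%:R :> R.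
  by rewrite ler_nat.
by rewrite !natrD => h; lra.
Qed.
End Density.

(** * The density of the cross adjacency *)

Section CrossDensity.
Variables (R : rcfType) (n d : nat).
Notation Z := 'I_n.+2.
Notation X := 'rV[Z]_d.
Variables (chi : circle_char R Z) (rho : R) (w : Z).
Hypotheses (rho0 : 0 < rho) (w5 : w *+ 5 = 0) (cw1 : cosz chi w != 1).
Implicit Types x y : X.

Lemma inner_reZ t x : inner chi w t x 0 = reZ chi setT (x + rot d w t).
Proof. by apply: eq_big => [k|k _]; rewrite ?inE // !mxE subr0. Qed.

(** Without a change from negative to positive, periodicity would give all five values one sign,
    against the vanishing sum. *)
Lemma sign_change (V : nat -> R) : (forall t, V (t + 5)%N = V t) -> \sum_(t < 5) V t = 0 ->
  (forall t : 'I_5, rho <= `|V t|) -> exists t : 'I_5, V t <= - rho /\ rho <= V t.+1.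
Proof.
move=> V5 Vsum Vbig; have r0 := rho0.
have Vmod t : V t = V (t %% 5)%N.
  rewrite {1}(divn_eq t 5); elim: (t %/ 5)%N => [|r IH]; first by rewrite mul0n add0n.
  by rewrite mulSn -addnA [(5 + _)%N]addnC V5.
have Vcase t : V t <= - rho \/ rho <= V t.
  rewrite Vmod; have := Vbig (Ordinal (ltn_pmod t (isT : (0 < 5)%N))).
  by rewrite ler_normr /= => /orP[]; [right|rewrite lerNr; left].
have [/existsP[t /andP[h1 h2]]|no] := boolP [exists t : 'I_5, (V t <= - rho) && (rho <= V t.+1)].
  by exists t.
have step t : V t <= - rho -> V t.+1 <= - rho.
  move=> h; have [//|h2] := Vcase t.+1.
  case/negP: no; apply/existsP; exists (Ordinal (ltn_pmod t (isT : (0 < 5)%N))).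
  rewrite /= -Vmod h /= Vmod.
  by rewrite -[(t %% 5).+1]addn1 modnDml addn1 -Vmod.
exfalso; have [h0|h0] := Vcase 0%N.
  have h1 := step _ h0; have h2 := step _ h1; have h3 := step _ h2; have h4 := step _ h3.
  by move: Vsum; rewrite !big_ord_recr big_ord0 /= => e; lra.
have pos t : (t <= 5)%N -> rho <= V t.
  move=> t5; have [ht|//] := Vcase t.
  have steps k : V (t + k)%N <= - rho by elim: k => [|k]; rewrite ?addn0 // addnS; exact: step.
  by have := steps (5 - t)%N; rewrite subnKC // -[5%N]add0n V5 => h; lra.
have h1 := pos 1%N isT; have h2 := pos 2%N isT; have h3 := pos 3%N isT; have h4 := pos 4%N isT.
by move: Vsum; rewrite !big_ord_recr big_ord0 /= => e; lra.
Qed.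

Lemma cross_card :
  (#|{: X}| <= 5 * #|[set x | cross_adj chi rho w x (0 : X)]|
    + 5 * #|[set x : X | (reZ chi setT x ^+ 2 < rho ^+ 2)%R]|)%N.
Proof.
set A := [set x | _]; set B := [set x | _].
have trans (S : {set X}) (t : X) : #|[set x | x + t \in S]| = #|S|.
  rewrite -(card_imset S (addIr (- t))); apply: eq_card => x; rewrite inE.
  apply/idP/imsetP => [xB|[y yB ->]]; last by rewrite subrK.
  by exists (x + t); rewrite ?addrK.
have cov : [set: X] \subset \bigcup_(t : 'I_5) ([set x | x + rot d w t \in A]
    :|: [set x | x + rot d w t \in B]).
  apply/subsetP => x _; apply/bigcupP.
  have [/existsP[t ht]|no] := boolP [exists t : 'I_5, x + rot d w t \in B].
    by exists t; rewrite // !inE; apply/orP; right; rewrite !inE in ht.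
  have [t [h1 h2]] : exists t : 'I_5, inner chi w t x 0 <= - rho /\ rho <= inner chi w t.+1 x 0.
    apply: (@sign_change (fun t => inner chi w t x 0)) => [t||t].
    - by apply: inner_period.
    - by apply: inner_sum.
    - rewrite inner_reZ; move/existsPn: no => /(_ t); rewrite inE -leNgt => h.
      by rewrite -(ger0_norm (ltW rho0)) -ler_sqr ?nnegrE // !real_normK ?num_real.
  exists t => //; rewrite !inE; apply/orP; left.
  by rewrite /cross_adj !inner_rotl add0n add1n h1.
rewrite -cardsT; apply: (leq_trans (subset_leq_card cov)).
apply: (@leq_trans (\sum_(t : 'I_5) (#|A| + #|B|))%N).
  elim/big_ind2: _ => // [|S1 k1 S2 k2 h1 h2|t _]; first by rewrite cards0.
    by rewrite (leq_trans (leq_card_setU _ _)) // leq_add.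
  by rewrite (leq_trans (leq_card_setU _ _)) // !trans.
by rewrite sum_nat_const card_ord mulnDr.
Qed.

Lemma cross_pairs :
  (\sum_(x : X) \sum_(y : X) cross_adj chi rho w x y
   = #|{: X}| * #|[set x | cross_adj chi rho w x (0 : X)]|)%N.
Proof.
rewrite exchange_big /= -sum_nat_const; apply: eq_bigr => y _.
rewrite (reindex_inj (addIr y)) /= -sum1_card [RHS]big_mkcond; apply: eq_bigr => x _.
rewrite inE /cross_adj.
have E t : inner chi w t (x + y) y = inner chi w t x 0.
  by apply: eq_bigr => k _; rewrite !mxE subr0 addrAC addrK.
by rewrite !E; case: ifP.
Qed.
End CrossDensity.

Local Notation pi := trigo.pi.

(** * The character of a cyclic group *)

Section TrigonometricCharacter.
Variables (R : realType) (n : nat).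
Notation m := n.+2.
Notation Z := 'I_m.

Definition angle (k : nat) : R := pi *+ 2 * k%:R / m%:R.

Lemma angle_period k q : angle (k + q * m) = angle k + pi *+ 2 *+ q.
Proof.
rewrite /angle natrD natrM mulrDr mulrDl mulrA; congr (_ + _).
by rewrite mulfK ?pnatr_eq0 // mulr_natr.
Qed.

Lemma cos_angle_mod k : cos (angle (k %% m)) = cos (angle k).
Proof.
rewrite [in RHS](divn_eq k m) addnC angle_period.
by rewrite (periodicn (@cosD2pi R)).
Qed.

Lemma sin_angle_mod k : sin (angle (k %% m)) = sin (angle k).
Proof.
rewrite [in RHS](divn_eq k m) addnC angle_period.
by rewrite (periodicn (@sinD2pi R)).
Qed.

Lemma angleD k l : angle (k + l) = angle k + angle l.
Proof. by rewrite /angle natrD mulrDr mulrDl. Qed.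

Lemma angle_opp k : (k <= m)%N -> angle (m - k) = - angle k + pi *+ 2.
Proof.
move=> km; apply/eqP; rewrite eq_sym addrC subr_eq -angleD subnK //.
by rewrite /angle mulfK // pnatr_eq0.
Qed.

Let tcos (k : Z) := cos (angle k).
Let tsin (k : Z) := sin (angle k).

Fact tcos0 : tcos 0 = 1.
Proof. by rewrite /tcos /angle mulr0 mul0r cos0. Qed.

Fact tsin0 : tsin 0 = 0.
Proof. by rewrite /tsin /angle mulr0 mul0r sin0. Qed.

Fact tcosN a : tcos (- a) = tcos a.
Proof.
rewrite /tcos /= cos_angle_mod angle_opp; last exact: ltnW (ltn_ord a).
by rewrite cosD2pi cosN.
Qed.

Fact tsinN a : tsin (- a) = - tsin a.
Proof.
rewrite /tsin /= sin_angle_mod angle_opp; last exact: ltnW (ltn_ord a).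
by rewrite sinD2pi sinN.
Qed.

Fact tcosD a b : tcos (a + b) = tcos a * tcos b - tsin a * tsin b.
Proof. by rewrite /tcos /tsin /= cos_angle_mod angleD cosD. Qed.

Fact tsinD a b : tsin (a + b) = tsin a * tcos b + tcos a * tsin b.
Proof. by rewrite /tcos /tsin /= sin_angle_mod angleD sinD. Qed.

Definition trig_char : circle_char R Z := CircleChar tcos0 tsin0 tcosN tsinN tcosD tsinD.

Lemma trig_char_cos k : cosz trig_char k%:R = cos (angle k).
Proof. by rewrite Zp_nat /= /tcos /= cos_angle_mod. Qed.

Lemma trig_char_sin k : sinz trig_char k%:R = sin (angle k).
Proof. by rewrite Zp_nat /= /tsin /= sin_angle_mod. Qed.
End TrigonometricCharacter.

Lemma sin_le (R : realType) (x : R) : 0 <= x -> sin x <= x.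
Proof.
rewrite le_eqVlt => /orP[/eqP <-|x0]; first by rewrite sin0.
have [|y _] := @MVT R sin cos 0 x x0 (fun y _ => is_derive_sin y).
  by apply: continuous_subspaceT => y; exact: continuous_sin.
by rewrite sin0 !subr0 => ->; rewrite -[leRHS]mul1r ler_wpM2r ?(ltW x0) ?cos_le1.
Qed.

Section TrigParameters.
Variables (R : realType).

(** A chord is at most its arc, so the left side is at most [(2 pi)^2]; the round value 64 comes
    from [pi / 2 < 2]. *)
Lemma trig_char_step n : n.+2%:R ^+ 2 * chord2 (trig_char R n) 1 0 <= 64.
Proof.
set m := n.+2; rewrite chord2_cos subr0 -[cosz _ 1]/(cosz _ 1%:R) trig_char_cos.
set t := angle R n 1.
have m0 : 0 < m%:R :> R by rewrite ltr0n.
have t0 : 0 <= t by rewrite /t /angle mulr1 divr_ge0 // mulrn_wge0 // pi_ge0.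
have -> : 2 - 2 * cos t = 4 * sin (t / 2) ^+ 2.
  have e : cos (t / 2 + t / 2) = 1 - 2 * sin (t / 2) ^+ 2.
    by rewrite cosD; have h := cos2Dsin2 (t / 2); lra.
  have -> : cos t = cos (t / 2 + t / 2) by congr cos; lra.
  by rewrite e; ring.
have th : 0 <= t / 2 by rewrite divr_ge0.
have h1 : sin (t / 2) ^+ 2 <= (t / 2) ^+ 2.
  apply: sqr_le_sqr; last exact: sin_le.
  have tpi : t / 2 = pi / m%:R by rewrite /t /angle mulr1 -[pi *+ 2]mulr_natr mulrAC mulfK ?pnatr_eq0.
  apply: sin_ge0_pi; rewrite th /= tpi ler_pdivrMr // ler_peMr ?pi_ge0 // ler1n //.
apply: (@le_trans _ _ (m%:R ^+ 2 * t ^+ 2)); first by rewrite ler_wpM2l ?sqr_ge0 //; lra.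
rewrite -exprMn /t /angle mulr1 mulrC divfK ?lt0r_neq0 //.
have -> : 64 = (8 : R) ^+ 2 by lra.
apply: sqr_le_sqr; first by rewrite mulrn_wge0 // pi_ge0.
have h := @pihalf_lt2 R; rewrite mulr2n; lra.
Qed.

(** For odd [M], no [2 j / M] with [0 < j < M] is an integer, so the finitely many sines are
    nonzero. *)
Lemma sin_bounded_below (M : nat) : odd M ->
  exists2 kap2 : R, 0 < kap2 & forall j, (0 < j < M)%N -> kap2 <= sin (pi *+ 2 * j%:R / M%:R) ^+ 2.
Proof.
move=> oM.
have pos j : (0 < j < M)%N -> 0 < sin (pi *+ 2 * j%:R / M%:R : R) ^+ 2.
  move=> /andP[j0 jM]; have M0' : (0 < M)%N by rewrite (leq_trans _ jM).
  have M0 : 0 < M%:R :> R by rewrite ltr0n.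
  rewrite exprn_even_gt0 //=; apply/eqP => s0.
  have p0 := @pi_gt0 R.
  have xE : pi *+ 2 * j%:R / M%:R = pi * ((2 * j)%:R / M%:R) :> R.
    by rewrite natrM -mulr_natr; ring.
  have : (2 * j != M)%N by apply: contraTneq oM => <-; rewrite mul2n odd_double.
  rewrite neq_ltn => /orP[lt|gt].
    have : 0 < sin (pi *+ 2 * j%:R / M%:R :> R).
      apply: sin_gt0_pi; rewrite xE mulr_gt0 ?divr_gt0 ?ltr0n ?muln_gt0 //=.
      by rewrite gtr_pMr // ltr_pdivrMr // mul1r ltr_nat.
    by rewrite s0 ltxx.
  have : 0 < sin (pi *+ 2 * j%:R / M%:R - pi :> R).
    apply: sin_gt0_pi; rewrite xE -[X in _ - X]mulr1 -mulrBr.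
    rewrite mulr_gt0 ?subr_gt0 ?ltr_pdivlMr ?mul1r ?ltr_nat //=.
    rewrite gtr_pMr // ltrBlDr ltr_pdivrMr // mulrDl mul1r -natrD ltr_nat.
    by rewrite addnn -mul2n ltn_pmul2l.
  have := @sinDpi R (pi *+ 2 * j%:R / M%:R - pi); rewrite subrK s0 => h.
  by rewrite -oppr_lt0 -h ltxx.
have [/existsP[j0 Pj0]|no] := boolP [exists j : 'I_M, (0 < j)%N].
  pose j1 := [arg min_(j < j0 | (0 < j)%N) (sin (pi *+ 2 * (j : 'I_M)%:R / M%:R : R) ^+ 2)]%O.
  have [Pj1 Hj1] : (0 < j1)%N /\ forall j : 'I_M, (0 < j)%N ->
      sin (pi *+ 2 * j1%:R / M%:R : R) ^+ 2 <= sin (pi *+ 2 * j%:R / M%:R) ^+ 2.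
    by rewrite /j1; case: Order.TotalTheory.arg_minP.
  exists (sin (pi *+ 2 * j1%:R / M%:R) ^+ 2); first by rewrite pos // Pj1 /=.
  by move=> j /andP[j0' jM]; exact: (Hj1 (Ordinal jM)).
exists 1 => // j /andP[j0 jM]; case/negP: no; apply/existsP.
by exists (Ordinal jM).
Qed.
End TrigParameters.

(** * Blow-ups *)

Section BlowUp.
Variables (R : realType) (Y : finType) (H : rel Y).
Hypotheses (Hsym : symmetric H) (Hirr : irreflexive H).
Variables (n : nat) (f : 'I_n -> Y).

Definition blow_up : {set {set 'I_n}} :=
  [set e in [set [set u.1; u.2] | u in [set u : 'I_n * 'I_n | H (f u.1) (f u.2)]]].

Lemma adj_blow_up i j : adj blow_up i j = H (f i) (f j).
Proof.
rewrite /adj /blow_up inE; apply/andP/idP => [[ij /imsetP[[u v] /=]]|h].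
  rewrite inE /= => huv /setP E; have := E i; have := E j; rewrite !inE !eqxx orbT /=.
  move=> /esym/orP[/eqP Ej|/eqP Ej] /esym/orP[/eqP Ei|/eqP Ei]; subst => //.
  - by rewrite eqxx in ij.
  - by rewrite Hsym.
  - by rewrite eqxx in ij.
split; first by apply: contraTneq h => ->; rewrite Hirr.
by apply/imsetP; exists (i, j); rewrite ?inE.
Qed.

Lemma blow_up_sgraph : is_sgraph blow_up.
Proof.
apply/forall_inP => e; rewrite inE => /imsetP[[u v] /=]; rewrite inE /= => huv ->.
by rewrite cards2; case: (u =P v) => // E; rewrite E Hirr in huv.
Qed.

Lemma blow_up_clique Q : rel_clique (adj blow_up) Q ->
  rel_clique H (f @: Q) /\ #|f @: Q| = #|Q|.
Proof.
move=> cl; split.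
  move=> _ _ /imsetP[i iQ ->] /imsetP[j jQ ->] ij; rewrite -adj_blow_up; apply: cl => //.
  by apply: contraNneq ij => ->.
apply: card_in_imset => i j iQ jQ fij; apply/eqP; apply: contraT => ij.
by have := cl i j iQ jQ ij; rewrite adj_blow_up fij Hirr.
Qed.

Lemma blow_up_Kfree q : (forall Q : {set Y}, #|Q| = q -> ~ rel_clique H Q) -> Kfree blow_up q.
Proof.
move=> Kq; apply/forallP => Q; apply/implyP => /andP[_ /eqP Qq].
apply/negP => /is_clique_adj /blow_up_clique[cl cQ].
by apply: (Kq (f @: Q)) cl; rewrite cQ.
Qed.

(** A set with more than [eps n] vertices projects onto at least [c] vertices of [Y], since fibres
    have size at most [k]. A K_p there lifts by taking one representative of each fibre. *)
Lemma blow_up_independence p (k : nat) (c eps : R) : 0 <= eps ->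
  (forall y, (#|[set i | f i == y]| <= k)%N) -> c * k%:R <= eps * n%:R -> (0 < k)%N ->
  (forall A : {set Y}, c <= #|A|%:R ->
    exists Q : {set Y}, [/\ Q \subset A, #|Q| = p & rel_clique H Q]) ->
  (independence_number blow_up p)%:R <= eps * n%:R.
Proof.
move=> eps0 fk ck k0 Ha; rewrite /independence_number.
apply: (big_ind (fun m : nat => m%:R <= eps * n%:R)) => [|a b ha hb|U KU].
- by rewrite mulr_ge0.
- by rewrite /maxn; case: ifP.
rewrite leNgt; apply/negP => /(le_lt_trans ck) aU.
have aI : c <= #|f @: U|%:R.
  rewrite leNgt; apply/negP => h; have UI : (#|U| <= #|f @: U| * k)%N.
    rewrite -sum1_card (partition_big f [in f @: U]) /= => [|i]; last exact: imset_f.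
    rewrite -sum_nat_const; apply: leq_sum => y _; apply: leq_trans (fk y).
    rewrite sum1_card subset_leq_card //; apply/subsetP => i; rewrite !inE.
    by rewrite unfold_in => /andP[].
  have : c * k%:R < #|f @: U|%:R * k%:R :> R.
    by rewrite -natrM; apply: lt_le_trans aU _; rewrite ler_nat.
  by rewrite ltr_pM2r ?ltr0n // ltNge (ltW h).
have [Q [QU Qp cl]] := Ha _ aI.
have ex y : y \in Q -> exists i, (i \in U) && (f i == y).
  by move=> /(subsetP QU)/imsetP[i iU ->]; exists i; rewrite iU eqxx.
have [Q' [Q'U Q'p Q'cl]] : exists Q' : {set 'I_n}, [/\ Q' \subset U, #|Q'| = p &
    rel_clique (adj blow_up) Q'].
  pose rep y := [pick i | (i \in U) && (f i == y)].
  pose Q' := [set i in U | (f i \in Q) && (rep (f i) == Some i)].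
  have finj : {in Q' &, injective f}.
    move=> i j; rewrite !inE => /and3P[_ _ /eqP ri] /and3P[_ _ /eqP rj] fij.
    by move: ri; rewrite fij rj => -[].
  have fQ' : f @: Q' = Q.
    apply/setP => y; apply/imsetP/idP => [[i]|yQ]; first by rewrite !inE => /and3P[_ h _] ->.
    case E : (rep y) => [i|]; last first.
      by have [i hi] := ex y yQ; move: E; rewrite /rep; case: pickP => // /(_ i); rewrite hi.
    move: (E); rewrite {1}/rep; case: pickP => // j /andP[jU /eqP fj] [Eij].
    rewrite Eij in jU fj.
    by exists i => //; rewrite !inE jU fj yQ E eqxx.
  exists Q'; split; first by apply/subsetP => i; rewrite !inE => /and3P[].
    by rewrite -(card_in_imset finj) fQ'.
  move=> i j iQ jQ ij; rewrite adj_blow_up; apply: cl; rewrite -?fQ' ?imset_f //.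
  by apply: contra ij => /eqP /finj ->.
move: KU => /forallP/(_ Q'); rewrite Q'U Q'p eqxx /= => /negP; apply.
exact/is_clique_adj.
Qed.

Lemma blow_up_edges (k : nat) : (forall y, (k <= #|[set i | f i == y]|)%N) ->
  (k ^ 2 * edges H setT setT <= 2 * #|blow_up|)%N.
Proof.
move=> fk; rewrite -edges_adj ?blow_up_sgraph //.
have sumT (T : finType) (F : rel T) : edges F setT setT = (\sum_x \sum_y F x y)%N.
  by apply: eq_big => [x|x _]; rewrite ?inE //; apply: eq_bigl => y; rewrite inE.
rewrite !sumT [leqRHS](partition_big f predT) //= big_distrr /=; apply: leq_sum => y _.
have fk' z : (k <= #|[pred i | f i == z]|)%N by have := fk z; rewrite cardsE.
have h : (k * \sum_z H y z <= \sum_j H y (f j))%N.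
  rewrite [leqRHS](partition_big f predT) //= big_distrr /=; apply: leq_sum => z _.
  under [leqRHS]eq_bigr => i /eqP -> do [].
  by rewrite sum_nat_const leq_mul2r fk' orbT.
apply: (@leq_trans (\sum_(i | f i == y) \sum_j H y (f j))%N); last first.
  by apply: leq_sum => i /eqP <-; apply: leq_sum => j _; rewrite adj_blow_up.
by rewrite sum_nat_const expnS expn1 -mulnA leq_mul // fk'.
Qed.
End BlowUp.

Lemma periodic_map (Y : finType) (n : nat) : (0 < #|Y|)%N -> exists f : 'I_n -> Y,
  forall y, (n %/ #|Y| <= #|[set i | f i == y]| <= n %/ #|Y| + 1)%N.
Proof.
move=> Y0; pose N := #|Y|.
exists (fun i : 'I_n => enum_val (Ordinal (ltn_pmod i Y0))) => y; apply/andP; split.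
  have lt (t : 'I_(n %/ N)) : (t * N + enum_rank y < n)%N.
    apply: (@leq_trans (t.+1 * N)); first by rewrite mulSn addnC ltn_add2r ltn_ord.
    by apply: leq_trans (leq_trunc_div n N); rewrite leq_mul2r ltn_ord orbT.
  rewrite -[leqLHS]card_ord -(card_imset _ (f := fun t => Ordinal (lt t))); last first.
    by move=> t t' /(congr1 val) /= /addIn /eqP; rewrite eqn_pmul2r // => /eqP/val_inj.
  apply/subset_leq_card/subsetP => _ /imsetP[t _ ->]; rewrite inE; apply/eqP.
  rewrite -[RHS]enum_rankK; congr enum_val; apply: val_inj => /=.
  by rewrite modnMDl modn_small // ltn_ord.
have lt (i : 'I_n) : (i %/ N < n %/ N + 1)%N by rewrite addn1 ltnS leq_div2r // ltnW.
rewrite -[leqRHS]card_ord -(card_in_imset (f := fun i => Ordinal (lt i))) ?max_card //.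
move=> i j; rewrite !inE => /eqP <- /eqP/enum_val_inj/(congr1 val) /= h /(congr1 val) /= h'.
by apply: val_inj; rewrite /= (divn_eq i N) (divn_eq j N) h' h.
Qed.

Lemma blow_up_ratio (R : realType) (Y : finType) (H : rel Y) (p q : nat) (c eps eta : R) :
  symmetric H -> irreflexive H -> (0 < #|Y|)%N -> 0 < eps -> 0 < eta -> 0 <= c -> c <= 1 ->
  (forall Q : {set Y}, #|Q| = q -> ~ rel_clique H Q) ->
  (forall A : {set Y}, eps / 4 * #|Y|%:R <= #|A|%:R ->
    exists Q : {set Y}, [/\ Q \subset A, #|Q| = p & rel_clique H Q]) ->
  c * (#|Y| ^ 2)%:R <= (edges H setT setT)%:R ->
  exists N, forall n, (N <= n)%N -> c - eta <= ramsey_turan_ratio p q eps n.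
Proof.
move=> Hsym Hirr Y0 eps0 eta0 c0 c1 Kq Hp Hc.
have Y0' : 0 < #|Y|%:R :> R by rewrite ltr0n.
exists (maxn (maxn 2 #|Y|) (Num.bound (2 * #|Y|%:R / eta))) => n.
rewrite !geq_max => /andP[/andP[n2 nY] nb].
have [f fP] := periodic_map n Y0.
set k := (n %/ #|Y|)%N in fP.
have nk : n%:R <= k%:R * #|Y|%:R + #|Y|%:R :> R.
  by rewrite -natrM -natrD ler_nat {1}(divn_eq n #|Y|) leq_add2l ltnW // ltn_pmod.
have kn : k%:R * #|Y|%:R <= n%:R :> R by rewrite -natrM ler_nat leq_trunc_div.
have nY' : #|Y|%:R <= n%:R :> R by rewrite ler_nat.
have nbig : 2 * #|Y|%:R <= eta * n%:R.
  rewrite [leRHS]mulrC -ler_pdivrMr // (le_trans (ltW (archi_boundP _))) ?ler_nat //.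
  by rewrite !mulr_ge0 // invr_ge0 ltW.
pose E := blow_up H f.
have E_ok : [&& is_sgraph E, Kfree E q & (independence_number E p)%:R <= eps * n%:R].
  rewrite blow_up_sgraph //= blow_up_Kfree //=.
  apply: (blow_up_independence Hsym Hirr (k := k + 1) (c := eps / 4 * #|Y|%:R)) => //.
  - exact: ltW.
  - by move=> y; have /andP[] := fP y.
  (* [(k + 1) |Y| <= 2 n] because [n >= |Y|]; the quarter in the hypothesis absorbs this factor. *)
  - rewrite natrD; apply: (@le_trans _ _ (eps / 4 * (2 * n%:R))).
      rewrite -mulrA ler_wpM2l ?divr_ge0 ?(ltW eps0) //.
      by rewrite mulrDr mulr1 mulrC; lra.
    by rewrite mulrA ler_wpM2r //; lra.
  - by rewrite addn1.
have E_big : c * (k%:R * #|Y|%:R) ^+ 2 <= 2 * #|E|%:R.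
  rewrite exprMn mulrCA; apply: (@le_trans _ _ (k ^ 2 * edges H setT setT)%:R).
    by rewrite natrM natrX ler_wpM2l ?sqr_ge0 // -natrX.
  rewrite -natrM ler_nat; apply: blow_up_edges => // y.
  by have /andP[] := fP y.
have RT : (#|E| <= ramsey_turan p n q (eps * n%:R))%N.
  exact: (@leq_bigmax_cond _ _ (fun E : {set {set 'I_n}} => #|E|)).
have bin0 : 0 < 'C(n, 2)%:R :> R by rewrite ltr0n bin_gt0.
rewrite /ramsey_turan_ratio ler_pdivlMr //; apply: (@le_trans _ _ #|E|%:R); last by rewrite ler_nat.
have [ce|/ltW ce] := lerP (c - eta) 0.
  by apply: (@le_trans _ _ 0) => //; rewrite mulr_le0_ge0 // ltW.
have n0 : 0 <= n%:R :> R by [].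
have k0 : 0 <= k%:R * #|Y|%:R :> R by rewrite mulr_ge0.
have b2 := bin2R R n.
set x := k%:R * _ in nk kn k0 E_big; set y := #|Y|%:R in nk nY' nbig Y0'.
set m := n%:R in b2 nk kn nY' nbig n0; set b := 'C(n, 2)%:R in b2 *.
(* Rounding loses at most [y] of the [m] vertices, hence at most [2 y m <= eta m^2] ordered
   pairs. *)
have s1 : (m - y) ^+ 2 <= x ^+ 2 by apply: sqr_le_sqr; lra.
have s2 : c * (m - y) ^+ 2 <= c * x ^+ 2 by rewrite ler_wpM2l.
have s3 : m ^+ 2 - 2 * y * m <= (m - y) ^+ 2 by nra.
have s4 : c * (m ^+ 2 - 2 * y * m) <= c * (m - y) ^+ 2 by rewrite ler_wpM2l.
have s5 : 2 * y * m <= eta * m * m by rewrite ler_wpM2r.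
have s6 : c * (2 * y * m) <= 2 * y * m by rewrite ler_piMl // !mulr_ge0 // ltW.
have s7 : (c - eta) * (m * (m - 1)) <= (c - eta) * m ^+ 2.
  by rewrite ler_wpM2l // expr2 ler_wpM2l //; lra.
rewrite -b2 in s7; nra.
Qed.

(** * The lower bound construction *)

Section BollobasErdosGraph.
Variables (R : rcfType) (n d : nat).
Notation Z := 'I_n.+2.
Notation X := 'rV[Z]_d.
Variables (chi : circle_char R Z) (rho : R) (w : Z).
Notation near := (near_adj chi rho w).
Notation cross := (cross_adj chi rho w).

Definition class (c : 'I_19) : nat := if (c < 9)%N then 0 else if (c < 14)%N then 1 else 2.

(* The weights 9 : 5 : 5 of the three classes maximise the number of edges. *)
Definition base_adj (u v : 'I_19 * X) : bool :=
  match class u.1, class v.1 with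
  | 0%N, 0%N => near u.2 v.2 | 1%N, 1%N => near u.2 v.2 | 2%N, 2%N => near u.2 v.2
  | 1%N, 2%N => cross u.2 v.2 | 2%N, 1%N => cross v.2 u.2
  | _, _ => true
  end.

Lemma classP c : [\/ class c = 0%N, class c = 1%N | class c = 2%N].
Proof.
by rewrite /class; case: (c < 9)%N; [exact: Or31|case: (c < 14)%N; [exact: Or32|exact: Or33]].
Qed.

Lemma sum_class (F : nat -> nat) : (\sum_c F (class c) = 9 * F 0 + 5 * F 1 + 5 * F 2)%N.
Proof.
rewrite /class -(big_mkord xpredT (fun c =>
  F (if (c < 9)%N then 0 else if (c < 14)%N then 1 else 2)%N)).
rewrite unlock /= /index_iota /=; lia.
Qed.

(** Ordered pairs of copies: 2 * 9 * 10 joined completely and 2 * 5 * 5 by the cross adjacency;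
    edges within a class are dropped. With cross density 1/5 the total is 190 / 361 = 10 / 19. *)
Lemma base_edges : (180 * #|X| ^ 2 + 50 * (#|X| * #|[set x | cross x (0 : X)]|)
  <= edges base_adj setT setT)%N.
Proof.
pose h (a b : nat) := (if a == b then 0 else if (a == 0) || (b == 0) then #|X| ^ 2
  else #|X| * #|[set x | cross x (0 : X)]|)%N.
have -> : edges base_adj setT setT =
    (\sum_c \sum_c' \sum_(x : X) \sum_(y : X) base_adj (c, x) (c', y))%N.
  rewrite /edges (eq_bigl predT) => [|u]; last by rewrite inE.
  rewrite -(pair_bigA _ (fun c x => \sum_(v in setT) base_adj (c, x) v))%N /=.
  apply: eq_bigr => c _; rewrite [RHS]exchange_big /=; apply: eq_bigr => x _.
  rewrite (eq_bigl predT) => [|u]; last by rewrite inE.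
  by rewrite -(pair_bigA _ (fun c' y => nat_of_bool (base_adj (c, x) (c', y)))).
apply: (@leq_trans (\sum_c \sum_c' h (class c) (class c'))); last first.
  apply: leq_sum => c _; apply: leq_sum => c' _; rewrite /base_adj /=.
  have full : (\sum_(x : X) \sum_(y : X) true = #|X| ^ 2)%N.
    by rewrite sum_nat_const sum_nat_const muln1.
  have [->|->|->] := classP c; have [->|->|->] := classP c'; rewrite /h //= ?full //.
    by rewrite cross_pairs.
  by rewrite exchange_big cross_pairs.
rewrite (sum_class (fun a => \sum_c' h a (class c'))%N).
by rewrite (sum_class (h 0%N)) (sum_class (h 1%N)) (sum_class (h 2%N)) /h /=; lia.
Qed.

Lemma card_slices (A : {set 'I_19 * X}) : #|A| = (\sum_c #|[set x | (c, x) \in A]|)%N.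
Proof.
rewrite -sum1_card (eq_bigr (fun u => nat_of_bool (u \in A))) => [|u ->//].
rewrite big_mkcond (eq_bigr (fun u => nat_of_bool ((u.1, u.2) \in A))); last first.
  by move=> [c x] _ /=; case: (_ \in A).
rewrite -(pair_bigA _ (fun c x => nat_of_bool ((c, x) \in A))) /=.
apply: eq_bigr => c _; rewrite -[RHS]sum1_card [RHS]big_mkcond; apply: eq_bigr => x _.
by rewrite inE; case: (_ \in A).
Qed.

Hypotheses (rho0 : 0 < rho) (sep : 10 * rho < d%:R).
Hypotheses (w5 : w *+ 5 = 0) (cw0 : 0 < cosz chi w) (cw1 : cosz chi w != 1).

Lemma rot_mod k : rot d w (k %% 5) = rot d w k.
Proof.
congr const_mx.
by rewrite [in RHS](divn_eq k 5) mulrnDr mulnC mulrnA w5 mul0rn add0r.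
Qed.

(** Some [x] has all five rotates close to [A]. The chosen points of [A] are then near rotates of
    one another, with error [4 * conc_radius eps] from the triangle inequality with factor 2. *)
Lemma near_clique_dense (A : {set X}) (eps : R) :
  n.+2%:R ^+ 2 * chord2 chi 1 0 <= 64 -> (d <= n.+2 ^ 2)%N ->
  0 < eps -> 4 * conc_radius eps <= rho -> eps * #|X|%:R <= #|A|%:R ->
  exists Q : {set X}, [/\ Q \subset A, #|Q| = 5%N & rel_clique near Q].
Proof.
move=> chi1 dn eps0 rho_eps hA.
have [x xP] := dense_near_translates (fun i : 'I_5 => rot d w i) chi1 dn eps0 hA.
have [a aA da] : exists2 a : 'I_5 -> X, forall i, a i \in A &
    forall i : 'I_5, dist2 chi (x + rot d w i) (a i) <= conc_radius eps.
  have ch (i : 'I_5) : exists b, (b \in A) && (dist2 chi (x + rot d w i) b <= conc_radius eps).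
    by have [b bA hb] := xP i; exists b; rewrite bA.
  by exists (fun i => xchoose (ch i)) => i; have /andP[] := xchooseP (ch i).
have cl (i j : 'I_5) : i != j -> near (a i) (a j).
  move=> ij; apply/existsP; exists (j - i); rewrite subr_eq0 eq_sym ij andTb.
  have E : x + rot d w j = x + rot d w i + rot d w (j - i)%R.
    rewrite -addrA -rotD -[rot d w (_ + _)]rot_mod; congr (_ + rot d w _).
    by have /(congr1 val) : j = i + (j - i) by rewrite addrC subrK.
  have t := dist2_triangle chi (a j) (x + rot d w j) (a i + rot d w (j - i)%R).
  rewrite [in X in _ + 2 * X]E dist2_translate (dist2C _ (a j) (x + _)) in t.
  by have hi := da i; have hj := da j; clear ij; lra.
have inj : injective a.
  move=> i j aij; apply/eqP; apply: contraT => /cl.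
  by rewrite aij near_adj_irr.
exists (a @: setT); split; first by apply/subsetP => _ /imsetP[i _ ->].
  by rewrite card_imset // cardsT card_ord.
by move=> _ _ /imsetP[i _ ->] /imsetP[j _ ->] ij; apply: cl; apply: contraNneq ij => ->.
Qed.

Lemma base_adj_sym : symmetric base_adj.
Proof.
move=> u v; rewrite /base_adj.
by have [->|->|->] := classP u.1; have [->|->|->] := classP v.1; rewrite // near_adj_sym.
Qed.

Lemma base_adj_class u v : class u.1 = class v.1 -> base_adj u v = near u.2 v.2.
Proof. by rewrite /base_adj => ->; have [->|->|->] := classP v.1. Qed.

Lemma base_adj_irr : irreflexive base_adj.
Proof. by move=> u; rewrite base_adj_class // near_adj_irr. Qed.

Lemma base_Kfree (Q : {set 'I_19 * X}) : rel_clique base_adj Q -> (#|Q| <= 11)%N.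
Proof.
move=> cl; pose P j := [set u in Q | class u.1 == j]; pose S j := snd @: P j.
have inj j : {in P j &, injective snd}.
  move=> u v; rewrite !inE => /andP[uQ /eqP cu] /andP[vQ /eqP cv] uv.
  apply/eqP; apply: contraT => /(cl _ _ uQ vQ).
  by rewrite base_adj_class ?cu // uv near_adj_irr.
have clS j : rel_clique near (S j).
  move=> _ _ /imsetP[u + ->] /imsetP[v + ->] uv; rewrite !inE.
  move=> /andP[uQ /eqP cu] /andP[vQ /eqP cv].
  by rewrite -base_adj_class ?cu //; apply: cl => //; apply: contraNneq uv => ->.
have S0 : (#|S 0| <= 5)%N by exact: near_clique_card (clS 0%N).
have S12 : (#|S 1| + #|S 2| <= 6)%N.
  apply: (cross_cliques rho0 sep w5 cw0 cw1 (clS 1%N) (clS 2%N)).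
  move=> _ _ /imsetP[u + ->] /imsetP[v + ->]; rewrite !inE.
  move=> /andP[uQ /eqP cu] /andP[vQ /eqP cv].
  have /(cl _ _ uQ vQ) : u != v by apply: contraTneq isT => E; rewrite E cv in cu.
  by rewrite /base_adj cu cv.
have Sc j : #|S j| = #|P j| by apply: card_in_imset; exact: inj.
have cov : Q \subset P 0%N :|: (P 1%N :|: P 2%N).
  by apply/subsetP => u uQ; rewrite !inE uQ; have [->|->|->] := classP u.1.
apply: leq_trans (subset_leq_card cov) _.
apply: leq_trans (leq_card_setU _ _) _.
apply: leq_trans (leq_add (leqnn _) (leq_card_setU _ _)) _.
by rewrite -!Sc (leq_add S0).
Qed.

Lemma base_dense (A : {set 'I_19 * X}) (eps : R) :
  n.+2%:R ^+ 2 * chord2 chi 1 0 <= 64 -> (d <= n.+2 ^ 2)%N ->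
  0 < eps -> 4 * conc_radius eps <= rho -> eps * #|{: 'I_19 * X}|%:R <= #|A|%:R ->
  exists Q : {set 'I_19 * X}, [/\ Q \subset A, #|Q| = 5%N & rel_clique base_adj Q].
Proof.
move=> chi1 dn eps0 rho_eps hA.
have [c hc] : exists c, eps * #|X|%:R <= #|[set x | (c, x) \in A]|%:R.
  apply/existsP; apply: contraT => /existsPn no.
  suff h : #|A|%:R < eps * #|{: 'I_19 * X}|%:R by rewrite leNgt h in hA.
  rewrite card_slices natr_sum card_prod card_ord natrM mulrCA.
  apply: lt_le_trans (_ : \sum_(c < 19) eps * #|X|%:R <= _); last first.
    by rewrite sumr_const card_ord mulr_natl.
  apply: ltr_sum => [|c _]; last by rewrite ltNge no.
  by apply/hasP; exists ord0; rewrite ?mem_index_enum.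
have [Q [QA Q5 cl]] := near_clique_dense chi1 dn eps0 rho_eps hc.
exists [set (c, x) | x in Q]; split.
- by apply/subsetP => _ /imsetP[x xQ ->]; have := subsetP QA x xQ; rewrite inE.
- by rewrite card_imset // => x y [].
- move=> _ _ /imsetP[x xQ ->] /imsetP[y yQ ->] xy; rewrite base_adj_class //=.
  by apply: cl => //; apply: contraNneq xy => ->.
Qed.

End BollobasErdosGraph.

Lemma torus_graph (R : realType) (eps eta : R) : 0 < eps -> 0 < eta ->
  exists (Y : finType) (H : rel Y), [/\ symmetric H, irreflexive H & (0 < #|Y|)%N] /\
    [/\ forall Q : {set Y}, #|Q| = 12%N -> ~ rel_clique H Q,
        forall A : {set Y}, eps * #|Y|%:R <= #|A|%:R ->
          exists Q : {set Y}, [/\ Q \subset A, #|Q| = 5%N & rel_clique H Q] &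
        (10 / 19 - eta) * (#|Y| ^ 2)%:R <= (edges H setT setT)%:R].
Proof.
move=> eps0 eta0; pose rho := 4 * conc_radius eps.
have rho0 : 0 < rho.
  have pos (a b : R) : 0 < (1 + Num.sqrt a + Num.sqrt b) ^+ 2.
    have ha := sqrtr_ge0 a; have hb := sqrtr_ge0 b; rewrite exprn_gt0 //; lra.
  by rewrite pmulr_rgt0; [exact: pos|lra].
(* Odd, so that the sines of multiples of a turn by [1 / M] stay away from 0. *)
pose M := (Num.bound (3 / eta)).*2.+1.
have oM : odd M by rewrite /= odd_double.
have etaM : 3 <= eta * M%:R.
  rewrite mulrC -ler_pdivrMr // (le_trans (ltW (archi_boundP _))) ?divr_ge0 ?(ltW eta0) //.
  by rewrite ler_nat /M -addnn leqW // leq_addr.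
have [kap2 kap0 kapP] := sin_bounded_below R oM.
have [d0 anti] := anticoncentration (sqr_ge0 rho) kap0 eta0 etaM.
pose d := maxn d0 (Num.bound (10 * rho)).
have sep : 10 * rho < d%:R.
  apply: lt_le_trans (archi_boundP _) _; first by rewrite mulr_ge0 // ltW.
  by rewrite ler_nat leq_maxr.
(* The modulus is divisible by 5 and by [M], so [w] is a fifth of a turn and [r] an [M]-th; the
   factor [d.+1] ensures [d <= n.+2 ^ 2]. *)
pose n := (5 * M * d.+1 - 2)%N.
have nE : n.+2 = (5 * M * d.+1)%N by rewrite /n -addn2 subnK // /M; nia.
pose chi := trig_char R n; pose w : 'I_n.+2 := (M * d.+1)%:R; pose r : 'I_n.+2 := (5 * d.+1)%:R.
have p0 : 0 < trigo.pi :> R := pi_gt0 R.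
have Mn0 : M%:R != 0 :> R by rewrite pnatr_eq0.
have dn0 : d.+1%:R != 0 :> R by rewrite pnatr_eq0.
have w5 : w *+ 5 = 0.
  rewrite /w -mulrnA mulnC mulnA -nE; apply: val_inj; rewrite Zp_nat /=.
  by rewrite modnn.
have angw : angle R n (M * d.+1) = trigo.pi *+ 2 / 5.
  by rewrite /angle nE !natrM; move: (M%:R) (d.+1%:R) Mn0 dn0 => x y x0 y0; field; rewrite x0 y0.
have cw : cosz chi w = cos (trigo.pi *+ 2 / 5) by rewrite trig_char_cos angw.
have cw0 : 0 < cosz chi w.
  rewrite cw; apply: cos_gt0_pihalf; rewrite -[trigo.pi *+ 2]mulr_natr; apply/andP; split; lra.
have cos_lt1 (x : R) : 0 < x -> x < trigo.pi -> cos x != 1.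
  move=> x0 xpi; have s0 : 0 < sin x by apply: sin_gt0_pi; rewrite x0.
  have h := cos2Dsin2 x; apply: contraTneq s0 => c1.
  by move: h; rewrite c1 expr1n -[RHS]addr0 => /addrI/eqP; rewrite sqrf_eq0 => /eqP ->; rewrite ltxx.
have cw1 : cosz chi w != 1 by rewrite cw; apply: cos_lt1; rewrite -[trigo.pi *+ 2]mulr_natr; lra.
have c1 : cosz chi 1 != 1.
  rewrite -[cosz _ 1]/(cosz _ 1%:R) trig_char_cos /angle mulr1.
  have m5 : 5 <= n.+2%:R :> R by rewrite nE (ler_nat _ 5) -mulnA leq_pmulr // muln_gt0.
  have m0 : 0 < n.+2%:R :> R by rewrite ltr0n.
  apply: cos_lt1; first by rewrite divr_gt0 // mulrn_wgt0.
  by rewrite ltr_pdivrMr // -[trigo.pi *+ 2]mulr_natr; nra.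
have kapr j : (0 < j < M)%N -> kap2 <= sinz chi (r *+ j) ^+ 2.
  move=> hj; rewrite /r -mulrnA trig_char_sin; apply: le_trans (kapP j hj) _.
  suff -> : angle R n (5 * d.+1 * j) = trigo.pi *+ 2 * j%:R / M%:R by [].
  by rewrite /angle nE !natrM; move: (M%:R) (d.+1%:R) Mn0 dn0 => x y x0 y0; field; rewrite x0 y0.
have dn : (d <= n.+2 ^ 2)%N by rewrite nE /M; clear; nia.
have chi_step := trig_char_step R n.
exists ('I_19 * 'rV['I_n.+2]_d)%type, (base_adj chi rho w); split; first split.
- exact: base_adj_sym.
- exact: base_adj_irr.
- by rewrite card_prod card_ord muln_gt0 /=; apply/card_gt0P; exists 0.
split=> [Q Q12 /(base_Kfree rho0 sep w5 cw0 cw1)|A hA|]; first by rewrite Q12.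
  exact: (base_dense rho0 sep w5 cw0 cw1 chi_step dn eps0 _ hA).
have he := base_edges d chi rho w.
have hc := cross_card d rho0 w5 cw1.
have ha := anti n d chi r (leq_maxl _ _) c1 kapr.
move: he hc ha; rewrite card_prod card_ord.
set a := #|[set x | cross_adj _ _ _ _ _]|; set b := #|[set x | (_ < _)%R]|.
set X := #|{: 'rV__}| => he hc ha.
have {}he : (180 * (X%:R * X%:R) + 50 * (X%:R * a%:R)) <= 
    (edges (base_adj chi rho w) setT [set: 'I_19 * 'rV['I_n.+2]_d])%:R :> R.
  by move: he; rewrite -(ler_nat R) natrD !natrM.
have {}hc : X%:R <= 5 * a%:R + 5 * b%:R :> R by move: hc; rewrite -(ler_nat R) natrD !natrM.
apply: le_trans he; rewrite natrX natrM.
have X0 : 0 <= X%:R :> R by [].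
(* The exceptional strip costs [50 eta X^2] of the pairs, within the allowance [361 eta X^2]. *)
have h1 : X%:R * X%:R <= X%:R * (5 * a%:R + 5 * (eta * X%:R)) :> R.
  by rewrite ler_wpM2l //; lra.
have h2 : 0 <= eta * X%:R * X%:R by rewrite !mulr_ge0 // ltW.
nra.
Qed.

Lemma lower_bound_density (R : realType) :
  ((10 / 19)%R%:E <= lower_ramsey_turan_density R 5 12)%E.
Proof.
(* The cap 1/2 keeps [10 / 19 - e] nonnegative, as [blow_up_ratio] requires. *)
apply: le_lower_density => eta eps eta0 eps0; pose e := Num.min (eta / 2) (1 / 2).
have e0 : 0 < e by rewrite lt_min; apply/andP; split; lra.
have e1 : e <= eta / 2 by rewrite ge_min lexx.
have e2 : e <= 1 / 2 by rewrite ge_min lexx orbT.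
have eps40 : 0 < eps / 4 by rewrite divr_gt0.
have [Y [H [[Hs Hi Y0] [Hq Hp He]]]] := torus_graph eps40 e0.
have c0 : 0 <= 10 / 19 - e by lra.
have c1 : 10 / 19 - e <= 1 by lra.
have [N HN] := blow_up_ratio Hs Hi Y0 eps0 e0 c0 c1 Hq Hp He.
by exists N => n /HN h; lra.
Qed.

Theorem theorem1p2 (R : realType) :
  [/\ (upper_ramsey_turan_density R 4 11 <= (4 / 7)%R%:E)%E,
      (upper_ramsey_turan_density R 5 12 <= (10 / 19)%R%:E)%E,
      (upper_ramsey_turan_density R 6 12 <= (5 / 12)%R%:E)%E &
      (upper_ramsey_turan_density R 6 14 <= (12 / 23)%R%:E)%E] /\
  ramsey_turan_density_eq R 5 12 (10 / 19)%R%:E.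
Proof.
have upper p q (D c : R) : turan_bound p q D -> (0 < p)%N -> D / p%:R = c ->
    (upper_ramsey_turan_density R p q <= c%:E)%E.
  by move=> tb p0 <-; exact: upper_bound_density.
have h2 : (upper_ramsey_turan_density R 5 12 <= (10 / 19)%R%:E)%E.
  by apply: upper (turan_bound_5_12 R) _ _ => //; lra.
have h : ((10 / 19)%:E <= lower_ramsey_turan_density R 5 12)%E := lower_bound_density R.
split; first split=> //.
- by apply: upper (turan_bound_4_11 R) _ _ => //; lra.
- by apply: upper (turan_bound_6_12 R) _ _ => //; lra.
- by apply: upper (turan_bound_6_14 R) _ _ => //; lra.
have lu := lower_le_upper_density R 5 12.
by split; apply/eqP; rewrite eq_le ?h ?h2 ?andbT ?(le_trans lu h2) ?(le_trans h lu).
Qed.
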